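(* Let $F$ be a graph with $e(F)>0$, $m=|F|$, and $0<p\le1$. Let $(\alpha_1,\dots,\alpha_r)$ be a vector of positive numbers with $r\ge m$ and $\sum_{i=1}^r\alpha_i\le1$. If either $(\alpha_1,\dots,\alpha_r)\neq(1/r,\dots,1/r)$, or $e(F)>1$ and $F$ is a regular graph, a star, or disconnected, then $\widetilde{\mathcal P}(F;\alpha_1,\dots,\alpha_r)$ is a $p$-quasi-random property.
   Context: Label $V(F)=\{1,\dots,m\}$. For a graph $G$ and $U_1,\dots,U_m\subseteq V(G)$, $N(F,G;U_1,\dots,U_m)$ counts injective homomorphisms $\varphi:V(F)\to V(G)$ with $\varphi(i)\in U_i$, and $\widetilde N(F,G;U_1,\dots,U_m)$ is its average over all $m!$ permutations of $(U_1,\dots,U_m)$; $N(F,G)$ counts injective homomorphisms. A sequence $(G_n)$, $|G_n|\to\infty$, is $p$-quasi-random if $N(H,G_n)=(p^{e(H)}+o(1))|G_n|^{|H|}$ for every graph $H$; a property of sequences is $p$-quasi-random if satisfied exactly by the $p$-quasi-random sequences. $\widetilde{\mathcal P}(F;\alpha_1,\dots,\alpha_r)$ is the property: for all pairwise disjoint $U_1,\dots,U_r\subseteq V(G_n)$ with $|U_i|=\lfloor\alpha_i|G_n|\rfloor$, $\sum_{1\le i_1<\dots<i_m\le r}\widetilde N(F,G_n;U_{i_1},\dots,U_{i_m})=p^{e(F)}\sum_{1\le i_1<\dots<i_m\le r}\prod_{j=1}^m|U_{i_j}|+o(|G_n|^m)$, uniformly in the subsets. *)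

(* Defs.v *)
From HB Require Import structures.
From mathcomp Require Import all_boot all_order all_fingroup all_algebra.
From mathcomp Require Import all_classical all_reals all_analysis.

Set Implicit Arguments.
Unset Strict Implicit.
Unset Printing Implicit Defensive.

Import Order.TTheory GRing.Theory Num.Theory.
Import numFieldNormedType.Exports.

Local Open Scope ring_scope.

Record sgraph (T : finType) := SGraph {
  edge : rel T;
  edge_sym : symmetric edge;
  edge_irr : irreflexive edge
}.

Definition edge_set (T : finType) (F : sgraph T) : {set {set T}} :=
  [set [set x.1; x.2] | x in [pred x : T * T | edge F x.1 x.2]].

Definition num_edges (T : finType) (F : sgraph T) : nat := #|edge_set F|.

Definition degree (T : finType) (F : sgraph T) (x : T) : nat :=
  #|[pred y | edge F x y]|.

Definition regular_graph (T : finType) (F : sgraph T) : Prop :=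
  exists d : nat, forall x : T, degree F x = d.

Definition star_graph (T : finType) (F : sgraph T) : Prop :=
  exists c : T, forall x y : T, edge F x y = ((x == c) != (y == c)).

Definition disconnected (T : finType) (F : sgraph T) : Prop :=
  exists x y : T, ~~ connect (edge F) x y.

Definition inj_hom (S T : finType) (F : sgraph S) (G : sgraph T) :
    {set {ffun S -> T}} :=
  [set phi : {ffun S -> T} | injectiveb phi &&
    [forall x, forall y, edge F x y ==> edge G (phi x) (phi y)]].

Definition N_hom (S T : finType) (F : sgraph S) (G : sgraph T) : nat :=
  #|inj_hom F G|.

Definition N_hom_in (S T : finType) (F : sgraph S) (G : sgraph T)
    (U : S -> {set T}) : nat :=
  #|[set phi in inj_hom F G | [forall i, phi i \in U i]]|.

Definition N_hom_avg (R : realType) (m : nat) (T : finType)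
    (F : sgraph 'I_m) (G : sgraph T) (U : 'I_m -> {set T}) : R :=
  (\sum_(s : 'S_m) (N_hom_in F G (fun i => U (s i)))%:R) / (m`!)%:R.

Definition pairwise_disjoint (r : nat) (T : finType) (U : 'I_r -> {set T}) :
    Prop :=
  forall i j : 'I_r, i != j -> [disjoint U i & U j].

Local Open Scope classical_set_scope.

Record graph_seq := GraphSeq {
  gvert : nat -> finType;
  gseq :> forall n : nat, sgraph (gvert n);
  gvert_cvg : (fun n => #|gvert n|) @ \oo --> \oo
}.

Definition quasi_random (R : realType) (p : R) (G : graph_seq) : Prop :=
  forall (k : nat) (H : sgraph 'I_k),
    exists2 u : nat -> R, u @ \oo --> (0 : R) &
      \forall n \near \oo, (N_hom H (G n))%:R =
        (p ^+ num_edges H + u n) * #|gvert G n|%:R ^+ k.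

Definition quasi_random_property (R : realType) (p : R)
    (P : graph_seq -> Prop) : Prop :=
  forall G : graph_seq, P G <-> quasi_random p G.

(* The index tuples i_1 < ... < i_m in {1, ..., r}. *)
Definition increasing (m r : nat) (i : {ffun 'I_m -> 'I_r}) : bool :=
  [forall a : 'I_m, forall b : 'I_m, (a < b)%N ==> (i a < i b)%N].

Definition P_tilde (R : realType) (p : R) (m : nat) (F : sgraph 'I_m)
    (r : nat) (alpha : 'rV[R]_r) (G : graph_seq) : Prop :=
  forall eps : R, 0 < eps -> \forall n \near \oo,
    forall U : 'I_r -> {set gvert G n},
      pairwise_disjoint U ->
      (forall i, #|U i|%:Z = Num.floor (alpha 0 i * #|gvert G n|%:R)) ->
      `| \sum_(i : {ffun 'I_m -> 'I_r} | increasing i)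
             N_hom_avg R F (G n) (fun j => U (i j))
         - p ^+ num_edges F *
           \sum_(i : {ffun 'I_m -> 'I_r} | increasing i)
             \prod_(j < m) #|U (i j)|%:R |
        <= eps * #|gvert G n|%:R ^+ m.

(* Main.v *)
(** Both properties are compared with the cut condition
    [|e(X, Y) - p |X| |Y|| = o(n^2)] for all [X], [Y].  The cut condition gives
    the counts of all graphs by replacing edges one at a time, and it follows
    from the counts of the subgraphs of the 4-cycle by Cauchy-Schwarz.

    Conversely, let [f x = [x injective] (hom x - p ^ e)] on [m]-tuples of
    vertices.  The property says that [f] is small on average over rainbow
    tuples of any colouring with prescribed class sizes; by a random colouring
    it stays small for fractional colourings [alpha_i + t kappa_i h].  The
    coefficients in [t] show that the components of [f] of degree [k] are small
    for [k <> 1], with [kappa] spread over [k] colours, so that [f] is close to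
    an additive function [g(x_1) + ... + g(x_m)].  When [alpha] is not constant
    [1 / r], some [kappa] has a nonzero coefficient for [k = 1] and [g] vanishes.
    Otherwise, Ramsey's theorem and density increments give families of clusters
    inside two sets [X], [Y] on which [g] is nearly constant, regular to each
    other with densities [u] (inside [X]), [v] (inside [Y]) and [s] (across).
    Counting [F] with one vertex in one family and the others in the other
    family yields polynomial equations in [u, v, s], which force [u = v] as soon
    as [e > 1], by AM-GM.  Hence [g] is constant up to [o(1)], thus small.  The
    same clusters with [g = 0] give the cut condition. *)
Require Import Defs.
From mathcomp Require Import all_boot all_order all_fingroup all_algebra.
From mathcomp Require Import all_classical all_reals all_analysis.
From mathcomp Require Import ring lra zify.
From mathcomp Require polyrcf.

Set Implicit Arguments.
Unset Strict Implicit.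
Unset Printing Implicit Defensive.

Import Order.TTheory GRing.Theory Num.Theory.
Import numFieldNormedType.Exports.

Local Open Scope ring_scope.

(** * Ramsey theorem *)

(** The vector [1 / r] is exceptional in degree one only: the colours then use up all the mass, so
    [kappa] must have sum zero, and the coefficient for [k = 1] is a multiple of that sum. An
    additive deviation is invisible to the rainbow counts of such colourings. It has to be excluded
    by what is special to [f], namely that it counts edges of a graph, and regular clusters give
    access to this. For a single edge the exclusion fails: [s = (u + v) / 2] satisfies both
    equations.

    A few clusters of linear size inside [X] and [Y] are enough, without a partition of all
    vertices, so density increments take the place of the regularity lemma. They control the new
    density from one prescribed side only, which suffices to refute a deviation of known sign.

    All intermediate statements concern a single finite graph, with a tolerance and a threshold for
    the number of vertices fixed before the graph. Compactness of the cube of triples [(u, v, s)]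
    turns the exact rigidity of the equations into such a tolerance. *)

Lemma pigeonhole (T : eqType) (K N : nat) (c : T -> 'I_K) (s : seq T) :
  (K * N < size s)%N -> exists k : 'I_K, (N < count (fun x => c x == k) s)%N.
Proof.
move=> ltKN; apply/existsP; apply: contraLR ltKN.
rewrite negb_exists -leqNgt => /forallP H.
have -> : size s = (\sum_(k < K) count (fun x => c x == k) s)%N.
  elim: s {H} => [|x s IHs] /=; first by rewrite big1.
  rewrite big_split /= -IHs (bigD1 (c x)) //= eqxx big1 ?addn0 ?add1n //.
  by move=> k; rewrite eq_sym => /negbTE ->.
apply: (@leq_trans (\sum_(k < K) N)%N); last by rewrite sum_nat_const card_ord.
by apply: leq_sum => k _; rewrite leqNgt.
Qed.

(** Keeping at each step only the points joined to the head in one frequent colour makes the colour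
    of a pair depend on its earlier member alone; that colour is stored with the head. A pigeonhole
    on the stored colours then gives [ramsey]. Pairs are read in the order of the sequence, so [c]
    may be asymmetric. *)
Lemma ramsey_end_coloured (K L : nat) : exists N : nat,
  forall (T : eqType) (c : T -> T -> 'I_K) (s : seq T), (N <= size s)%N ->
  exists t : seq (T * 'I_K),
    [/\ subseq [seq p.1 | p <- t] s, size t = L &
        pairwise (fun p q => c p.1 q.1 == p.2) t].
Proof.
elim: L => [|L [N IH]]; first by exists 0%N => T c s _; exists [::]; rewrite sub0seq.
exists (K * N).+2 => T c [//|x s] /= lts.
have [|k ltk] := pigeonhole (K := K) (N := N) (c x) (s := s).
  by rewrite ltnS in lts.
rewrite -size_filter in ltk; have [t [sub st pt]] := IH T c _ (ltnW ltk).
exists ((x, k) :: t); split => /=; last 1 first.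
- rewrite pt andbT; apply/allP => q qt.
  have /(mem_subseq sub) : q.1 \in [seq p.1 | p <- t] by apply: map_f.
  by rewrite mem_filter => /andP[].
- by rewrite eqxx; apply: subseq_trans sub (filter_subseq _ _).
- by rewrite st.
Qed.

Lemma ramsey (K m : nat) : exists N : nat,
  forall (T : eqType) (c : T -> T -> 'I_K) (s : seq T), (N <= size s)%N ->
  exists (k : 'I_K) (t : seq T),
    [/\ subseq t s, size t = m & pairwise (fun x y => c x y == k) t].
Proof.
have [N HN] := ramsey_end_coloured K (K * m).+1; exists N => T c s /(HN T c)[t [sub st pt]].
have [|k /ltnW ltk] := pigeonhole (K := K) (N := m) snd (s := t); first by rewrite st.
pose t' := [seq p <- t | p.2 == k].
have {}ltk : (m <= size t')%N by rewrite size_filter.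
have sub' : subseq (take m t') t.
  exact: subseq_trans (take_subseq _ _) (filter_subseq _ _).
exists k, [seq p.1 | p <- take m t']; split.
- exact: subseq_trans (map_subseq _ sub') sub.
- by rewrite size_map size_takel.
- rewrite pairwise_map; have := subseq_pairwise sub' pt.
  apply: sub_in_pairwise (allss _) => p q /mem_take.
  by rewrite mem_filter => /andP[/eqP <- _].
Qed.

Lemma exists_subset_card (V : finType) (A : {set V}) (b : nat) :
  (b <= #|A|)%N -> exists2 B : {set V}, B \subset A & #|B| = b.
Proof.
move=> leb; exists [set x in take b (enum A)].
  by apply/fintype.subsetP => x; rewrite inE => /mem_take; rewrite mem_enum.
rewrite cardsE; have /card_uniqP -> : uniq (take b (enum A)).
  exact: take_uniq (enum_uniq _).
by rewrite size_takel // -cardE.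
Qed.

(** Greedy choice: the sets already chosen cover at most [(#|I| - 1) * b] points of [Q i], which
    leaves [b] of them. *)
Lemma exists_disjoint_subsets (I V : finType) (b : nat) (Q : I -> {set V}) :
  (forall i, #|I| * b <= #|Q i|)%N ->
  exists Z : I -> {set V}, [/\ forall i, Z i \subset Q i, forall i, #|Z i| = b &
    forall i j, i != j -> [disjoint Z i & Z j]].
Proof.
move=> leQ.
suff H (s : seq I) : uniq s -> exists Z : I -> {set V},
    {in s, forall i, Z i \subset Q i /\ #|Z i| = b} /\
    {in s &, forall i j, i != j -> [disjoint Z i & Z j]}.
  have [Z [H1 H2]] := H (enum I) (enum_uniq _).
  by exists Z; split=> [i|i|i j]; [have [] := H1 i _|have [] := H1 i _|apply: H2];
    rewrite ?mem_enum.
elim: s => [|i s IHs] /=; first by move=> _; exists (fun=> finset.set0); split.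
case/andP=> nis us; have [Z [H1 H2]] := IHs us.
pose W := \bigcup_(j in [pred j | j \in s]) Z j.
have leW : (#|W| <= size s * b)%N.
  apply: (@leq_trans (\sum_(j in [pred j | j \in s]) #|Z j|)%N).
    rewrite /W; elim/big_rec2: _ => [|j n A _ le]; first by rewrite cards0.
    by apply: leq_trans (leq_card_setU _ _) _; rewrite leq_add2l.
  rewrite (eq_bigr (fun=> b)) => [|j js]; last by have [] := H1 j js.
  rewrite sum_nat_const leq_mul2r; apply/orP; right.
  exact: card_size.
have lts : (size s < #|I|)%N.
  by rewrite -[(size s).+1]/(size (i :: s)) cardE; apply: uniq_leq_size => //=;
    [rewrite nis us | move=> x _; rewrite mem_enum].
have [|B sB cB] := @exists_subset_card V (Q i :\: W) b.
  have := leQ i; rewrite -(cardsID W (Q i)) => le1.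
  have le2 : (#|Q i :&: W| <= size s * b)%N.
    exact: leq_trans (subset_leq_card (subsetIr _ _)) leW.
  rewrite -(leq_add2l (#|Q i :&: W|)); apply: leq_trans le1.
  apply: (@leq_trans (size s * b + b)); first by rewrite leq_add2r.
  by rewrite -mulSnr leq_mul2r lts orbT.
have dB j : j \in s -> [disjoint B & Z j].
  move=> js; rewrite disjoint_subset; apply/fintype.subsetP => x xB.
  rewrite inE; apply: contraTN xB => xZ; apply/negP => /(fintype.subsetP sB).
  by rewrite inE => /andP[/negP nW _]; apply: nW; apply/finset.bigcupP; exists j.
exists (fun j => if j == i then B else Z j); split.
- move=> j; rewrite inE; case: eqP => [->|_] /=; last exact: H1.
  by move=> _; split=> //; apply: fintype.subset_trans sB (subsetDl _ _).
- move=> j k; rewrite !inE.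
  case: (altP (j =P i)) => [->|nj]; case: (altP (k =P i)) => [->|nk] //=; rewrite ?eqxx //.
  + by move=> _ ks _; apply: dB.
  + by move=> js _ _; rewrite disjoint_sym; apply: dB.
  + exact: H2.
Qed.

(** * Regular pairs and clusters *)

Section Wsum.
Variables (R : realType) (V : finType).
Implicit Types (a : V -> V -> R) (S T X Y : {set V}).

Definition wsum a S T : R := \sum_(x in S) \sum_(y in T) a x y.

Definition unit_valued a := forall x y, 0 <= a x y <= 1.

(** Regularity in cut norm form: the error is relative to the whole of [X] and [Y], with no lower
    bound on [S] and [T], and [s] may differ from the exact density of the pair. The absolute error
    therefore passes to subpairs, and a change of [s] is absorbed in [eps]. *)
Definition regular_pair a (eps s : R) X Y := forall S T,
  S \subset X -> T \subset Y ->
  `|wsum a S T - s * #|S|%:R * #|T|%:R| <= eps * #|X|%:R * #|Y|%:R.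

Lemma wsum_ge0 a S T : unit_valued a -> 0 <= wsum a S T.
Proof.
move=> Ha; apply: sumr_ge0 => x _; apply: sumr_ge0 => y _.
by case/andP: (Ha x y).
Qed.

Lemma wsum_le a S T : unit_valued a -> wsum a S T <= #|S|%:R * #|T|%:R.
Proof.
move=> Ha; rewrite -[X in X * _]mulr1 -mulrA mulr_natl -sumr_const.
apply: ler_sum => x _; rewrite mul1r -sumr_const; apply: ler_sum => y _.
by case/andP: (Ha x y).
Qed.

Lemma wsum_setIDl a S X T : S \subset X ->
  wsum a X T = wsum a S T + wsum a (X :\: S) T.
Proof. by move=> /finset.setIidPr sSX; rewrite /wsum (big_setID S) /= sSX. Qed.

Lemma wsum_setIDr a S T Y : T \subset Y ->
  wsum a S Y = wsum a S T + wsum a S (Y :\: T).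
Proof.
move=> /finset.setIidPr sTY; rewrite /wsum -big_split; apply: eq_bigr => x _ /=.
by rewrite (big_setID T) /= sTY.
Qed.

Lemma wsumC a S T : (forall x y, a x y = a y x) -> wsum a S T = wsum a T S.
Proof.
move=> sa; rewrite /wsum exchange_big; apply: eq_bigr => x _.
by apply: eq_bigr => y _; rewrite sa.
Qed.

Lemma wsumBr a (s : R) S T :
  wsum (fun x y => a x y - s) S T = wsum a S T - s * #|S|%:R * #|T|%:R.
Proof.
rewrite /wsum; under eq_bigr do rewrite sumrB sumr_const.
by rewrite sumrB sumr_const; congr (_ - _); rewrite -mulrnA -[s *+ _]mulr_natr natrM; ring.
Qed.

Lemma wsum1B a S T :
  wsum (fun x y => 1 - a x y) S T = #|S|%:R * #|T|%:R - wsum a S T.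
Proof.
rewrite /wsum; under eq_bigr do rewrite sumrB sumr_const.
by rewrite sumrB sumr_const mulr_natl.
Qed.

Lemma regular_pair_sub a eps s X Y (eps' : R) X' Y' :
  regular_pair a eps s X Y -> X' \subset X -> Y' \subset Y ->
  eps * #|X|%:R * #|Y|%:R <= eps' * #|X'|%:R * #|Y'|%:R ->
  regular_pair a eps' s X' Y'.
Proof.
move=> H sX sY le S T sS sT; apply: le_trans le.
by apply: H; [apply: fintype.subset_trans sX|apply: fintype.subset_trans sY].
Qed.

Lemma regular_pair_density a eps s X Y (u d : R) :
  regular_pair a eps s X Y -> 0 <= d -> `|s - u| <= d ->
  regular_pair a (eps + d) u X Y.
Proof.
move=> H d0 le S T sS sT; have := H S T sS sT.
set A := wsum _ _ _ => HA.
have -> : A - u * #|S|%:R * #|T|%:R =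
    (A - s * #|S|%:R * #|T|%:R) + (s - u) * (#|S|%:R * #|T|%:R) by ring.
apply: le_trans (ler_normD _ _) _; rewrite -[leRHS]mulrA [leRHS]mulrDl lerD //; first by rewrite mulrA.
rewrite normrM ler_pM ?normr_ge0 // normrM !normr_nat.
by rewrite ler_pM ?ler0n // ler_nat subset_leq_card.
Qed.

Lemma regular_pairC a eps s X Y : (forall x y, a x y = a y x) ->
  regular_pair a eps s X Y -> regular_pair a eps s Y X.
Proof.
move=> sa H S T sS sT; rewrite wsumC // -mulrA [#|S|%:R * _]mulrC mulrA.
by rewrite -[leRHS]mulrA [#|Y|%:R * _]mulrC mulrA; apply: H.
Qed.

Lemma regular_pair1B a eps s X Y :
  regular_pair (fun x y => 1 - a x y) eps s X Y ->
  regular_pair a eps (1 - s) X Y.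
Proof.
move=> H S T sS sT; have := H S T sS sT; rewrite wsum1B -normrN.
by congr (`|_| <= _); ring.
Qed.

(** The deviations of the four quadrants cut out by [S] and [T] add up to zero. If that of the first
    exceeds [3 q] in absolute value, then either it is itself at least [q], or the other three add
    up to more than [3 q] and one of them is at least [q]. *)
Lemma irregular_increment a (e s : R) X Y : unit_valued a -> 0 < e -> 0 <= s ->
  wsum a X Y = s * #|X|%:R * #|Y|%:R -> ~ regular_pair a (3 * e) s X Y ->
  exists S T, [/\ S \subset X, T \subset Y &
    e * #|X|%:R * #|Y|%:R <= wsum a S T - s * #|S|%:R * #|T|%:R].
Proof.
move=> Ha e0 s0 es /existsNP[S /existsNP[T]].
case/not_implyP => sS /not_implyP[sT] /negP; rewrite -ltNge -wsumBr.
set b := fun x y => _.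
have b0 : wsum b X Y = 0 by rewrite wsumBr es subrr.
have E : 0 = wsum b S T + wsum b S (Y :\: T) + wsum b (X :\: S) T +
    wsum b (X :\: S) (Y :\: T).
  by rewrite -b0 (wsum_setIDl _ _ sS) (wsum_setIDr _ _ sT) (wsum_setIDr _ (X :\: S) sT) !addrA.
set q := e * _ * _; have q0 : 0 <= q by rewrite !mulr_ge0 ?ler0n // ltW.
have -> : 3 * e * #|X|%:R * #|Y|%:R = 3 * q by rewrite /q !mulrA.
move=> lt.
have [l1|l1] := leP q (wsum b S T).
  by exists S, T; split=> //; rewrite -wsumBr.
have {lt} l2 : wsum b S T < - 3 * q.
  have [p|p] := leP 0 (wsum b S T); last by rewrite ltr0_norm // in lt; lra.
  by rewrite ger0_norm // in lt; lra.
have [l3|l3] := leP q (wsum b S (Y :\: T)).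
  by exists S, (Y :\: T); rewrite -wsumBr; split=> //; apply: subsetDl.
have [l4|l4] := leP q (wsum b (X :\: S) T).
  by exists (X :\: S), T; rewrite -wsumBr; split=> //; apply: subsetDl.
exists (X :\: S), (Y :\: T); rewrite -wsumBr; split; try exact: subsetDl.
by rewrite -/b; lra.
Qed.

End Wsum.

(** Here [k] bounds the number of increments still possible: each raises the density by at least
    [e], and density never exceeds 1. An increment of [e |X| |Y|] is at most [|S| |T|], so each side
    shrinks by a factor of at least [e] per step. *)
Lemma density_increment_iter (R : realType) (e : R) (k : nat) :
  0 < e -> e <= 1 -> forall (V : finType) (a : V -> V -> R) (X Y : {set V}),
  unit_valued a -> (0 < #|X|)%N -> (0 < #|Y|)%N ->
  1 - k%:R * e < wsum a X Y / (#|X|%:R * #|Y|%:R) ->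
  exists (X' Y' : {set V}) (s : R),
    [/\ X' \subset X, Y' \subset Y, e ^+ k * #|X|%:R <= #|X'|%:R,
        e ^+ k * #|Y|%:R <= #|Y'|%:R &
        [/\ wsum a X Y <= s * #|X|%:R * #|Y|%:R, 0 <= s, s <= 1 &
            regular_pair a (3 * e) s X' Y']].
Proof.
move=> e0 e1 V a; elim: k => [|k IHk] X Y Ha X0 Y0.
  rewrite mul0r subr0 ltr_pdivlMr ?mulr_gt0 ?ltr0n // mul1r ltNge.
  by rewrite wsum_le.
set x : R := #|X|%:R; set y : R := #|Y|%:R.
have x0 : 0 < x by rewrite ltr0n.
have y0 : 0 < y by rewrite ltr0n.
set s := _ / _ => ltk.
have es : wsum a X Y = s * x * y.
  by rewrite /s -mulrA divfK // mulf_neq0 // gt_eqF.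
have s0 : 0 <= s by rewrite divr_ge0 ?wsum_ge0 // mulr_ge0 // ltW.
have s1 : s <= 1.
  by rewrite ler_pdivrMr ?mulr_gt0 // mul1r wsum_le.
have [H|H] := pselect (regular_pair a (3 * e) s X Y).
  exists X, Y, s; split=> //; try by rewrite ger_pMl // exprn_ile1 // ltW.
  by split=> //; rewrite es.
have [S [T [sS sT le]]] := irregular_increment Ha e0 s0 es H.
rewrite -/x -/y in le.
set x1 : R := #|S|%:R in le; set y1 : R := #|T|%:R in le.
have lx : x1 <= x by rewrite ler_nat subset_leq_card.
have ly : y1 <= y by rewrite ler_nat subset_leq_card.
have x10 : 0 <= x1 by rewrite ler0n.
have y10 : 0 <= y1 by rewrite ler0n.
have le1 : e * x * y <= x1 * y1.
  apply: le_trans le _; apply: le_trans (wsum_le _ _ Ha) => //.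
  by rewrite lerBlDr lerDl mulr_ge0 // mulr_ge0.
have lex : e * x <= x1.
  rewrite -(ler_pM2r y0); apply: le_trans le1 _; exact: ler_wpM2l.
have ley : e * y <= y1.
  rewrite -(ler_pM2r x0) mulrAC; apply: le_trans le1 _; rewrite mulrC.
  exact: ler_wpM2l.
have x1p : 0 < x1 by apply: lt_le_trans lex; apply: mulr_gt0.
have y1p : 0 < y1 by apply: lt_le_trans ley; apply: mulr_gt0.
have led : s + e <= wsum a S T / (x1 * y1).
  rewrite ler_pdivlMr ?mulr_gt0 //.
  have : e * (x1 * y1) <= e * x * y.
    by rewrite -mulrA; apply: ler_wpM2l; [apply: ltW|apply: ler_pM].
  move: le; set q := wsum a S T; nra.
have [|||X' [Y' [s' [sX sY lX lY [w1 w2 w3 w4]]]]] := IHk S T Ha.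
- by rewrite -(ltr0n R).
- by rewrite -(ltr0n R).
- by apply: lt_le_trans led; move: ltk; rewrite -natr1; lra.
have les : s <= s'.
  have : wsum a S T / (x1 * y1) <= s' by rewrite ler_pdivrMr ?mulr_gt0 // mulrA.
  by lra.
have ek : 0 <= e ^+ k by rewrite exprn_ge0 // ltW.
exists X', Y', s'; split.
- exact: fintype.subset_trans sX sS.
- exact: fintype.subset_trans sY sT.
- by rewrite exprSr -mulrA; apply: le_trans lX; apply: ler_wpM2l.
- by rewrite exprSr -mulrA; apply: le_trans lY; apply: ler_wpM2l.
split=> //; rewrite es; apply: ler_wpM2r; first exact: ltW.
by apply: ler_wpM2r; first exact: ltW.
Qed.

(* [up] selects whether the density of the regular pair is at least or at most
   that of the original pair. *)
Lemma exists_regular_pair (R : realType) (eps : R) : 0 < eps ->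
  exists2 kappa : R, 0 < kappa & forall (up : bool) (V : finType)
    (a : V -> V -> R) (X Y : {set V}),
  unit_valued a -> (0 < #|X|)%N -> (0 < #|Y|)%N ->
  exists (X' Y' : {set V}) (s : R),
    [/\ X' \subset X, Y' \subset Y, kappa * #|X|%:R <= #|X'|%:R,
        kappa * #|Y|%:R <= #|Y'|%:R &
        [/\ if up then wsum a X Y <= s * #|X|%:R * #|Y|%:R
            else s * #|X|%:R * #|Y|%:R <= wsum a X Y,
            0 <= s, s <= 1 & regular_pair a eps s X' Y']].
Proof.
move=> eps0; pose e : R := Num.min 1 (eps / 3).
have e0 : 0 < e by rewrite lt_min ltr01 divr_gt0.
have e1 : e <= 1 by rewrite ge_min lexx.
have e3 : 3 * e <= eps by rewrite mulrC -ler_pdivlMr // ge_min lexx orbT.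
(* So many increments that the lower bound [1 - k e] is negative and every pair qualifies. *)
pose k := (Num.truncn e^-1).+1.
have ke : 1 - k%:R * e < 0.
  rewrite subr_lt0 -ltr_pdivrMr // div1r.
  by have /andP[] := truncn_itv (ltW (etrans (invr_gt0 e) e0)).
exists (e ^+ k); first exact: exprn_gt0.
have up (V : finType) (a : V -> V -> R) (X Y : {set V}) : unit_valued a ->
    (0 < #|X|)%N -> (0 < #|Y|)%N -> exists (X' Y' : {set V}) (s : R),
    [/\ X' \subset X, Y' \subset Y, e ^+ k * #|X|%:R <= #|X'|%:R,
        e ^+ k * #|Y|%:R <= #|Y'|%:R &
        [/\ wsum a X Y <= s * #|X|%:R * #|Y|%:R,
            0 <= s, s <= 1 & regular_pair a eps s X' Y']].
  move=> Ha X0 Y0.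
  have [|X' [Y' [s [? ? ? ? [? ? ? H]]]]] := density_increment_iter (k := k) e0 e1 Ha X0 Y0.
    by apply: lt_le_trans ke _; rewrite divr_ge0 ?wsum_ge0 // mulr_ge0 ?ler0n.
  exists X', Y', s; split=> //; split=> //; apply: regular_pair_sub H _ _ _ => //.
  by rewrite !ler_wpM2r ?ler0n.
case=> V a X Y Ha X0 Y0; first exact: up.
(* The downward case is the upward case for the complementary weights [1 - a]. *)
have Ha' : unit_valued (fun x y => 1 - a x y).
  by move=> x y; have /andP[] := Ha x y; rewrite subr_ge0 gerBl => -> ->.
have [X' [Y' [s [? ? ? ? [le s0 s1 H]]]]] := up _ _ _ _ Ha' X0 Y0.
exists X', Y', (1 - s); split=> //; split; rewrite ?subr_ge0 ?gerBl //.
  by move: le; rewrite wsum1B; lra.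
exact: regular_pair1B.
Qed.

(** The pairs are treated one after the other. The head pair is made regular before the rest, which
    may shrink each of its sides by the factor [k']; hence its precision [eps * k' ^+ 2]. The
    entries of a pair must differ for the two sets to be replaced independently. *)
Lemma exists_regular_family (R : realType) (I : eqType) (L : seq (I * I))
    (eps : R) : 0 < eps -> all (fun q => q.1 != q.2) L ->
  exists2 kappa : R, 0 < kappa & forall (V : finType) (a : V -> V -> R)
    (Z : I -> {set V}), unit_valued a -> (forall i, 0 < #|Z i|)%N ->
  exists (B : I -> {set V}) (w : I -> I -> R),
    [/\ forall i, B i \subset Z i, forall i, kappa * #|Z i|%:R <= #|B i|%:R &
      forall i j, (i, j) \in L ->
        [/\ 0 <= w i j, w i j <= 1 & regular_pair a eps (w i j) (B i) (B j)]].
Proof.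
move=> eps0; elim: L => [|[i j] L IHL] /=.
  move=> _; exists 1 => // V a Z Ha Z0; exists Z, (fun _ _ => 0).
  by split=> // k; rewrite mul1r.
case/andP=> nij /IHL[k' k'0 H']; have [|k k0 H] := @exists_regular_pair R (eps * k' ^+ 2).
  by rewrite mulr_gt0 // exprn_gt0.
pose k1 := Num.min 1 k.
have k10 : 0 < k1 by rewrite lt_min ltr01.
exists (k' * k1); first exact: mulr_gt0.
move=> V a Z Ha Z0.
have [X [Y [s [sX sY lX lY [_ s0 s1 Hs]]]]] := H true V a (Z i) (Z j) Ha (Z0 i) (Z0 j).
pose Z' l := if l == i then X else if l == j then Y else Z l.
have Zi : Z' i = X by rewrite /Z' eqxx.
have Zj : Z' j = Y by rewrite /Z' eq_sym (negbTE nij) eqxx.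
have le1 l : k1 * #|Z l|%:R <= #|Z' l|%:R :> R.
  rewrite /Z'; case: eqP => [->|_]; last case: eqP => [->|_].
  - by apply: le_trans lX; rewrite ler_wpM2r // ge_min lexx orbT.
  - by apply: le_trans lY; rewrite ler_wpM2r // ge_min lexx orbT.
  - by rewrite ger_pMl ?ge_min ?lexx // ltr0n.
have sZ l : Z' l \subset Z l.
  by rewrite /Z'; case: eqP => [->|_] //; case: eqP => [->|_].
have Z'0 l : (0 < #|Z' l|)%N.
  by rewrite -(ltr0n R); apply: lt_le_trans (le1 l); rewrite mulr_gt0 ?ltr0n.
have [B [w [sB lB HB]]] := H' V a Z' Ha Z'0.
exists B, (fun l l' => if (l, l') == (i, j) then s else w l l'); split.
- by move=> l; apply: fintype.subset_trans (sB l) (sZ l).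
- move=> l; apply: le_trans (lB l); rewrite -mulrA ler_wpM2l //; exact: ltW.
move=> l l'; rewrite inE; case: eqP => [[-> ->] _|_] /=; last exact: HB.
split=> //; apply: regular_pair_sub Hs _ _ _.
- by rewrite -Zi.
- by rewrite -Zj.
rewrite -Zi -Zj; have := lB i; have := lB j.
set x := #|B i|%:R; set y := #|B j|%:R; set x' := #|_|%:R; set y' := #|_|%:R.
move=> l1 l2; have -> : eps * k' ^+ 2 * y' * x' = eps * ((k' * y') * (k' * x')) by ring.
rewrite -[leRHS]mulrA ler_pM2l // ler_pM // mulr_ge0 ?ler0n //; exact: ltW.
Qed.

(** Ramsey's theorem for the colouring of pairs by their density rounded down to a multiple of
    [1 / K]; rounding costs [1 / K] in regularity. *)
Lemma homogeneous_subfamily (R : realType) (m K : nat) : (0 < K)%N ->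
  exists M : nat, (0 < M)%N /\ forall (V : finType) (a : V -> V -> R) (eps : R)
    (B : 'I_M -> {set V}) (w : 'I_M -> 'I_M -> R),
  (forall x y, a x y = a y x) ->
  (forall i j : 'I_M, (i < j)%N ->
     [/\ 0 <= w i j, w i j <= 1 & regular_pair a eps (w i j) (B i) (B j)]) ->
  exists (u : R) (t : 'I_m -> 'I_M), [/\ 0 <= u <= 1, injective t &
    forall i j, i != j -> regular_pair a (eps + K%:R^-1) u (B (t i)) (B (t j))].
Proof.
move=> K0; have [N HN] := ramsey K.+1 m; exists N.+1; split=> // V a eps B w sa Hw.
have K0R : 0 < K%:R :> R by rewrite ltr0n.
(* The rounded densities are [0 / K] to [K / K], which makes [K.+1] colours. *)
pose c (i j : 'I_N.+1) : 'I_K.+1 := inord (Num.truncn (w i j * K%:R)).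
have [|k [t [sub st pt]]] := HN _ c (enum 'I_N.+1); first by rewrite size_enum_ord.
have lt_t : pairwise (fun i j : 'I_N.+1 => (i < j)%N) t.
  apply: subseq_pairwise sub _.
  rewrite -(pairwise_map (val : 'I_N.+1 -> nat) ltn) val_enum_ord.
  by rewrite -sorted_pairwise ?iota_ltn_sorted //; apply: ltn_trans.
pose T (i : 'I_m) := nth ord0 t i.
have szt (i : 'I_m) : nat_of_ord i \in [pred i | i < size t]%N by rewrite inE st.
have H1 (i j : 'I_m) : (i < j)%N -> (T i < T j)%N.
  by move=> ltij; have /(pairwiseP ord0) := lt_t; apply.
have H2 (i j : 'I_m) : (i < j)%N -> c (T i) (T j) = k.
  by move=> ltij; have /(pairwiseP ord0)/(_ i j (szt i) (szt j) ltij)/eqP := pt.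
have injT : injective T.
  move=> i j eqT; apply/val_inj; case: (ltngtP i j) => // /H1; by rewrite eqT ltnn.
exists (k%:R / K%:R), T; split=> //.
  rewrite divr_ge0 ?ler0n //= ler_pdivrMr // mul1r ler_nat -ltnS; exact: ltn_ord.
have H3 (i j : 'I_m) : (i < j)%N ->
    regular_pair a (eps + K%:R^-1) (k%:R / K%:R) (B (T i)) (B (T j)).
  move=> ltij; have [w0 w1 Hr] := Hw _ _ (H1 _ _ ltij).
  apply: regular_pair_density Hr _ _; first by rewrite invr_ge0 ler0n.
  have wK0 : 0 <= w (T i) (T j) * K%:R by rewrite mulr_ge0 ?ler0n.
  have /andP[le1 le2] := truncn_itv wK0.
  have := H2 _ _ ltij; move/(congr1 val); rewrite /= inordK => [<-|]; last first.
    by rewrite ltnS -(ler_nat R) -[leRHS]mul1r (le_trans le1) // ler_wpM2r.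
  set z := _%:R; have -> : w (T i) (T j) - z / K%:R = (w (T i) (T j) * K%:R - z) / K%:R.
    by rewrite mulrBl mulfK // gt_eqF.
  rewrite normrM (gtr0_norm (x := K%:R^-1)) ?invr_gt0 //.
  rewrite ler_piMl ?invr_ge0 ?ler0n // ger0_norm ?subr_ge0 //.
  by move: le2; rewrite -natr1 -/z; lra.
move=> i j; rewrite neq_ltn => /orP[|] lt; first exact: H3.
by apply: regular_pairC => //; apply: H3.
Qed.

(** [X] and [Y] may overlap. Half of the smaller set is removed from the larger one, which loses at
    most half of its points. *)
Lemma exists_disjoint_halves_le (V : finType) (X Y : {set V}) : (#|X| <= #|Y|)%N ->
  exists P Q : {set V}, [/\ P \subset X, Q \subset Y, [disjoint P & Q],
    (#|X| <= (#|P|).*2.+1)%N & (#|Y| <= (#|Q|).*2.+1)%N].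
Proof.
move=> leXY; have [|P sP cP] := @exists_subset_card V X (#|X|./2).
  by rewrite leq_half_double; lia.
exists P, (Y :\: P); split=> //; first exact: subsetDl.
- by rewrite -setI_eq0; apply/eqP/finset.setP => x; rewrite !inE; case: (x \in P).
- by rewrite cP; lia.
- have := cardsID P Y; have := subset_leq_card (subsetIr Y P); rewrite cP.
  by move: #|Y :&: P| #|Y :\: P| => ? ?; lia.
Qed.

Lemma exists_disjoint_halves (V : finType) (X Y : {set V}) :
  exists P Q : {set V}, [/\ P \subset X, Q \subset Y, [disjoint P & Q],
    (#|X| <= (#|P|).*2.+1)%N & (#|Y| <= (#|Q|).*2.+1)%N].
Proof.
have [|/ltnW] := leqP #|X| #|Y|; first exact: exists_disjoint_halves_le.
case/exists_disjoint_halves_le => Q [P [? ? ? ? ?]].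
by exists P, Q; split=> //; rewrite disjoint_sym.
Qed.

(** With [4 M] points in a set, its half has at least [2 M], so each of the [M] blocks is nonempty
    and rounding down their size at most doubles the loss; 8 is a safe constant. *)
Lemma exists_disjoint_blocks (V : finType) (M : nat) (X Y : {set V}) :
  (0 < M)%N -> (4 * M <= #|X|)%N -> (4 * M <= #|Y|)%N ->
  exists Zx Zy : 'I_M -> {set V},
  [/\ forall i, [/\ Zx i \subset X, Zy i \subset Y,
        (#|X| <= 8 * M * #|Zx i|)%N & (#|Y| <= 8 * M * #|Zy i|)%N] &
      forall i j, [/\ [disjoint Zx i & Zy j], i != j -> [disjoint Zx i & Zx j] &
        i != j -> [disjoint Zy i & Zy j]]].
Proof.
move=> M0 leX leY; have [P [Q [sP sQ dPQ cP cQ]]] := exists_disjoint_halves X Y.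
have blocks (W : {set V}) : exists Z : 'I_M -> {set V}, [/\ forall i, Z i \subset W,
    forall i, #|Z i| = (#|W| %/ M)%N & forall i j, i != j -> [disjoint Z i & Z j]].
  by apply: exists_disjoint_subsets => _; rewrite card_ord mulnC leq_trunc_div.
have size_le (x w : nat) : (4 * M <= x)%N -> (x <= w.*2.+1)%N -> (x <= 8 * M * (w %/ M))%N.
  move=> l1 l2; have l3 : (0 < w %/ M)%N by rewrite divn_gt0 //; lia.
  have := ltn_ceil w M0; move: (w %/ M)%N l3 => d d0; nia.
have [Zx [sx cx dx]] := blocks P; have [Zy [sy cy dy]] := blocks Q.
exists Zx, Zy; split=> [i|i j].
  split; first exact: fintype.subset_trans (sx i) sP.
  - exact: fintype.subset_trans (sy i) sQ.
  - by rewrite cx; apply: size_le.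
  - by rewrite cy; apply: size_le.
split; [|exact: dx|exact: dy].
exact: disjointWl (sx i) (disjointWr (sy j) dPQ).
Qed.

(** The pair [(X, Y)] is regularised first, with the required direction of the density, and so
    precisely that all later subsets inherit it. The density across is thus the same [s] for all
    pairs of clusters, and only pairs on the same side, listed in [L], have to be regularised and
    made homogeneous by Ramsey's theorem. *)
Lemma exists_clusters (R : realType) (m : nat) (eps theta : R) :
  0 < eps -> 0 < theta -> exists2 beta : R, 0 < beta & exists n0 : nat,
  forall (up : bool) (V : finType) (a : V -> V -> R) (X Y : {set V}),
  unit_valued a -> (forall x y, a x y = a y x) -> (n0 <= #|V|)%N ->
  theta * #|V|%:R <= #|X|%:R -> theta * #|V|%:R <= #|Y|%:R ->
  exists (Bx By : 'I_m -> {set V}) (u v s : R),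
  [/\ forall i, [/\ Bx i \subset X, By i \subset Y, beta * #|V|%:R <= #|Bx i|%:R &
        beta * #|V|%:R <= #|By i|%:R],
      forall i j, [/\ [disjoint Bx i & By j], i != j -> [disjoint Bx i & Bx j] &
        i != j -> [disjoint By i & By j]],
      [/\ 0 <= u <= 1, 0 <= v <= 1 & 0 <= s <= 1],
      forall i j, [/\ regular_pair a eps s (Bx i) (By j),
        i != j -> regular_pair a eps u (Bx i) (Bx j) &
        i != j -> regular_pair a eps v (By i) (By j)] &
      if up then wsum a X Y <= s * #|X|%:R * #|Y|%:R
      else s * #|X|%:R * #|Y|%:R <= wsum a X Y].
Proof.
move=> eps0 theta0; pose K := (Num.truncn (2 / eps)).+1.
have K0 : (0 < K)%N by [].
have Keps : K%:R^-1 <= eps / 2.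
  rewrite -[eps / 2]invrK lef_pV2 ?posrE ?invr_gt0 ?divr_gt0 ?ltr0n // invf_div.
  by have /andP[_ /ltW] := truncn_itv (ltW (divr_gt0 (ltr0n R 2) eps0)).
have [M [M0 HM]] := @homogeneous_subfamily R m K K0.
pose I : finType := (bool * 'I_M)%type.
pose L := [seq q : I * I <- enum {: I * I} | (q.1.1 == q.2.1) && (q.1.2 < q.2.2)%N].
have Lneq : all (fun q => q.1 != q.2) L.
  apply/allP => -[[b i] [b' j]]; rewrite mem_filter /= => /andP[/andP[_ lt] _].
  by apply: contraTneq lt => -[_ ->]; rewrite ltnn.
have e20 : 0 < eps / 2 by rewrite divr_gt0.
have [k2 k20 H2] := exists_regular_family e20 Lneq.
have M0R : 0 < M%:R :> R by rewrite ltr0n.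
(* The proportion of [X'] or [Y'] kept in a cluster: the blocks cost [8 M], the regular family
   [k2]. *)
pose c := k2 / (8 * M%:R); have c0 : 0 < c by rewrite divr_gt0 // mulr_gt0.
have [|k1 k10 H1] := @exists_regular_pair R (eps * c ^+ 2).
  by rewrite mulr_gt0 // exprn_gt0.
exists (c * (k1 * theta)); first by rewrite mulr_gt0 // mulr_gt0.
exists (Num.truncn (4 * M%:R / (k1 * theta))).+1 => up V a X Y Ha sa len leX leY.
have len' : 4 * M%:R <= k1 * theta * #|V|%:R.
  rewrite [leRHS]mulrC -ler_pdivrMr ?mulr_gt0 //; apply: le_trans (_ : _ <= _.+1%:R) _.
    by have /andP[_ /ltW h] := truncn_itv (ltW (divr_gt0 (mulr_gt0 (ltr0n R 4) M0R) (mulr_gt0 k10 theta0))); exact: h.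
  by rewrite ler_nat.
have V0 : 0 < #|V|%:R :> R.
  have : 0 < k1 * theta * #|V|%:R by apply: lt_le_trans len'; rewrite mulr_gt0.
  by rewrite pmulr_rgt0 // mulr_gt0.
have X0 : (0 < #|X|)%N by rewrite -(ltr0n R); apply: lt_le_trans leX; rewrite mulr_gt0.
have Y0 : (0 < #|Y|)%N by rewrite -(ltr0n R); apply: lt_le_trans leY; rewrite mulr_gt0.
have [X' [Y' [s [sX sY lX lY [dir s0 s1 Hs]]]]] := H1 up V a X Y Ha X0 Y0.
have lX' : k1 * theta * #|V|%:R <= #|X'|%:R.
  by apply: le_trans lX; rewrite -mulrA ler_pM2l.
have lY' : k1 * theta * #|V|%:R <= #|Y'|%:R.
  by apply: le_trans lY; rewrite -mulrA ler_pM2l.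
have X'4 : (4 * M <= #|X'|)%N by rewrite -(ler_nat R) natrM; apply: le_trans lX'.
have Y'4 : (4 * M <= #|Y'|)%N by rewrite -(ler_nat R) natrM; apply: le_trans lY'.
have [Zx [Zy [HZ dZ]]] := exists_disjoint_blocks M0 X'4 Y'4.
pose Z (q : I) := if q.1 then Zx q.2 else Zy q.2.
have pos_size (x z : nat) : (4 * M <= x)%N -> (x <= 8 * M * z)%N -> (0 < z)%N.
  move=> l1 l2; have : (0 < 8 * M * z)%N.
    by apply: leq_trans l2; apply: leq_trans l1; rewrite muln_gt0.
  by rewrite muln_gt0 => /andP[].
have Z0 q : (0 < #|Z q|)%N.
  rewrite /Z; have [_ _ l1 l2] := HZ q.2.
  by case: q.1; [apply: pos_size X'4 l1|apply: pos_size Y'4 l2].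
have [B [w [sB lB HB]]] := H2 V a Z Ha Z0.
have HBb b (i j : 'I_M) : (i < j)%N -> [/\ 0 <= w (b, i) (b, j), w (b, i) (b, j) <= 1 &
    regular_pair a (eps / 2) (w (b, i) (b, j)) (B (b, i)) (B (b, j))].
  by move=> lt; apply: HB; rewrite mem_filter /= eqxx lt mem_enum.
have [u [tx [u01 tx_inj Hu]]] := HM V a (eps / 2) (fun i => B (true, i)) (fun i j => w (true, i) (true, j)) sa (HBb true).
have [v [ty [v01 ty_inj Hv]]] := HM V a (eps / 2) (fun i => B (false, i)) (fun i j => w (false, i) (false, j)) sa (HBb false).
have sum_eps (x : R) (U W : {set V}) : regular_pair a (eps / 2 + K%:R^-1) x U W ->
    regular_pair a eps x U W.
  move=> H; apply: regular_pair_sub H _ _ _ => //; rewrite -!mulrA ler_wpM2r ?mulr_ge0 ?ler0n //.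
  by rewrite [leRHS](splitr eps) lerD2l.
have ncard (W U U' : {set V}) : (#|W| <= 8 * M * #|U|)%N -> k2 * #|U|%:R <= #|U'|%:R ->
    c * #|W|%:R <= #|U'|%:R.
  move=> l1 l2; apply: le_trans l2; rewrite /c mulrAC ler_pdivrMr ?mulr_gt0 //.
  by rewrite -mulrA ler_pM2l // mulrC -!natrM ler_nat.
have cX i : c * #|X'|%:R <= #|B (true, tx i)|%:R.
  by have [_ _ l _] := HZ (tx i); apply: ncard l (lB (true, tx i)).
have cY i : c * #|Y'|%:R <= #|B (false, ty i)|%:R.
  by have [_ _ _ l] := HZ (ty i); apply: ncard l (lB (false, ty i)).
have sX' i : B (true, tx i) \subset X'.
  by apply: fintype.subset_trans (sB _) _; have [] := HZ (tx i).
have sY' i : B (false, ty i) \subset Y'.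
  by apply: fintype.subset_trans (sB _) _; have [] := HZ (ty i).
exists (fun i => B (true, tx i)), (fun i => B (false, ty i)), u, v, s; split=> //.
- move=> i; split.
  + exact: fintype.subset_trans (sX' i) sX.
  + exact: fintype.subset_trans (sY' i) sY.
  + by apply: le_trans (cX i); rewrite -mulrA ler_pM2l.
  + by apply: le_trans (cY i); rewrite -mulrA ler_pM2l.
- move=> i j; split.
  + apply: disjointWl (sB _) (disjointWr (sB _) _).
    by have [] := dZ (tx i) (ty j).
  + move=> nij; apply: disjointWl (sB _) (disjointWr (sB _) _).
    by have [_ h _] := dZ (tx i) (tx j); apply: h; rewrite (inj_eq tx_inj).
  + move=> nij; apply: disjointWl (sB _) (disjointWr (sB _) _).
    by have [_ _ h] := dZ (ty i) (ty j); apply: h; rewrite (inj_eq ty_inj).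
- by split=> //; rewrite s0 s1.
- move=> i j; split.
  + apply: regular_pair_sub Hs _ _ _ => //.
    have -> : eps * c ^+ 2 * #|X'|%:R * #|Y'|%:R =
      eps * ((c * #|X'|%:R) * (c * #|Y'|%:R)) by ring.
    rewrite -[leRHS]mulrA ler_pM2l //.
    by apply: ler_pM => //; rewrite mulr_ge0 ?ler0n // ltW.
  + by move=> nij; apply: sum_eps; apply: Hu.
  + by move=> nij; apply: sum_eps; apply: Hv.
Qed.

(** * Counting homomorphisms *)

Definition upd (I V : finType) (x : {ffun I -> V}) (i : I) (a : V) : {ffun I -> V} :=
  [ffun k => if k == i then a else x k].

(** Resampling a coordinate: exchanging the new value [a] with [y i] is an involution on pairs
    [(y, a)]. *)
Lemma sum_upd (R : realType) (I V : finType) (G : {ffun I -> V} -> R) (i : I) :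
  \sum_y \sum_a G (upd y i a) = #|V|%:R * \sum_x G x.
Proof.
rewrite pair_big /=; pose h (q : {ffun I -> V} * V) := (upd q.1 i q.2, q.1 i).
have hK : involutive h.
  case=> y a; rewrite /h /=; congr pair; last by rewrite ffunE eqxx.
  by apply/ffunP => k; rewrite !ffunE; case: eqP => [->|].
rewrite (reindex_inj (inv_inj hK)) /=.
rewrite (eq_bigr (fun q : {ffun I -> V} * V => G q.1)); last first.
  by move=> q _; rewrite -[upd _ i _]/(h (h q)).1 hK.
rewrite -(pair_big xpredT xpredT (fun y _ => G y)) /= mulr_sumr.
by apply: eq_bigr => y _; rewrite sumr_const mulr_natl.
Qed.

Section Counting.
Variables (R : realType) (V : finType) (E : rel V) (m : nat).
Implicit Types (L : seq ('I_m * 'I_m)) (Z : 'I_m -> {set V}) (x y : {ffun 'I_m -> V}).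

Definition hom_along L x := all (fun q => E (x q.1) (x q.2)) L.

Definition erel (u v : V) : R := (E u v)%:R.

(** Apart from [(i, j)], a listed edge meets at most one of the coordinates [i] and [j], the order
    excluding [(j, i)]. With the other coordinates fixed, these edges confine [a] and [b] to sets
    independently of each other, which is the situation where a cut bound applies. *)
Lemma hom_along_upd2 L y (i j : 'I_m) : (i < j)%N ->
  all (fun q : 'I_m * 'I_m => q.1 < q.2)%N L -> (i, j) \notin L ->
  exists (S T : {set V}) (c : bool), forall a b,
    hom_along L (upd (upd y i a) j b) = [&& c, a \in S & b \in T].
Proof.
move=> ltij; have nij : i != j by rewrite neq_ltn ltij.
elim: L => [|[k l] L IHL] /=.
  by move=> _ _; exists [set: V], [set: V], true => a b; rewrite !inE.
case/andP => ltkl lL; rewrite inE negb_or => /andP[neq nL].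
have [S [T [c H]]] := IHL lL nL.
have nji : (i == j) = false by rewrite (negbTE nij).
rewrite xpair_eqE negb_and in neq.
have [ki|nki] := altP (k =P i).
  have nlj : (l == j) = false by move: neq; rewrite ki eqxx eq_sym => /negbTE.
  have nli : (l == i) = false by apply: contraTF ltkl => /eqP ->; rewrite ki ltnn.
  exists [set a in S | E a (y l)], T, c => a b.
  rewrite H !ffunE ki eqxx nji nlj nli inE.
  by case: (E a _); rewrite ?andbT ?andbF.
have [kj|nkj] := altP (k =P j).
  have nlj : (l == j) = false by apply: contraTF ltkl => /eqP ->; rewrite kj ltnn.
  have nli : (l == i) = false.
    by apply: contraTF ltkl => /eqP ->; rewrite kj -leqNgt ltnW.
  exists S, [set b in T | E b (y l)], c => a b.
  rewrite H !ffunE kj eqxx nlj nli inE.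
  by case: (E b _); rewrite ?andbT ?andbF.
have [li|nli] := altP (l =P i).
  exists [set a in S | E (y k) a], T, c => a b.
  rewrite H !ffunE li eqxx nji (negbTE nki) (negbTE nkj) inE.
  by case: (E _ a); rewrite ?andbT ?andbF.
have [lj|nlj] := altP (l =P j).
  exists S, [set b in T | E (y k) b], c => a b.
  rewrite H !ffunE lj eqxx (negbTE nki) (negbTE nkj) inE.
  by case: (E _ b); rewrite ?andbT ?andbF.
exists S, T, (E (y k) (y l) && c) => a b.
by rewrite H !ffunE (negbTE nki) (negbTE nkj) (negbTE nli) (negbTE nlj) andbA.
Qed.

Lemma sum_prod_mem Z (P : pred 'I_m) :
  \sum_(y : {ffun 'I_m -> V}) \prod_(k | P k) (y k \in Z k)%:R =
  #|V|%:R ^+ #|[pred k | ~~ P k]| * \prod_(k | P k) #|Z k|%:R :> R.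
Proof.
rewrite (eq_bigr (fun y : {ffun 'I_m -> V} =>
    \prod_k (if P k then (y k \in Z k)%:R else 1))); last first.
  by move=> y _; rewrite big_mkcond.
rewrite -(bigA_distr_bigA (fun k v => if P k then (v \in Z k)%:R else 1)) /=.
rewrite (bigID P) /= mulrC; congr (_ * _); last first.
  apply: eq_bigr => k ->; rewrite -sum1_card natr_sum [RHS]big_mkcond /=.
  by apply: eq_bigr => v _; case: (v \in Z k).
rewrite (eq_bigr (fun=> #|V|%:R)) ?prodr_const // => k /negbTE ->.
by rewrite sumr_const.
Qed.

(** The bounds [M k] are kept apart from the sizes of the [Z k] so that one statement serves regular
    pairs, with [M k = |Z k|], and the cut condition, with [M k = |V|]. *)
Lemma deviation_bound Z (M : 'I_m -> R) (eta w : R) L (i j : 'I_m) :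
  (0 < #|V|)%N -> (i < j)%N ->
  all (fun q : 'I_m * 'I_m => q.1 < q.2)%N L -> (i, j) \notin L ->
  (forall k, #|Z k|%:R <= M k) ->
  (forall S T : {set V}, S \subset Z i -> T \subset Z j ->
     `|wsum erel S T - w * #|S|%:R * #|T|%:R| <= eta * M i * M j) ->
  `|\sum_(x : {ffun 'I_m -> V}) (erel (x i) (x j) - w) * (hom_along L x)%:R * \prod_k (x k \in Z k)%:R|
    <= eta * \prod_k M k.
Proof.
move=> V0 ltij lL nL leM Hw; have nij : j != i by rewrite neq_ltn ltij orbT.
pose G (x : {ffun 'I_m -> V}) : R :=
  (erel (x i) (x j) - w) * (hom_along L x)%:R * \prod_k (x k \in Z k)%:R.
rewrite -/(\sum_x G x).
have n0 : 0 < #|V|%:R :> R by rewrite ltr0n.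
have M0 k : 0 <= M k by apply: le_trans (leM k).
have etaMM : 0 <= eta * M i * M j.
  by apply: le_trans (Hw _ _ (finset.sub0set _) (finset.sub0set _)).
(* Resampling coordinates [i] and [j] turns the sum into an average, over [y], of double sums to
   which [Hw] applies. *)
have sum2 : \sum_y \sum_a \sum_b G (upd (upd y i a) j b) = #|V|%:R ^+ 2 * \sum_x G x.
  by rewrite (sum_upd (fun y => \sum_b G (upd y j b))) sum_upd mulrA expr2.
have bound y : `|\sum_a \sum_b G (upd (upd y i a) j b)| <=
    (eta * M i * M j) * \prod_(k | (k != i) && (k != j)) (y k \in Z k)%:R.
  have [S [T [c HST]]] := hom_along_upd2 y ltij lL nL.
  set P := \prod_(k | _) _.
  have P0 : 0 <= P by apply: prodr_ge0.
  have -> : \sum_a \sum_b G (upd (upd y i a) j b) =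
      P * (c%:R * (wsum erel (S :&: Z i) (T :&: Z j) -
        w * #|S :&: Z i|%:R * #|T :&: Z j|%:R)).
    rewrite -wsumBr mulrA /wsum mulr_sumr [RHS]big_mkcond /=; apply: eq_bigr => a _.
    have E1 b : G (upd (upd y i a) j b) = P * c%:R * (a \in S :&: Z i)%:R *
        ((b \in T :&: Z j)%:R * (erel a b - w)).
      rewrite /G HST (bigD1 i) //= (bigD1 j) //= !ffunE !eqxx eq_sym (negbTE nij) !inE.
      have -> : \prod_(k | (k != i) && (k != j)) (upd (upd y i a) j b k \in Z k)%:R = P.
        by apply: eq_bigr => k /andP[/negbTE ki /negbTE kj]; rewrite !ffunE ki kj.
      by rewrite -!mulnb !natrM; ring.
    rewrite (eq_bigr _ (fun b _ => E1 b)) -mulr_sumr.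
    rewrite (_ : \sum_b _ = \sum_(b in T :&: Z j) (erel a b - w)); last first.
      by rewrite [RHS]big_mkcond; apply: eq_bigr => b _; case: (b \in _); rewrite ?mul1r ?mul0r.
    by case: (a \in _); rewrite ?mulr1 ?mulr0 ?mul0r.
  rewrite normrM ger0_norm // mulrC ler_wpM2r // normrM.
  apply: le_trans (Hw (S :&: Z i) (T :&: Z j) (subsetIr _ _) (subsetIr _ _)).
  by rewrite ler_piMl // normr_nat; case: c {HST}; rewrite ?lexx ?ler01.
rewrite -(ler_pM2l (exprn_gt0 2 n0)) -[X in X * `|_|]ger0_norm ?exprn_ge0 ?ler0n //.
rewrite -normrM -sum2; apply: le_trans (ler_norm_sum _ _ _) _.
apply: le_trans (ler_sum _ (fun y _ => bound y)) _.
rewrite -mulr_sumr sum_prod_mem.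
have -> : #|[pred k : 'I_m | ~~ ((k != i) && (k != j))]| = 2%N.
  rewrite (@eq_card _ _ (pred2 i j)) ?card2 1?eq_sym ?nij // => k.
  by rewrite !inE negb_and !negbK.
rewrite mulrCA ler_wpM2l ?exprn_ge0 ?ler0n //.
have -> : eta * \prod_k M k =
    eta * M i * M j * \prod_(k | (k != i) && (k != j)) M k.
  by rewrite (bigD1 i) //= (bigD1 j) //= !mulrA.
rewrite ler_wpM2l //.
by apply: ler_prod => k _; rewrite ler0n leM.
Qed.

Lemma counting_lemma Z (M : 'I_m -> R) (eta : R) (w : 'I_m -> 'I_m -> R) L :
  (0 < #|V|)%N -> uniq L -> all (fun q : 'I_m * 'I_m => q.1 < q.2)%N L ->
  (forall i j, 0 <= w i j <= 1) -> (forall k, #|Z k|%:R <= M k) ->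
  (forall i j (S T : {set V}), (i, j) \in L -> S \subset Z i -> T \subset Z j ->
     `|wsum erel S T - w i j * #|S|%:R * #|T|%:R| <= eta * M i * M j) ->
  `|\sum_(x : {ffun 'I_m -> V}) (hom_along L x)%:R * \prod_k (x k \in Z k)%:R
    - \prod_(q <- L) w q.1 q.2 * \prod_k #|Z k|%:R|
    <= (size L)%:R * (eta * \prod_k M k).
Proof.
move=> V0 + + w01 leM; elim: L => [|[i j] L IHL] /=.
  move=> _ _ _; rewrite big_nil mul1r mul0r.
  rewrite (eq_bigr (fun x : {ffun 'I_m -> V} => \prod_k (x k \in Z k)%:R)).
    by rewrite sum_prod_mem (eq_card0 (A := [pred k | ~~ true])) // mul1r subrr normr0.
  by move=> x _; rewrite mul1r.
case/andP => nL uL /andP[ltij lL] Hw.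
have {}IHL := IHL uL lL (fun k l S T h => Hw k l S T (mem_behead (s := (i, j) :: L) h)).
have Hij S T := Hw i j S T (mem_head _ _).
have D := deviation_bound V0 ltij lL nL leM Hij.
set A := \sum_x _ in IHL; set B := \prod_(q <- L) _ in IHL.
set C := \prod_k #|Z k|%:R in IHL *.
set X := \sum_x _ in D.
have -> : \sum_(x : {ffun 'I_m -> V}) (E (x i) (x j) && hom_along L x)%:R * \prod_k (x k \in Z k)%:R =
    X + w i j * A.
  rewrite /X /A mulr_sumr -big_split /=; apply: eq_bigr => x _.
  by rewrite /erel; case: (E _ _); rewrite /= ?mul0r ?mul1r; ring.
rewrite big_cons -/B /=.
have -> : X + w i j * A - w i j * B * C = X + w i j * (A - B * C) by ring.
apply: le_trans (ler_normD _ _) _; rewrite -natr1 mulrDl mul1r addrC lerD //.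
rewrite normrM; have /andP[w0 w1] := w01 i j.
by apply: le_trans IHL; rewrite ler_piMl // ger0_norm.
Qed.

End Counting.

(** * Symmetric sums and additive functions *)

(* Ryser's formula for the permanent *)
Lemma permanent_inclusion_exclusion (R : realType) (m : nat) (y : 'I_m -> 'I_m -> R) :
  \sum_(s : 'S_m) \prod_j y (s j) j =
  \sum_(T : {set 'I_m}) (-1) ^+ #|~: T| * \prod_j \sum_(i in T) y i j.
Proof.
transitivity (\sum_(c : {ffun 'I_m -> 'I_m}) (\prod_j y (c j) j) * (injectiveb c)%:R).
  rewrite (bigID (fun c : {ffun 'I_m -> 'I_m} => injectiveb c)) /= addrC.
  rewrite [X in X + _]big1 => [|c ninj]; last by rewrite (negbTE ninj) mulr0.
  rewrite add0r.
  rewrite (reindex (@pval _)) /=; last first.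
    pose in_Sn := insubd (1%g : 'S_m).
    by exists in_Sn => /= f Uf; first apply: val_inj; apply: insubdK.
  apply: eq_big => /= [s | s _]; rewrite ?(valP s) // mulr1.
  by apply: eq_bigr => j _; rewrite pvalE.
transitivity (\sum_(c : {ffun 'I_m -> 'I_m}) (\prod_j y (c j) j) *
    \sum_(T : {set 'I_m}) (-1) ^+ #|~: T| * \prod_j (c j \in T)%:R).
  apply: eq_bigr => c _; congr (_ * _).
  (* A map from ['I_m] to itself is injective when it misses no value. The product expands over the
     sets [~: T] of values declared missed, and such a term survives when [c] maps into [T]. *)
  transitivity (\prod_i (1 + - ((i \notin codom c) %:R : R))).
    have [/injectiveP ic|nc] := boolP (injectiveb c).
      rewrite big1 // => i _; rewrite (_ : i \in codom c) ?subr0 //.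
      apply/codomP; exists (invF ic i); by rewrite f_invF.
    suff [i ni] : exists i, i \notin codom c by rewrite (bigD1 i) //= ni subrr mul0r.
    apply/existsP; apply: contraNT nc; rewrite negb_exists => /forallP H.
    apply/card_uniqP; rewrite size_map -cardE; apply: eq_card => i.
    by have := H i; rewrite negbK => ->.
  rewrite bigA_distr; apply: eq_bigr => T _.
  rewrite (_ : (-1) ^+ #|~: T| = \prod_i (if i \in T then 1 else -1)); last first.
    rewrite (bigID (mem T)) /= big1 ?mul1r => [|i ->] //.
    rewrite (eq_bigr (fun=> -1)) ?prodr_const => [|i /negbTE -> //].
    by congr (_ ^+ _); apply: eq_card => i; rewrite !inE.
  rewrite (_ : \prod_j (c j \in T)%:R =
      \prod_i (if i \in T then 1 else ((i \notin codom c)%:R : R))); last first.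
    have [/forallP H|] := boolP [forall j, c j \in T].
      rewrite big1 => [|j _]; last by rewrite H.
      rewrite big1 // => i _; case: ifPn => // niT.
      suff -> : i \notin codom c by [].
      by apply: contra niT => /codomP[j ->].
    rewrite negb_forall => /existsP[j nj]; rewrite (bigD1 j) //= (negbTE nj) mul0r.
    by rewrite (bigD1 (c j)) //= (negbTE nj) codom_f mul0r.
  rewrite -big_split /=; apply: eq_bigr => i _.
  by case: ifP => _; rewrite ?mulr1 ?mulN1r.
under eq_bigr do rewrite mulr_sumr.
rewrite exchange_big /=; apply: eq_bigr => T _.
transitivity ((-1) ^+ #|~: T| * \sum_(c : {ffun 'I_m -> 'I_m}) \prod_j (y (c j) j * (c j \in T)%:R)).
  by rewrite mulr_sumr; apply: eq_bigr => c _; rewrite big_split /= mulrCA.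
congr (_ * _); rewrite -(bigA_distr_bigA (fun j i => y i j * (i \in T)%:R)) /=.
apply: eq_bigr => j _; rewrite [RHS]big_mkcond /=; apply: eq_bigr => i _.
by case: (i \in T); rewrite ?mulr1 ?mulr0.
Qed.

Section Mform.
Variables (R : realType) (V : finType) (m : nat).
Implicit Types (f : {ffun 'I_m -> V} -> R) (Z : 'I_m -> {set V}).

Definition mform f Z : R := \sum_x f x * \prod_j (x j \in Z j)%:R.

(** The diagonal values on unions of the [Z i] determine the symmetrised value on [(Z i)], by
    Ryser's formula applied at each [x] to the matrix of indicators of [x j \in Z i]. Disjointness
    makes the indicator of a union the sum of the indicators; there are [2 ^ m] unions. *)
Lemma polarization f Z (eps : R) :
  (forall i j, i != j -> [disjoint Z i & Z j]) ->
  (forall W : {set V}, `|mform f (fun=> W)| <= eps) ->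
  `|\sum_(s : 'S_m) mform f (fun j => Z (s j))| <= 2 ^+ m * eps.
Proof.
move=> dZ H.
have -> : \sum_(s : 'S_m) mform f (fun j => Z (s j)) =
    \sum_(T : {set 'I_m}) (-1) ^+ #|~: T| * mform f (fun=> \bigcup_(i in T) Z i).
  rewrite /mform exchange_big /=; under [RHS]eq_bigr do rewrite mulr_sumr.
  rewrite [RHS]exchange_big /=; apply: eq_bigr => x _.
  rewrite -mulr_sumr (permanent_inclusion_exclusion (fun i j => (x j \in Z i)%:R)).
  rewrite mulr_sumr; apply: eq_bigr => T _; rewrite mulrCA; congr (_ * (_ * _)).
  apply: eq_bigr => j _; have [/finset.bigcupP[i iT xi]|nx] := boolP (x j \in _).
    rewrite (bigD1 i) //= xi big1 ?addr0 // => k /andP[_ ki].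
    by rewrite (disjointFr (dZ i k _)) // eq_sym.
  rewrite big1 // => i iT; case xi: (x j \in Z i) => //.
  by case/negP: nx; apply/finset.bigcupP; exists i.
apply: le_trans (ler_norm_sum _ _ _) _.
apply: (@le_trans _ _ (\sum_(T : {set 'I_m}) eps)).
  by apply: ler_sum => T _; rewrite normrM normrX normrN1 expr1n mul1r H.
by rewrite sumr_const -[eps *+ _]mulr_natl -cardsT -powersetT card_powerset cardsT card_ord natrX.
Qed.

Lemma mform_coord (phi : V -> R) (j : 'I_m) Z :
  mform (fun x => phi (x j)) Z =
  (\sum_(v in Z j) phi v) * \prod_(k | k != j) #|Z k|%:R.
Proof.
rewrite /mform (eq_bigr (fun x : {ffun 'I_m -> V} =>
    \prod_k ((if k == j then phi (x k) else 1) * (x k \in Z k)%:R))); last first.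
  by move=> x _; rewrite big_split /= -big_mkcond /= big_pred1_eq.
rewrite -(bigA_distr_bigA (fun k v => (if k == j then phi v else 1) * (v \in Z k)%:R)) /=.
rewrite (bigD1 j) //= eqxx; congr (_ * _).
  by rewrite [RHS]big_mkcond /=; apply: eq_bigr => v _; case: (v \in _); rewrite ?mulr1 ?mulr0.
apply: eq_bigr => k /negbTE ->; rewrite -sum1_card natr_sum [RHS]big_mkcond /=.
by apply: eq_bigr => v _; rewrite mul1r; case: (v \in _).
Qed.

Lemma mformB f f' Z : mform (fun x => f x - f' x) Z = mform f Z - mform f' Z.
Proof. by rewrite /mform -sumrB; apply: eq_bigr => x _; rewrite mulrBl. Qed.

Lemma mformZ (c : R) f Z : mform (fun x => c * f x) Z = c * mform f Z.
Proof. by rewrite /mform mulr_sumr; apply: eq_bigr => x _; rewrite mulrA. Qed.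

Lemma mform_sum (I : finType) (F : I -> {ffun 'I_m -> V} -> R) Z :
  mform (fun x => \sum_i F i x) Z = \sum_i mform (F i) Z.
Proof.
rewrite /mform exchange_big; apply: eq_bigr => x _.
by rewrite mulr_suml.
Qed.

Lemma mform_cst (c : R) Z : mform (fun=> c) Z = c * \prod_k #|Z k|%:R.
Proof.
rewrite /mform -mulr_sumr; congr (_ * _).
by rewrite sum_prod_mem (eq_card0 (A := [pred k | ~~ true])) // mul1r.
Qed.

(** Normalised as a mean, so that for [0 < m] a constant [g] gives that constant. *)
Definition additive_form (g : V -> R) (x : {ffun 'I_m -> V}) : R :=
  m%:R^-1 * \sum_j g (x j).

Definition set_avg (g : V -> R) (W : {set V}) : R := (\sum_(v in W) g v) / #|W|%:R.

Lemma mform_additive (g : V -> R) Z : (forall j, 0 < #|Z j|)%N ->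
  mform (additive_form g) Z =
  m%:R^-1 * (\sum_j set_avg g (Z j)) * \prod_k #|Z k|%:R.
Proof.
move=> Z0; rewrite mformZ mform_sum -mulrA mulr_suml; congr (_ * _).
apply: eq_bigr => j _; rewrite mform_coord [in RHS](bigD1 j) //= mulrA; congr (_ * _).
by rewrite /set_avg divfK // pnatr_eq0 -lt0n.
Qed.

End Mform.

Lemma sum_perm_const (R : realType) (m : nat) (c : R) :
  \sum_(s : 'S_m) c = (m`!)%:R * c.
Proof. by rewrite sumr_const card_Sn mulr_natl. Qed.

Section Blocks.
Variables (R : realType) (V : finType) (E : rel V) (m : nat).
Variables (L : seq ('I_m * 'I_m)) (p : R).
Hypotheses (uniq_L : uniq L)
  (lt_L : all (fun q : 'I_m * 'I_m => q.1 < q.2)%N L).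
Implicit Types (Z : 'I_m -> {set V}).

Definition hom_dev (x : {ffun 'I_m -> V}) : R :=
  (injectiveb x)%:R * ((hom_along E L x)%:R - p ^+ size L).

Lemma mform_hom_dev Z : (forall i j, i != j -> [disjoint Z i & Z j]) ->
  mform hom_dev Z = \sum_(x : {ffun 'I_m -> V}) (hom_along E L x)%:R * \prod_k (x k \in Z k)%:R
    - p ^+ size L * \prod_k #|Z k|%:R.
Proof.
move=> dZ; rewrite -mform_cst /mform -sumrB; apply: eq_bigr => x _.
rewrite -mulrBl /hom_dev; have [_|nix] := boolP (injectiveb x); first by rewrite mul1r.
rewrite mul0r mul0r; case/injectivePn: nix => i [j nij eqx].
rewrite [X in _ = _ * X](bigD1 i) //= (bigD1 j) 1?eq_sym //=.
have [xi|] := boolP (x i \in Z i); last by rewrite !mul0r mulr0.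
by rewrite -eqx (disjointFr (dZ i j nij) xi) mul0r !mulr0.
Qed.

(** The symmetrised form of [hom_dev] on the blocks is computed twice: by the counting lemma from
    the densities, and by polarisation from the additive form. The second error is relative to
    [|V| ^ m], and dividing it by the product of the block sizes costs [beta ^ m]. *)
Lemma block_equation Z (w : 'I_m -> 'I_m -> R) (g : V -> R) (eps eps' beta : R) :
  (0 < #|V|)%N -> 0 < beta -> 0 <= eps' ->
  (forall i j, i != j -> [disjoint Z i & Z j]) ->
  (forall i, beta * #|V|%:R <= #|Z i|%:R) ->
  (forall i j, 0 <= w i j <= 1) ->
  (forall i j, i != j -> regular_pair (erel R E) eps (w i j) (Z i) (Z j)) ->
  (forall W : {set V},
     `|mform (fun x => hom_dev x - additive_form g x) (fun=> W)| <= eps' * #|V|%:R ^+ m) ->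
  `|(m`!)%:R^-1 * (\sum_(s : 'S_m) \prod_(q <- L) w (s q.1) (s q.2))
     - p ^+ size L - m%:R^-1 * \sum_i set_avg g (Z i)|
    <= (size L)%:R * eps + 2 ^+ m * eps' / beta ^+ m.
Proof.
move=> V0 beta0 eps'0 dZ leZ w01 Hr HW.
have n0 : 0 < #|V|%:R :> R by rewrite ltr0n.
have Z0 i : (0 < #|Z i|)%N.
  by rewrite -(ltr0n R); apply: lt_le_trans (leZ i); rewrite mulr_gt0.
pose PZ := \prod_k #|Z k|%:R : R.
have PZ0 : 0 < PZ by apply: prodr_gt0 => k _; rewrite ltr0n.
have lePZ : beta ^+ m * #|V|%:R ^+ m <= PZ.
  rewrite -exprMn -[X in _ ^+ X]card_ord -prodr_const; apply: ler_prod => k _.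
  by rewrite leZ mulr_ge0 // ltW.
have m0 : 0 < (m`!)%:R :> R by rewrite ltr0n fact_gt0.
have PZs (s : 'S_m) : \prod_k #|Z (s k)|%:R = PZ.
  by rewrite /PZ [RHS](reindex_inj (@perm_inj _ s)).
have dZs (s : 'S_m) i j : i != j -> [disjoint Z (s i) & Z (s j)].
  by move=> nij; apply: dZ; rewrite (inj_eq (@perm_inj _ s)).
pose A := \sum_(s : 'S_m) \prod_(q <- L) w (s q.1) (s q.2).
pose B := \sum_i set_avg g (Z i).
have add_sum : \sum_(s : 'S_m) mform (additive_form g) (fun j => Z (s j)) =
    (m`!)%:R * (m%:R^-1 * B * PZ).
  rewrite (eq_bigr (fun=> m%:R^-1 * B * PZ)); last first.
    move=> s _; rewrite mform_additive; last by move=> j; apply: Z0.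
    by rewrite PZs /B [in RHS](reindex_inj (@perm_inj _ s)).
  exact: sum_perm_const.
have H1 : `|\sum_(s : 'S_m) mform hom_dev (fun j => Z (s j)) -
    (m`!)%:R * (m%:R^-1 * B * PZ)| <= 2 ^+ m * (eps' * #|V|%:R ^+ m).
  rewrite -add_sum -sumrB; under eq_bigr do rewrite -mformB.
  exact: polarization.
have H2 : `|\sum_(s : 'S_m) mform hom_dev (fun j => Z (s j)) -
    (A - (m`!)%:R * p ^+ size L) * PZ| <= (m`!)%:R * ((size L)%:R * (eps * PZ)).
  have -> : (A - (m`!)%:R * p ^+ size L) * PZ =
      \sum_(s : 'S_m) (\prod_(q <- L) w (s q.1) (s q.2) * PZ - p ^+ size L * PZ).
    by rewrite sumrB -mulr_suml sum_perm_const -/A; ring.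
  rewrite -sumrB; apply: le_trans (ler_norm_sum _ _ _) _.
  apply: (@le_trans _ _ (\sum_(s : 'S_m) (size L)%:R * (eps * PZ))); last first.
    by rewrite sum_perm_const.
  apply: ler_sum => s _; rewrite mform_hom_dev; last exact: dZs.
  rewrite PZs opprB addrA subrK.
  have := @counting_lemma R V E m (fun j => Z (s j)) (fun j => #|Z (s j)|%:R) eps
    (fun i j => w (s i) (s j)) L V0 uniq_L lt_L.
  rewrite /= !PZs; apply => // i j S T ij sS sT; apply: Hr => //.
  rewrite (inj_eq (@perm_inj _ s)) neq_ltn.
  by rewrite (allP lt_L _ ij).
set C := \sum_(s : 'S_m) mform _ _ in H1 H2.
rewrite -(ler_pM2r PZ0) -(ler_pM2l m0) -/A -/B.
rewrite -[X in _ * (_ * X) <= _](gtr0_norm PZ0) -normrM -[X in X * `|_|](gtr0_norm m0) -normrM.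
have -> : (m`!)%:R * (((m`!)%:R^-1 * A - p ^+ size L - m%:R^-1 * B) * PZ) =
    (C - (m`!)%:R * (m%:R^-1 * B * PZ)) - (C - (A - (m`!)%:R * p ^+ size L) * PZ).
  have : (m`!)%:R * ((m`!)%:R^-1 * A * PZ) = A * PZ by rewrite !mulrA divff ?mul1r // gt_eqF.
  move: (m`!)%:R (m%:R^-1) (p ^+ _) => F mi P.
  move: (F^-1) => fi e; transitivity (F * (fi * A * PZ) - F * P * PZ - F * (mi * B * PZ)).
    by ring.
  by rewrite e; ring.
apply: le_trans (ler_normB _ _) _; apply: le_trans (lerD H1 H2) _.
rewrite mulrDl mulrDr addrC lerD ?mulrA //.
have -> : (m`!)%:R * 2 ^+ m * eps' / beta ^+ m * PZ =
  2 ^+ m * eps' * ((m`!)%:R * (PZ / beta ^+ m)) by move: (_^-1) => ?; ring.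
rewrite ler_wpM2l ?mulr_ge0 ?exprn_ge0 //.
have bm0 : 0 < beta ^+ m by apply: exprn_gt0.
apply: le_trans (_ : PZ / beta ^+ m <= _).
  by rewrite ler_pdivlMr // mulrC.
by rewrite ler_peMl ?divr_ge0 ?(ltW PZ0) ?(ltW bm0) // ler1n fact_gt0.
Qed.

Definition edges_at (j : 'I_m) := count (fun q : 'I_m * 'I_m => (q.1 == j) || (q.2 == j)) L.

(** The first equation takes all blocks in [By]. The second adds up the [m] families in which only
    the block [i0] comes from [Bx]: for a fixed permutation, the vertex of [F] placed in that block
    runs through all vertices [j] as [i0] varies, and its [edges_at j] edges are those of density
    [s]. Summing over [i0] also turns the single averages over [Bx i0] into [gX]. *)
Lemma cluster_equations (Bx By : 'I_m -> {set V}) (v s : R) (g : V -> R)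
    (eps eps' beta : R) :
  (0 < #|V|)%N -> 0 < beta -> 0 <= eps' -> (0 < m)%N ->
  (forall i j, i != j -> [disjoint Bx i & By j]) ->
  (forall i j, i != j -> [disjoint By i & By j]) ->
  (forall i, beta * #|V|%:R <= #|Bx i|%:R) ->
  (forall i, beta * #|V|%:R <= #|By i|%:R) ->
  0 <= v <= 1 -> 0 <= s <= 1 -> symmetric E ->
  (forall i j, i != j -> regular_pair (erel R E) eps s (Bx i) (By j)) ->
  (forall i j, i != j -> regular_pair (erel R E) eps v (By i) (By j)) ->
  (forall W : {set V},
     `|mform (fun x => hom_dev x - additive_form g x) (fun=> W)| <= eps' * #|V|%:R ^+ m) ->
  let gX := m%:R^-1 * \sum_i set_avg g (Bx i) in
  let gY := m%:R^-1 * \sum_i set_avg g (By i) in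
  let err := (size L)%:R * eps + 2 ^+ m * eps' / beta ^+ m in
  `|v ^+ size L - p ^+ size L - gY| <= err /\
  `|\sum_j v ^+ (size L - edges_at j) * s ^+ edges_at j
    - m%:R * p ^+ size L - (m%:R - 1) * gY - gX| <= m%:R * err.
Proof.
move=> V0 beta0 eps'0 m_gt0 dXY dYY leX leY v01 s01 symE HrX HrY HW gX gY err.
have m0 : 0 < (m`!)%:R :> R by rewrite ltr0n fact_gt0.
have mR0 : 0 < m%:R :> R by rewrite ltr0n.
split.
  have := block_equation V0 beta0 eps'0 dYY leY (w := fun _ _ => v) (fun _ _ => v01) HrY HW.
  have -> : \prod_(q <- L) v = v ^+ size L.
    by elim: (L) => [|q l IHl]; rewrite ?big_nil // big_cons IHl exprS.
  by rewrite sum_perm_const mulKf ?gt_eqF.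
pose Z i0 i := if i == i0 then Bx i else By i.
pose w (i0 i j : 'I_m) := if (i == i0) || (j == i0) then s else v.
have eq1 i0 : `|(m`!)%:R^-1 * (\sum_(t : 'S_m) \prod_(q <- L) w i0 (t q.1) (t q.2))
     - p ^+ size L - m%:R^-1 * \sum_i set_avg g (Z i0 i)| <= err.
  apply: block_equation => //.
  - move=> i j nij; rewrite /Z; case: (altP (i =P i0)) => [ei|ni]; case: (altP (j =P i0)) => [ej|nj].
    + by rewrite ei ej eqxx in nij.
    + exact: dXY.
    + by rewrite disjoint_sym; apply: dXY; rewrite eq_sym.
    + exact: dYY.
  - by move=> i; rewrite /Z; case: eqP.
  - by move=> i j; rewrite /w; case: ifP.
  - move=> i j nij; rewrite /Z /w.
    case: (altP (i =P i0)) => [ei|ni]; case: (altP (j =P i0)) => [ej|nj] /=.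
    + by rewrite ei ej eqxx in nij.
    + exact: HrX.
    + apply: regular_pairC; last by apply: HrX; rewrite eq_sym.
      by move=> x y; rewrite /erel symE.
    + exact: HrY.
pose P (j : 'I_m) := \prod_(q <- L) (if (q.1 == j) || (q.2 == j) then s else v).
have PE j : P j = v ^+ (size L - edges_at j) * s ^+ edges_at j.
  rewrite /P /edges_at; elim: (L) => [|q l IHl]; first by rewrite big_nil mulr1.
  rewrite big_cons IHl /=; case: ifP => _ /=; rewrite ?add0n ?add1n ?subSS.
    by rewrite exprS mulrCA.
  by rewrite subSn ?count_size // exprS mulrA.
have wP i0 (t : 'S_m) : \prod_(q <- L) w i0 (t q.1) (t q.2) = P (t^-1%g i0).
  apply: eq_bigr => q _.
  by rewrite /w -!(inj_eq (@perm_inj _ t) _ (t^-1%g i0)) permKV.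
have sumA : \sum_i0 (m`!)%:R^-1 * (\sum_(t : 'S_m) \prod_(q <- L) w i0 (t q.1) (t q.2)) =
    \sum_j P j.
  rewrite -mulr_sumr exchange_big /= (eq_bigr (fun=> \sum_j P j)).
    by rewrite sum_perm_const mulKf ?gt_eqF.
  move=> t _; rewrite [RHS](reindex_inj (@perm_inj _ (t^-1)%g)).
  by apply: eq_bigr => i0 _; rewrite wP.
have sumB : \sum_i0 m%:R^-1 * \sum_i set_avg g (Z i0 i) = (m%:R - 1) * gY + gX.
  rewrite -mulr_sumr.
  have -> : \sum_i0 \sum_i set_avg g (Z i0 i) =
      \sum_(i0 < m) (\sum_i set_avg g (By i) + (set_avg g (Bx i0) - set_avg g (By i0))).
    apply: eq_bigr => i0 _; rewrite (bigD1 i0) //= [in RHS](bigD1 i0) //= /Z eqxx.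
    rewrite (eq_bigr (fun i => set_avg g (By i))) => [|i /negbTE -> //]; ring.
  rewrite big_split sumr_const card_ord sumrB /= /gX /gY -[_ *+ _]mulr_natl.
  by field; rewrite gt_eqF.
have -> : \sum_j v ^+ (size L - edges_at j) * s ^+ edges_at j
    - m%:R * p ^+ size L - (m%:R - 1) * gY - gX =
   \sum_i0 ((m`!)%:R^-1 * (\sum_(t : 'S_m) \prod_(q <- L) w i0 (t q.1) (t q.2))
     - p ^+ size L - m%:R^-1 * \sum_i set_avg g (Z i0 i)).
  rewrite !sumrB sumA sumB sumr_const card_ord -[_ *+ m]mulr_natl.
  by rewrite (eq_bigr _ (fun j _ => PE j)); ring.
apply: le_trans (ler_norm_sum _ _ _) _; apply: le_trans (ler_sum _ (fun i0 _ => eq1 i0)) _.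
by rewrite sumr_const card_ord mulr_natl.
Qed.

End Blocks.

(** * Rigidity of the density equations *)

Section PowerInequalities.
Variable R : realType.
Implicit Types (x y u v s : R) (a b k d e : nat).

(** Weighted AM-GM for 1 and [y ^ (a + b)] with weights [b] and [a]. The difference of the two sides
    is [y - 1] times a difference of geometric sums that has the sign of [y - 1]. *)
Lemma amgm_nat y a b : 0 <= y ->
  (a + b)%:R * y ^+ a <= b%:R + a%:R * y ^+ (a + b).
Proof.
move=> y0; rewrite -subr_ge0.
have -> : b%:R + a%:R * y ^+ (a + b) - (a + b)%:R * y ^+ a =
    a%:R * y ^+ a * (y ^+ b - 1) - b%:R * (y ^+ a - 1) by rewrite exprD natrD; ring.
rewrite !subrX1 !(mulrCA _ (y - 1)) -mulrBr.
have sum_cst n (c : R) : \sum_(i < n) c = n%:R * c by rewrite sumr_const card_ord mulr_natl.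
have [y1|/ltW y1] := leP 1 y.
  rewrite mulr_ge0 ?subr_ge0 //.
  apply: (@le_trans _ _ (b%:R * (a%:R * y ^+ a))).
    rewrite ler_wpM2l // -sum_cst; apply: ler_sum => i _.
    by rewrite ler_weXn2l // ltnW.
  rewrite mulrC ler_wpM2l ?mulr_ge0 ?exprn_ge0 // -[leLHS]mulr1 -sum_cst.
  by apply: ler_sum => i _; apply: exprn_ege1.
rewrite mulr_le0 // ?subr_le0 //.
apply: (@le_trans _ _ (b%:R * (a%:R * y ^+ a))).
  rewrite [leRHS]mulrC ler_wpM2l ?mulr_ge0 ?exprn_ge0 // -[leRHS]mulr1 -sum_cst.
  by apply: ler_sum => i _; apply: exprn_ile1.
rewrite ler_wpM2l // -sum_cst; apply: ler_sum => i _.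
by rewrite ler_wiXn2l // ltnW.
Qed.

Lemma amgm_nat_strict y a b : 0 <= y -> y < 1 -> (0 < a)%N -> (0 < b)%N ->
  (a + b)%:R * y ^+ a < b%:R + a%:R * y ^+ (a + b).
Proof.
move=> y0 y1 a0 b0; rewrite -subr_gt0.
have -> : b%:R + a%:R * y ^+ (a + b) - (a + b)%:R * y ^+ a =
    a%:R * y ^+ a * (y ^+ b - 1) - b%:R * (y ^+ a - 1) by rewrite exprD natrD; ring.
rewrite !subrX1 !(mulrCA _ (y - 1)) -mulrBr.
have sum_cst n (c : R) : \sum_(i < n) c = n%:R * c by rewrite sumr_const card_ord mulr_natl.
rewrite nmulr_rgt0 ?subr_lt0 //.
apply: (@le_lt_trans _ _ (b%:R * (a%:R * y ^+ a))).
  rewrite [leRHS]mulrC ler_wpM2l ?mulr_ge0 ?exprn_ge0 // -[leRHS]mulr1 -sum_cst.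
  by apply: ler_sum => i _; apply: exprn_ile1 => //; apply: ltW.
rewrite ltr_pM2l ?ltr0n // -sum_cst; case: a a0 => // a _.
rewrite !big_ord_recl /= expr0; apply: ltr_leD; first exact: exprn_ilt1.
by apply: ler_sum => i _; rewrite ler_wiXn2l ?(ltW y1) // ltnW // ltnS.
Qed.

Lemma amgm_weighted v s d e : (d <= e)%N -> 0 <= v -> 0 < s ->
  e%:R * (v ^+ (e - d) * s ^+ d) <= (e - d)%:R * v ^+ e + d%:R * s ^+ e.
Proof.
move=> de v0 s0; have := amgm_nat (e - d) d (divr_ge0 v0 (ltW s0)).
rewrite subnK // !expr_div_n.
have se0 : 0 < s ^+ e by apply: exprn_gt0.
rewrite -(ler_pM2r se0); congr (_ <= _).
  by rewrite -[in s ^+ e](subnK de) exprD; field; rewrite gt_eqF // exprn_gt0.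
by field; rewrite gt_eqF.
Qed.

Lemma amgm_weighted_strict v s d e : (0 < d)%N -> (d < e)%N -> 0 <= v -> v < s ->
  e%:R * (v ^+ (e - d) * s ^+ d) < (e - d)%:R * v ^+ e + d%:R * s ^+ e.
Proof.
move=> d0 de v0 vs; have s0 : 0 < s by apply: le_lt_trans vs.
have e0 : (0 < e - d)%N by rewrite subn_gt0.
have := amgm_nat_strict (divr_ge0 v0 (ltW s0)) _ e0 d0.
rewrite ltr_pdivrMr // mul1r => /(_ vs).
rewrite subnK ?(ltnW de) // !expr_div_n.
have se0 : 0 < s ^+ e by apply: exprn_gt0.
rewrite -(ltr_pM2r se0); congr (_ < _).
  by rewrite -[in s ^+ e](subnK (ltnW de)) exprD; field; rewrite gt_eqF // exprn_gt0.
by field; rewrite gt_eqF.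
Qed.

(* The two sides differ by the increment of an antiderivative of
   [t ^+ k * (e + j * t ^+ (e + j) - (e + j) * t ^+ j)], where [e = k.+1 + j];
   this integrand is nonnegative by AM-GM. *)
Lemma power_gap k j x y : 0 <= x -> x <= y ->
  let e := (k.+1 + j)%N in
  k.+1%:R * j%:R * (y ^+ e - x ^+ e) * (2 - x ^+ e - y ^+ e) <=
  2 * e%:R * (e%:R * (y ^+ k.+1 - x ^+ k.+1) - k.+1%:R * (y ^+ e - x ^+ e)).
Proof.
move=> x0 xy /=; set e := (k.+1 + j)%N.
pose P : {poly R} := (2 * e%:R ^+ 2) *: 'X^(k.+1) - (2 * e%:R * k.+1%:R) *: 'X^e +
  (k.+1%:R * j%:R) *: ('X^e - 1) ^+ 2.
have PE t : P.[t] = 2 * e%:R ^+ 2 * t ^+ k.+1 - 2 * e%:R * k.+1%:R * t ^+ e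
    + k.+1%:R * j%:R * (t ^+ e - 1) ^+ 2.
  by rewrite /P !hornerE.
suff : P.[x] <= P.[y] by rewrite !PE; move: (x ^+ e) (y ^+ e) => X Y; nra.
apply: (@polyrcf.ler_hornerW R x y P) => //; last 2 first.
- by rewrite in_itv /= lexx.
- by rewrite in_itv /= lexx xy.
move=> t; rewrite in_itv /= => /andP[xt _]; have t0 : 0 <= t by apply/ltW/(le_lt_trans x0).
have -> : P^`().[t] = 2 * e%:R * k.+1%:R * t ^+ k *
    (e%:R + j%:R * t ^+ (j + e) - (j + e)%:R * t ^+ j).
  rewrite /P !poly.derivE !hornerE /=.
  rewrite !hornerMn !hornerXn -[t ^+ k *+ _]mulr_natr -[t ^+ (k + j) *+ _]mulr_natr.
  have -> : t ^+ e = t ^+ k * t * t ^+ j by rewrite /e exprD exprSr.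
  rewrite !exprD exprSr !natrD -[k.+1%:R]natr1.
  by ring.
rewrite mulr_ge0 ?subr_ge0 ?amgm_nat // !mulr_ge0 ?exprn_ge0 ?ler0n //.
Qed.

Lemma power_gap_homogeneous v u s k e : (0 < k)%N -> (k <= e)%N ->
  0 <= v -> v <= u -> 0 < s ->
  k%:R * (e - k)%:R * (u ^+ e - v ^+ e) * (2 * s ^+ e - v ^+ e - u ^+ e) <=
  2 * e%:R * s ^+ e * (e%:R * (s ^+ (e - k) * (u ^+ k - v ^+ k)) - k%:R * (u ^+ e - v ^+ e)).
Proof.
case: k => // k _ ke v0 vu s0.
have := @power_gap k (e - k.+1) (v / s) (u / s) (divr_ge0 v0 (ltW s0)).
rewrite ler_pM2r ?invr_gt0 // => /(_ vu) /=; rewrite subnKC //.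
have se0 : 0 < s ^+ e by apply: exprn_gt0.
have sk0 : 0 < s ^+ k.+1 by apply: exprn_gt0.
have sek : s ^+ e = s ^+ (e - k.+1) * s ^+ k.+1 by rewrite -exprD subnK.
rewrite !expr_div_n => H.
rewrite -(ler_pM2r (exprn_gt0 2 se0)) in H.
move: H; congr (_ <= _); first by field; rewrite gt_eqF.
rewrite [in RHS]mulrA [in RHS](_ : s ^+ (e - k.+1) = s ^+ e / s ^+ k.+1); last first.
  by rewrite sek mulfK // gt_eqF.
by field; rewrite !gt_eqF.
Qed.

(** The first equation forces [v < s], and then by AM-GM, strict at the vertex with [0 < d j < e],
    also [u ^ e + v ^ e < 2 s ^ e]. By [power_gap_homogeneous] every [gap j] is then nonnegative,
    and positive at that vertex. But the difference of the two equations, together with the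
    handshake identity for the [d j], says that the gaps add up to zero. *)
Lemma two_cluster_rigid (m e : nat) (d : 'I_m -> nat) u v s :
  (forall j, d j <= e)%N -> (\sum_j d j = 2 * e)%N ->
  (exists j, 0 < d j < e)%N -> 0 <= v -> 0 <= s -> v < u ->
  \sum_j v ^+ (e - d j) * s ^+ d j = u ^+ e + (m%:R - 1) * v ^+ e ->
  \sum_j u ^+ (e - d j) * s ^+ d j = v ^+ e + (m%:R - 1) * u ^+ e -> False.
Proof.
move=> de sumd [j0 /andP[dj0 dje]] v0 s0 vu eq1 eq2.
have u0 : 0 <= u by apply: le_trans (ltW vu).
have e0 : (0 < e)%N by apply: leq_trans (ltnW dje).
have eR : 0 < e%:R :> R by rewrite ltr0n.
have ltve : v ^+ e < u ^+ e by rewrite ltr_pXn2r ?nnegrE // -lt0n.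
have vs : v < s.
  rewrite ltNge; apply/negP => sv; suff : u ^+ e + (m%:R - 1) * v ^+ e <= m%:R * v ^+ e by lra.
  rewrite -eq1 -[X in _ <= X%:R * _]card_ord mulr_natl -sumr_const; apply: ler_sum => j _.
  rewrite -[in leRHS](subnK (de j)) exprD ler_wpM2l ?exprn_ge0 //.
  by rewrite lerXn2r ?nnegrE.
have sp : 0 < s by apply: le_lt_trans vs.
have sumdR : \sum_j (d j)%:R = 2 * e%:R :> R by rewrite -natr_sum sumd natrM.
have sumk : \sum_j (e - d j)%:R = (m%:R - 2) * e%:R :> R.
  rewrite (eq_bigr (fun j => e%:R - (d j)%:R)) => [|j _]; last by rewrite natrB.
  by rewrite sumrB sumdR sumr_const card_ord -[_ *+ m]mulr_natl; ring.
have lt2 : u ^+ e + v ^+ e < 2 * s ^+ e.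
  have : \sum_j e%:R * (v ^+ (e - d j) * s ^+ d j) <
      \sum_j ((e - d j)%:R * v ^+ e + (d j)%:R * s ^+ e).
    rewrite (bigD1 j0) //= [ltRHS](bigD1 j0) //=; apply: ltr_leD.
      exact: amgm_weighted_strict.
    by apply: ler_sum => j _; apply: amgm_weighted.
  rewrite -mulr_sumr eq1 big_split /= -!mulr_suml sumk sumdR => H.
  rewrite -(ltr_pM2l eR); move: H; move: (u ^+ e) (v ^+ e) (s ^+ e) => U W S H.
  by nra.
have se0 : 0 < s ^+ e by apply: exprn_gt0.
pose gap j := e%:R * (s ^+ d j * (u ^+ (e - d j) - v ^+ (e - d j))) -
  (e - d j)%:R * (u ^+ e - v ^+ e).
have gap_ge j : (d j < e)%N ->
    (e - d j)%:R * (d j)%:R * (u ^+ e - v ^+ e) * (2 * s ^+ e - v ^+ e - u ^+ e) <=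
    2 * e%:R * s ^+ e * gap j.
  move=> ltj; have := @power_gap_homogeneous v u s (e - d j) e.
  by rewrite subn_gt0 leq_subr subKn // => /(_ ltj isT v0 (ltW vu) sp).
have c0 : 0 < 2 * e%:R * s ^+ e by rewrite !mulr_gt0.
have gap0 j : 0 <= gap j.
  have [ltj|] := ltnP (d j) e; last first.
    by rewrite -subn_eq0 /gap => /eqP ->; rewrite !expr0 subrr mul0r !mulr0 subr0.
  rewrite -(pmulr_rge0 _ c0); apply: le_trans (gap_ge j ltj).
  by rewrite !mulr_ge0 ?ler0n //; lra.
have gapj0 : 0 < gap j0.
  rewrite -(pmulr_rgt0 _ c0); apply: lt_le_trans (gap_ge j0 dje).
  by rewrite !mulr_gt0 ?ltr0n ?subn_gt0 //; lra.
have : \sum_j gap j = 0.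
  rewrite sumrB -mulr_suml sumk -mulr_sumr.
  have -> : \sum_j s ^+ d j * (u ^+ (e - d j) - v ^+ (e - d j)) =
      \sum_j u ^+ (e - d j) * s ^+ d j - \sum_j v ^+ (e - d j) * s ^+ d j.
    by rewrite -sumrB; apply: eq_bigr => j _; ring.
  by rewrite eq1 eq2; ring.
rewrite (bigD1 j0) //=; have : 0 <= \sum_(j | j != j0) gap j by apply: sumr_ge0.
by lra.
Qed.

(** Once [v = p], the second equation is a vanishing sum of terms
    [p ^ (e - d j) * (s ^ d j - p ^ d j)], which all have the sign of [s - p] or vanish. *)
Lemma one_cluster_rigid (m e : nat) (d : 'I_m -> nat) (p v s : R) :
  (0 < e)%N -> (forall j, d j <= e)%N -> (exists j, 0 < d j)%N ->
  0 < p -> 0 <= v -> 0 <= s -> v ^+ e = p ^+ e ->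
  \sum_j v ^+ (e - d j) * s ^+ d j = m%:R * p ^+ e -> s = p.
Proof.
move=> e0 de [j0 dj0] p0 v0 s0 /eqP; rewrite eqrXn2 ?(ltW p0) // => /eqP -> eq1.
have E : \sum_j p ^+ (e - d j) * p ^+ d j = m%:R * p ^+ e.
  rewrite (eq_bigr (fun=> p ^+ e)) => [|j _]; last by rewrite -exprD subnK.
  by rewrite sumr_const card_ord mulr_natl.
have {}E : \sum_j p ^+ (e - d j) * (s ^+ d j - p ^+ d j) = 0.
  by under eq_bigr do rewrite mulrBr; rewrite sumrB eq1 E subrr.
have pk j : 0 < p ^+ (e - d j) by apply: exprn_gt0.
have [lt|lt|//] := ltgtP s p; move: E; rewrite (bigD1 j0) //= => E.
  suff : p ^+ (e - d j0) * (s ^+ d j0 - p ^+ d j0) +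
      \sum_(j | j != j0) p ^+ (e - d j) * (s ^+ d j - p ^+ d j) < 0 by rewrite E ltxx.
  rewrite -[ltRHS]addr0; apply: ltr_leD.
  - by rewrite pmulr_rlt0 // subr_lt0 ltr_pXn2r ?nnegrE ?(ltW p0) // -lt0n.
  - apply: sumr_le0 => j _; rewrite pmulr_rle0 // subr_le0 lerXn2r ?nnegrE ?(ltW p0) //.
    exact: ltW.
suff : 0 < p ^+ (e - d j0) * (s ^+ d j0 - p ^+ d j0) +
    \sum_(j | j != j0) p ^+ (e - d j) * (s ^+ d j - p ^+ d j) by rewrite E ltxx.
rewrite -[ltLHS]addr0; apply: ltr_leD.
- by rewrite pmulr_rgt0 // subr_gt0 ltr_pXn2r ?nnegrE ?(ltW p0) // -lt0n.
- apply: sumr_ge0 => j _; rewrite pmulr_rge0 // subr_ge0 lerXn2r ?nnegrE ?(ltW p0) //.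
  exact: ltW.
Qed.

End PowerInequalities.

(** * Compactness: tolerances for the rigidity statements *)

Section Compactness.
Variable R : realType.
Local Open Scope classical_set_scope.
Local Notation cube3 := ((R * R) * R)%type.

Definition unit_cube : set cube3 := (`[0, 1] `*` `[0, 1]) `*` `[0, 1].

Lemma pos_on_unit_cube (Phi : cube3 -> R) : continuous Phi ->
  (forall z, unit_cube z -> 0 < Phi z) ->
  exists2 eps : R, 0 < eps & forall z, unit_cube z -> eps <= Phi z.
Proof.
move=> cPhi pos; have [|||c] := @compact_EVT_min _ R Phi unit_cube.
- by exists ((0, 0), 0); rewrite /unit_cube /= !in_itv /= !lexx !ler01.
- by apply: compact_setX; [apply: compact_setX|]; apply: segment_compact.
- exact: continuous_subspaceT.
rewrite inE => cA H; exists (Phi c); first exact: pos.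
by move=> z zA; apply: H; rewrite inE.
Qed.

Lemma continuous_pow (T : topologicalType) (f : T -> R) (k : nat) :
  continuous f -> continuous (fun z => f z ^+ k).
Proof.
move=> cf z; apply: (@continuous_comp _ _ _ f (fun t => t ^+ k)); first exact: cf.
exact: exprn_continuous.
Qed.

Lemma continuous_normr (T : topologicalType) (f : T -> R) :
  continuous f -> continuous (fun z => `|f z|).
Proof.
move=> cf z; apply: (@continuous_comp _ _ _ f (fun t => `|t|)); first exact: cf.
exact: norm_continuous.
Qed.

Lemma continuous_add (T : topologicalType) (f g : T -> R) :
  continuous f -> continuous g -> continuous (fun z => f z + g z).
Proof. by move=> cf cg z; apply: continuousD; [apply: cf|apply: cg]. Qed.

Lemma continuous_sub (T : topologicalType) (f g : T -> R) :
  continuous f -> continuous g -> continuous (fun z => f z - g z).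
Proof. by move=> cf cg z; apply: continuousB; [apply: cf|apply: cg]. Qed.

Lemma continuous_mul (T : topologicalType) (f g : T -> R) :
  continuous f -> continuous g -> continuous (fun z => f z * g z).
Proof. by move=> cf cg z; apply: continuousM; [apply: cf|apply: cg]. Qed.

Lemma continuous_const (T : topologicalType) (c : R) : continuous (fun _ : T => c).
Proof. by move=> z; apply: cst_continuous. Qed.

Lemma continuous_sum (T : topologicalType) (I : Type) (r : seq I) (f : I -> T -> R) :
  (forall i, continuous (f i)) -> continuous (fun z => \sum_(i <- r) f i z).
Proof.
move=> cf; elim: r => [|i r IHr].
  by under eq_fun do rewrite big_nil; apply: continuous_const.
by under eq_fun do rewrite big_cons; apply: continuous_add.
Qed.

Lemma continuous_fst (T U : topologicalType) : continuous (@fst T U).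
Proof. by move=> z; apply: cvg_fst. Qed.

Lemma continuous_snd (T U : topologicalType) : continuous (@snd T U).
Proof. by move=> z; apply: cvg_snd. Qed.

Lemma cube_coord1 : continuous (fun z : cube3 => z.1.1).
Proof. by move=> z; apply: (@continuous_comp _ _ _ fst fst); apply: continuous_fst. Qed.

Lemma cube_coord2 : continuous (fun z : cube3 => z.1.2).
Proof.
move=> z; apply: (@continuous_comp _ _ _ fst snd); first exact: continuous_fst.
exact: continuous_snd.
Qed.

Lemma cube_coord3 : continuous (fun z : cube3 => z.2).
Proof. exact: continuous_snd. Qed.

(** A continuous function that is positive on the compact cube has a positive minimum there. The
    condition [v < u] is strengthened to a closed one by means of [c]. *)
Lemma two_cluster_gap (m e : nat) (d : 'I_m -> nat) (c : R) :
  (forall j, d j <= e)%N -> (\sum_j d j = 2 * e)%N ->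
  (exists j, 0 < d j < e)%N -> 0 < c ->
  exists2 eps : R, 0 < eps & forall u v s : R,
    0 <= u <= 1 -> 0 <= v <= 1 -> 0 <= s <= 1 -> c <= u ^+ e - v ^+ e ->
    `|\sum_j v ^+ (e - d j) * s ^+ d j - (u ^+ e + (m%:R - 1) * v ^+ e)| < eps ->
    `|\sum_j u ^+ (e - d j) * s ^+ d j - (v ^+ e + (m%:R - 1) * u ^+ e)| < eps -> False.
Proof.
move=> de sumd ex c0.
pose E1 (z : cube3) : R := \sum_j z.1.2 ^+ (e - d j) * z.2 ^+ d j -
  (z.1.1 ^+ e + (m%:R - 1) * z.1.2 ^+ e).
pose E2 (z : cube3) : R := \sum_j z.1.1 ^+ (e - d j) * z.2 ^+ d j -
  (z.1.2 ^+ e + (m%:R - 1) * z.1.1 ^+ e).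
pose t (z : cube3) : R := c - (z.1.1 ^+ e - z.1.2 ^+ e).
(* The penalty [t + |t|] vanishes exactly where [u ^ e - v ^ e] is at least [c], so positivity of
   [Phi] on the whole cube expresses that the equations have no solution in that region. *)
pose Phi (z : cube3) : R := `|E1 z| + `|E2 z| + (t z + `|t z|).
have cE1 : continuous E1.
  apply: (@continuous_sub _ _ _ (@continuous_sum _ _ _ _ (fun j => @continuous_mul _ _ _ (@continuous_pow _ _ (e - d j) (@cube_coord2)) (@continuous_pow _ _ (d j) (@cube_coord3))))).
  apply: (@continuous_add _ _ _ (@continuous_pow _ _ e (@cube_coord1))).
  exact: (@continuous_mul _ _ _ (@continuous_const _ (m%:R - 1)) (@continuous_pow _ _ e (@cube_coord2))).
have cE2 : continuous E2.
  apply: (@continuous_sub _ _ _ (@continuous_sum _ _ _ _ (fun j => @continuous_mul _ _ _ (@continuous_pow _ _ (e - d j) (@cube_coord1)) (@continuous_pow _ _ (d j) (@cube_coord3))))).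
  apply: (@continuous_add _ _ _ (@continuous_pow _ _ e (@cube_coord2))).
  exact: (@continuous_mul _ _ _ (@continuous_const _ (m%:R - 1)) (@continuous_pow _ _ e (@cube_coord1))).
have ct : continuous t.
  apply: (@continuous_sub _ _ _ (@continuous_const _ c)).
  exact: (@continuous_sub _ _ _ (@continuous_pow _ _ e (@cube_coord1)) (@continuous_pow _ _ e (@cube_coord2))).
have cPhi : continuous Phi.
  apply: (@continuous_add _ _ _ (@continuous_add _ _ _ (@continuous_normr _ _ cE1) (@continuous_normr _ _ cE2))).
  exact: @continuous_add _ _ _ ct (@continuous_normr _ _ ct).
have [|eps eps0 H] := pos_on_unit_cube cPhi.
  move=> [[u v] s] [[/= + +] +]; rewrite !in_itv /= => /andP[u0 u1] /andP[v0 v1] /andP[s0 s1].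
  rewrite ltNge; apply/negP => P0; rewrite /Phi in P0.
  have a1 := normr_ge0 (E1 (u, v, s)); have a2 := normr_ge0 (E2 (u, v, s)).
  have a3 : 0 <= t (u, v, s) + `|t (u, v, s)|.
    by have := ler_norm (- t (u, v, s)); rewrite normrN; lra.
  have t0 : t (u, v, s) <= 0.
    have := normr_ge0 (t (u, v, s)); lra.
  have /eqP : `|E1 (u, v, s)| = 0 by lra.
  rewrite normr_eq0 subr_eq0 => /eqP /= e1.
  have /eqP : `|E2 (u, v, s)| = 0 by lra.
  rewrite normr_eq0 subr_eq0 => /eqP /= e2.
  apply: (two_cluster_rigid de sumd ex v0 s0 _ e1 e2).
  rewrite /t /= in t0; rewrite ltNge; apply/negP => uv.
  have : u ^+ e <= v ^+ e by rewrite lerXn2r ?nnegrE.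
  by lra.
exists (eps / 2); first by rewrite divr_gt0.
move=> u v s u01 v01 s01 cuv h1 h2.
have := H ((u, v), s); rewrite /unit_cube /= !in_itv /= => /(_ (conj (conj u01 v01) s01)).
rewrite /Phi; have : t (u, v, s) <= 0 by rewrite /t /=; lra.
move=> t0; rewrite (ler0_norm t0) subrr addr0 leNgt => /negP; apply.
by rewrite [ltRHS]splitr ltrD.
Qed.

Lemma one_cluster_gap (m e : nat) (d : 'I_m -> nat) (p c : R) :
  (0 < e)%N -> (forall j, d j <= e)%N -> (exists j, 0 < d j)%N ->
  0 < p -> 0 < c ->
  exists2 eps : R, 0 < eps & forall v s : R,
    0 <= v <= 1 -> 0 <= s <= 1 -> c <= `|s - p| ->
    `|v ^+ e - p ^+ e| < eps ->
    `|\sum_j v ^+ (e - d j) * s ^+ d j - m%:R * p ^+ e| < eps -> False.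
Proof.
move=> e0 de ex p0 c0.
pose E1 (z : cube3) : R := z.1.2 ^+ e - p ^+ e.
pose E2 (z : cube3) : R := \sum_j z.1.2 ^+ (e - d j) * z.2 ^+ d j - m%:R * p ^+ e.
pose t (z : cube3) : R := c - `|z.2 - p|.
pose Phi (z : cube3) : R := `|E1 z| + `|E2 z| + (t z + `|t z|).
have cE1 : continuous E1.
  exact: (@continuous_sub _ _ _ (@continuous_pow _ _ e (@cube_coord2)) (@continuous_const _ (p ^+ e))).
have cE2 : continuous E2.
  apply: (@continuous_sub _ _ _ (@continuous_sum _ _ _ _ (fun j => @continuous_mul _ _ _ (@continuous_pow _ _ (e - d j) (@cube_coord2)) (@continuous_pow _ _ (d j) (@cube_coord3))))).
  exact: (@continuous_const _ (m%:R * p ^+ e)).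
have ct : continuous t.
  apply: (@continuous_sub _ _ _ (@continuous_const _ c)).
  exact: (@continuous_normr _ _ (@continuous_sub _ _ _ (@cube_coord3) (@continuous_const _ p))).
have cPhi : continuous Phi.
  apply: (@continuous_add _ _ _ (@continuous_add _ _ _ (@continuous_normr _ _ cE1) (@continuous_normr _ _ cE2))).
  exact: @continuous_add _ _ _ ct (@continuous_normr _ _ ct).
have [|eps eps0 H] := pos_on_unit_cube cPhi.
  move=> [[u v] s] [[/= + +] +]; rewrite !in_itv /= => _ /andP[v0 v1] /andP[s0 s1].
  rewrite ltNge; apply/negP => P0; rewrite /Phi in P0.
  have a1 := normr_ge0 (E1 (u, v, s)); have a2 := normr_ge0 (E2 (u, v, s)).
  have a3 : 0 <= t (u, v, s) + `|t (u, v, s)|.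
    by have := ler_norm (- t (u, v, s)); rewrite normrN; lra.
  have t0 : t (u, v, s) <= 0.
    have := normr_ge0 (t (u, v, s)); lra.
  have /eqP : `|E1 (u, v, s)| = 0 by lra.
  rewrite normr_eq0 subr_eq0 => /eqP /= e1.
  have /eqP : `|E2 (u, v, s)| = 0 by lra.
  rewrite normr_eq0 subr_eq0 => /eqP /= e2.
  have sp := one_cluster_rigid e0 de ex p0 v0 s0 e1 e2.
  by move: t0; rewrite /t /= sp subrr normr0; lra.
exists (eps / 2); first by rewrite divr_gt0.
move=> v s v01 s01 cs h1 h2.
have := H ((0, v), s); rewrite /unit_cube /= !in_itv /= lexx ler01.
move=> /(_ (conj (conj isT v01) s01)).
rewrite /Phi; have : t (0, v, s) <= 0 by rewrite /t /=; lra.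
move=> t0; rewrite (ler0_norm t0) subrr addr0 leNgt => /negP; apply.
by rewrite [ltRHS]splitr ltrD.
Qed.

End Compactness.

(** * From hereditary counts to the cut condition *)

Lemma set_avg_ge (R : realType) (V : finType) (g : V -> R) (W : {set V}) (c : R) :
  (0 < #|W|)%N -> (forall v, v \in W -> c <= g v) -> c <= set_avg g W.
Proof.
move=> W0 H; rewrite ler_pdivlMr ?ltr0n // mulr_natr -sumr_const.
exact: ler_sum.
Qed.

Lemma set_avg_le (R : realType) (V : finType) (g : V -> R) (W : {set V}) (c : R) :
  (0 < #|W|)%N -> (forall v, v \in W -> g v <= c) -> set_avg g W <= c.
Proof.
move=> W0 H; rewrite ler_pdivrMr ?ltr0n // mulr_natr -sumr_const.
exact: ler_sum.
Qed.

(** [gX] and [gY] are means of [g] over clusters in [X] and [Y]; they are described only by the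
    bounds they inherit from [g] on these sets. The equations come in two versions, exchanging the
    roles of the two cluster families. *)
Lemma cluster_lemma (R : realType) (m : nat) (L : seq ('I_m * 'I_m)) (p eps theta : R) :
  (0 < m)%N -> uniq L -> all (fun q : 'I_m * 'I_m => q.1 < q.2)%N L ->
  0 < eps -> 0 < theta ->
  exists2 eps' : R, 0 < eps' & exists n0 : nat,
  forall (up : bool) (V : finType) (E : rel V) (g : V -> R) (X Y : {set V}),
  symmetric E -> (n0 <= #|V|)%N ->
  theta * #|V|%:R <= #|X|%:R -> theta * #|V|%:R <= #|Y|%:R ->
  (forall W : {set V}, `|mform (fun x => hom_dev E L p x - additive_form g x) (fun=> W)|
     <= eps' * #|V|%:R ^+ m) ->
  exists u v s gX gY : R,
  [/\ [/\ 0 <= u <= 1, 0 <= v <= 1 & 0 <= s <= 1],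
      `|u ^+ size L - p ^+ size L - gX| <= eps /\ `|v ^+ size L - p ^+ size L - gY| <= eps,
      `|\sum_j v ^+ (size L - edges_at L j) * s ^+ edges_at L j
        - m%:R * p ^+ size L - (m%:R - 1) * gY - gX| <= eps /\
      `|\sum_j u ^+ (size L - edges_at L j) * s ^+ edges_at L j
        - m%:R * p ^+ size L - (m%:R - 1) * gX - gY| <= eps,
      [/\ forall c, (forall x, x \in X -> c <= g x) -> c <= gX,
          forall c, (forall x, x \in X -> g x <= c) -> gX <= c,
          forall c, (forall x, x \in Y -> c <= g x) -> c <= gY &
          forall c, (forall x, x \in Y -> g x <= c) -> gY <= c] &
      if up then wsum (erel R E) X Y <= s * #|X|%:R * #|Y|%:R
      else s * #|X|%:R * #|Y|%:R <= wsum (erel R E) X Y].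
Proof.
move=> m0 uL lL eps0 theta0.
have mR0 : 0 < m%:R :> R by rewrite ltr0n.
(* [eps1] and [eps'] are such that each of the two error terms in [cluster_equations], multiplied by
   [m], is at most [eps / 2]. *)
pose eps1 := eps / (2 * m%:R * (size L).+1%:R).
have eps10 : 0 < eps1 by rewrite divr_gt0 // !mulr_gt0 // ltr0n.
have [beta beta0 [n1 Hn1]] := exists_clusters m eps10 theta0.
have bm0 : 0 < beta ^+ m by apply: exprn_gt0.
pose eps' := eps * beta ^+ m / (2 * m%:R * 2 ^+ m).
have eps'0 : 0 < eps' by rewrite divr_gt0 ?mulr_gt0 // ?exprn_gt0.
exists eps' => //; exists n1.+1 => up V E g X Y symE len leX leY HW.
have V0 : (0 < #|V|)%N by apply: leq_trans len.
pose err := (size L)%:R * eps1 + 2 ^+ m * eps' / beta ^+ m.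
have errle : m%:R * err <= eps.
  have -> : m%:R * err = eps * ((size L)%:R / (size L).+1%:R) / 2 + eps / 2.
    rewrite /err /eps1 /eps'; field.
    by rewrite -natr1 !gt_eqF ?exprn_gt0 // ltr_wpDl ?ler0n.
  rewrite [leRHS]splitr lerD2r ler_pM2r // ler_piMr ?(ltW eps0) //.
  by rewrite ler_pdivrMr ?ltr0n // mul1r ler_nat.
have err0 : 0 <= err.
  apply: addr_ge0; [apply: mulr_ge0|apply: divr_ge0; [apply: mulr_ge0|]];
    by rewrite ?ler0n ?exprn_ge0 // ltW.
have errle1 : err <= eps.
  by apply: le_trans errle; rewrite ler_peMl // ler1n.
have ua : unit_valued (erel R E).
  by move=> x y; rewrite /erel; case: (E x y); rewrite ?lexx ?ler01.
have sa x y : erel R E x y = erel R E y x by rewrite /erel symE.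
have [Bx [By [u [v [s [HB dB [u01 v01 s01] HR dir]]]]]] :=
  Hn1 up V (erel R E) X Y ua sa (ltnW len) leX leY.
have cBx i : (0 < #|Bx i|)%N.
  by rewrite -(ltr0n R); have [_ _ h _] := HB i; apply: lt_le_trans h; rewrite mulr_gt0 // ltr0n.
have cBy i : (0 < #|By i|)%N.
  by rewrite -(ltr0n R); have [_ _ _ h] := HB i; apply: lt_le_trans h; rewrite mulr_gt0 // ltr0n.
pose avg (B : 'I_m -> {set V}) := m%:R^-1 * \sum_i set_avg g (B i).
have avg_ge (B : 'I_m -> {set V}) c : (forall i, 0 < #|B i|)%N ->
    (forall i x, x \in B i -> c <= g x) -> c <= avg B.
  move=> B0 H; rewrite /avg mulrC ler_pdivlMr // mulr_natr -[X in _ *+ X]card_ord -sumr_const.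
  by apply: ler_sum => i _; apply: set_avg_ge (B0 i) (H i).
have avg_le (B : 'I_m -> {set V}) c : (forall i, 0 < #|B i|)%N ->
    (forall i x, x \in B i -> g x <= c) -> avg B <= c.
  move=> B0 H; rewrite /avg mulrC ler_pdivrMr // mulr_natr -[X in _ *+ X]card_ord -sumr_const.
  by apply: ler_sum => i _; apply: set_avg_le (B0 i) (H i).
have sBX i x : x \in Bx i -> x \in X by have [/fintype.subsetP h _ _ _] := HB i; apply: h.
have sBY i x : x \in By i -> x \in Y by have [_ /fintype.subsetP h _ _] := HB i; apply: h.
have [eq1 eq2] : `|v ^+ size L - p ^+ size L - avg By| <= err /\
    `|\sum_j v ^+ (size L - edges_at L j) * s ^+ edges_at L j
    - m%:R * p ^+ size L - (m%:R - 1) * avg By - avg Bx| <= m%:R * err.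
  apply: (cluster_equations (E := E) (Bx := Bx) (By := By) uL lL V0 beta0 (ltW eps'0)) => //.
  - by move=> i j _; have [] := dB i j.
  - by move=> i j; have [] := dB i j.
  - by move=> i; have [] := HB i.
  - by move=> i; have [] := HB i.
  - by move=> i j _; have [] := HR i j.
  - by move=> i j; have [] := HR i j.
have [eq3 eq4] : `|u ^+ size L - p ^+ size L - avg Bx| <= err /\
    `|\sum_j u ^+ (size L - edges_at L j) * s ^+ edges_at L j
    - m%:R * p ^+ size L - (m%:R - 1) * avg Bx - avg By| <= m%:R * err.
  apply: (cluster_equations (E := E) (Bx := By) (By := Bx) uL lL V0 beta0 (ltW eps'0)) => //.
  - by move=> i j _; rewrite disjoint_sym; have [] := dB j i.
  - by move=> i j; have [] := dB i j.
  - by move=> i; have [] := HB i.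
  - by move=> i; have [] := HB i.
  - by move=> i j _; apply: regular_pairC => //; have [] := HR j i.
  - by move=> i j; have [] := HR i j.
exists u, v, s, (avg Bx), (avg By); split=> //.
- by split; apply: le_trans errle1.
- by split; apply: le_trans errle.
- split=> c Hc.
  + by apply: avg_ge => // i x xB; apply: Hc; apply: sBX xB.
  + by apply: avg_le => // i x xB; apply: Hc; apply: sBX xB.
  + by apply: avg_ge => // i x xB; apply: Hc; apply: sBY xB.
  + by apply: avg_le => // i x xB; apply: Hc; apply: sBY xB.
Qed.

Section EdgeList.
Variables (m : nat) (L : seq ('I_m * 'I_m)).
Hypotheses (uL : uniq L) (lL : all (fun q : 'I_m * 'I_m => q.1 < q.2)%N L).

Lemma edges_at_le j : (edges_at L j <= size L)%N.
Proof. exact: count_size. Qed.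

Lemma sum_edges_at : (\sum_j edges_at L j = 2 * size L)%N.
Proof.
rewrite /edges_at; elim: (L) lL => [|q l IHl] /=; first by rewrite big1.
case/andP => ltq /IHl e; rewrite big_split /= e mulnS; congr (_ + _)%N.
have nq : q.1 != q.2 by rewrite neq_ltn ltq.
rewrite (bigD1 q.1) //= eqxx (bigD1 q.2) 1?eq_sym //= eqxx orbT big1 // => j /andP[j1 j2].
by rewrite ![_ == j]eq_sym (negbTE j1) (negbTE j2).
Qed.

Lemma exists_edges_at : (0 < size L)%N -> exists j, (0 < edges_at L j)%N.
Proof.
case: L => // q l _; exists q.1; rewrite -has_count; apply/hasP.
by exists q; rewrite ?mem_head // eqxx.
Qed.

(** Take two distinct edges [a] and [b]. If both ends of [a] lay on every edge, they would be the
    ends of [b], and [b] would equal [a]. *)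
Lemma exists_edges_at_lt : (1 < size L)%N ->
  exists j, (0 < edges_at L j < size L)%N.
Proof.
move=> L1; have [a [b [aL bL nab]]] : exists a b, [/\ a \in L, b \in L & a != b].
  case: (L) uL L1 => [|a [|b l]] //= /andP[+ _] _.
  rewrite inE negb_or => /andP[nab _]; exists a, b; split=> //; first exact: mem_head.
  by rewrite !inE eqxx orbT.
have lta := allP lL a aL; have ltb := allP lL b bL.
have pos j : (a.1 == j) || (a.2 == j) -> (0 < edges_at L j)%N.
  by move=> h; rewrite -has_count; apply/hasP; exists a.
have full j : edges_at L j = size L -> (b.1 == j) || (b.2 == j).
  by move/eqP; rewrite -all_count => /allP; apply.
have [lt1|] := ltnP (edges_at L a.1) (size L).
  by exists a.1; rewrite lt1 andbT; apply: pos; rewrite eqxx.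
have [lt2|] := ltnP (edges_at L a.2) (size L).
  by exists a.2; rewrite lt2 andbT; apply: pos; rewrite eqxx orbT.
move=> h2 h1.
have /full f1 : edges_at L a.1 = size L by apply/eqP; rewrite eqn_leq edges_at_le.
have /full f2 : edges_at L a.2 = size L by apply/eqP; rewrite eqn_leq edges_at_le.
case/eqP: nab; rewrite [a]surjective_pairing [b]surjective_pairing.
case/orP: f1 => /eqP e1; case/orP: f2 => /eqP e2.
- by rewrite -e1 -e2 ltnn in lta.
- by rewrite e1 e2.
- by rewrite -e1 -e2 ltnNge (ltnW ltb) in lta.
- by rewrite -e1 -e2 ltnn in lta.
Qed.

End EdgeList.

(** A deviation above [c n ^ 2] forces [|X|] and [|Y|] to be at least [c n], so that clusters exist.
    With [up] chosen by the sign of the deviation, the density [s] across the clusters is at least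
    [c] away from [p], against [one_cluster_gap]. *)
Lemma hereditary_count_cut (R : realType) (m : nat) (L : seq ('I_m * 'I_m)) (p c : R) :
  uniq L -> all (fun q : 'I_m * 'I_m => q.1 < q.2)%N L -> (0 < size L)%N ->
  0 < p -> p <= 1 -> 0 < c ->
  exists2 eps : R, 0 < eps & exists n0 : nat, forall (V : finType) (E : rel V),
  symmetric E -> (n0 <= #|V|)%N ->
  (forall W : {set V}, `|mform (hom_dev E L p) (fun=> W)| <= eps * #|V|%:R ^+ m) ->
  forall X Y : {set V},
    `|wsum (erel R E) X Y - p * #|X|%:R * #|Y|%:R| <= c * #|V|%:R ^+ 2.
Proof.
move=> uL lL L0 p0 p1 c0.
have m0 : (0 < m)%N by case: L L0 {uL lL} => // -[i j] l _; apply: leq_ltn_trans (ltn_ord i).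
have [eps1 eps10 Hgap] := one_cluster_gap L0 (edges_at_le L) (exists_edges_at L0) p0 c0.
have [|eps eps0 [n0 H]] := @cluster_lemma R m L p (eps1 / 2) c m0 uL lL _ c0.
  by rewrite divr_gt0.
exists eps => //; exists n0.+1 => V E symE len HW X Y; rewrite leNgt; apply/negP => big.
have V0 : 0 < #|V|%:R :> R by rewrite ltr0n; apply: leq_trans len.
set x : R := #|X|%:R; set y : R := #|Y|%:R; set n : R := #|V|%:R in big V0 HW *.
have x0 : 0 <= x by rewrite ler0n.
have y0 : 0 <= y by rewrite ler0n.
have xn : x <= n by rewrite ler_nat max_card.
have yn : y <= n by rewrite ler_nat max_card.
have ua : unit_valued (erel R E).
  by move=> a b; rewrite /erel; case: (E a b); rewrite ?lexx ?ler01.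
have w0 := wsum_ge0 X Y ua; have w1 := wsum_le X Y ua; rewrite -/x -/y in w1 big.
set w := wsum _ _ _ in w0 w1 big.
have xy0 : 0 <= x * y by rewrite mulr_ge0.
have pxy : 0 <= p * x * y by rewrite -mulrA mulr_ge0 // ltW.
have pxy1 : p * x * y <= x * y by rewrite -mulrA ler_piMl.
have cxy : c * n ^+ 2 < x * y.
  by apply: lt_le_trans big _; rewrite ler_norml; lra.
have lex : c * n <= x.
  rewrite -(ler_pM2r V0) -mulrA -expr2; apply: le_trans (ltW cxy) _.
  exact: ler_wpM2l.
have ley : c * n <= y.
  rewrite -(ler_pM2r V0) -mulrA -expr2; apply: le_trans (ltW cxy) _.
  by rewrite mulrC; apply: ler_wpM2l.
have xyp : 0 < x * y by apply: lt_trans cxy; rewrite mulr_gt0 // exprn_gt0.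
have HW0 (W : {set V}) : `|mform (fun x => hom_dev E L p x - additive_form (fun=> 0) x) (fun=> W)|
     <= eps * n ^+ m.
  have -> : (fun x => hom_dev E L p x - additive_form (fun=> 0) x) = hom_dev E L p.
    by apply: funext => z; rewrite /additive_form big1 // mulr0 subr0.
  exact: HW.
have [u [v [s [gX [gY [[_ v01 s01] [_ e1] [e2 _] [bX1 bX2 bY1 bY2] dir]]]]]] :=
  H (p * x * y < w) V E (fun=> 0) X Y symE (ltnW len) lex ley HW0.
have gX0 : gX = 0 by apply: le_anti; rewrite bX1 // bX2.
have gY0 : gY = 0 by apply: le_anti; rewrite bY1 // bY2.
rewrite gX0 gY0 ?mulr0 ?subr0 in e1 e2.
have eps1h : eps1 / 2 < eps1 by rewrite ltr_pdivrMr // mulrC; lra.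
apply: (Hgap v s v01 s01) => //; last 2 first.
- exact: le_lt_trans e1 _.
- exact: le_lt_trans e2 _.
have cxyn : c * (x * y) <= c * n ^+ 2 by rewrite ler_pM2l // expr2 ler_pM.
rewrite -(ler_pM2r xyp) -[in leRHS](gtr0_norm xyp) -normrM.
move: dir; rewrite -/x -/y -/w; case: ltP => cmp dir.
  rewrite ger0_norm in big; last by lra.
  by rewrite ger0_norm; nra.
rewrite ler0_norm in big; last by lra.
by rewrite ler0_norm; nra.
Qed.

(** The first two equations express [gX] and [gY] through [u] and [v]; substituted in the other two,
    they leave those of [two_cluster_gap], while [gX - gY >= c] separates [u ^ e] from [v ^ e]. *)
Lemma separated_values_impossible (R : realType) (m : nat) (L : seq ('I_m * 'I_m))
    (p c theta : R) :
  uniq L -> all (fun q : 'I_m * 'I_m => q.1 < q.2)%N L -> (1 < size L)%N ->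
  0 < c -> 0 < theta ->
  exists2 eps : R, 0 < eps & exists n0 : nat,
  forall (V : finType) (E : rel V) (g : V -> R) (X Y : {set V}) (t : R),
  symmetric E -> (n0 <= #|V|)%N ->
  (forall W : {set V}, `|mform (fun x => hom_dev E L p x - additive_form g x) (fun=> W)|
     <= eps * #|V|%:R ^+ m) ->
  (forall x, x \in X -> t + c <= g x) -> (forall x, x \in Y -> g x <= t) ->
  theta * #|V|%:R <= #|X|%:R -> theta * #|V|%:R <= #|Y|%:R -> False.
Proof.
move=> uL lL L1 c0 theta0; have L0 : (0 < size L)%N by apply: ltnW.
have m0 : (0 < m)%N by case: L L0 {uL lL L1} => // -[i j] l _; apply: leq_ltn_trans (ltn_ord i).
have mR : 1 <= m%:R :> R by rewrite ler1n.
have [|eps1 eps10 Hgap] := two_cluster_gap (c := c / 2) (edges_at_le L) (sum_edges_at lL)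
    (exists_edges_at_lt uL lL L1).
  by rewrite divr_gt0.
(* The substitution adds up [m + 1] errors [eps2]; the bound [c / 4] leaves a gap of [c / 2] between
   [u ^ e] and [v ^ e]. *)
pose eps2 := Num.min (c / 4) (eps1 / (2 * (m%:R + 1))).
have eps20 : 0 < eps2.
  by rewrite lt_min !divr_gt0 // mulr_gt0 // ltr_wpDl ?ler0n.
have eps2c : eps2 <= c / 4 by rewrite ge_min lexx.
have eps2m : (m%:R + 1) * eps2 <= eps1 / 2.
  have : eps2 <= eps1 / (2 * (m%:R + 1)) by rewrite ge_min lexx orbT.
  rewrite ler_pdivlMr ?mulr_gt0 //; lra.
have [eps eps0 [n0 H]] := @cluster_lemma R m L p eps2 theta m0 uL lL eps20 theta0.
exists eps => //; exists n0 => V E g X Y t symE len HW gX gY leX leY.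
have [u [v [s [a [b [[u01 v01 s01] [e1 e2] [e3 e4] [a1 _ _ b2] _]]]]]] :=
  H true V E g X Y symE len leX leY HW.
have {}a1 := a1 _ gX; have {}b2 := b2 _ gY.
move: e1 e2; set U := u ^+ _; set W := v ^+ _; set P := p ^+ _ in e3 e4 *.
rewrite !ler_norml => /andP[e1 e1'] /andP[e2 e2'].
apply: (Hgap u v s u01 v01 s01); rewrite -/U -/W; first lra.
- move: e3; set A := \sum_j _; rewrite !ler_norml => /andP[e3 e3'].
  by rewrite ltr_norml; apply/andP; split; nra.
- move: e4; set A := \sum_j _; rewrite !ler_norml => /andP[e4 e4'].
  by rewrite ltr_norml; apply/andP; split; nra.
Qed.

Lemma mform_additive_bound (R : realType) (V : finType) (m : nat) (g : V -> R) (W : {set V}) :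
  (0 < m)%N ->
  `|mform (@additive_form R V m g) (fun=> W)| * #|V|%:R <= (\sum_v `|g v|) * #|V|%:R ^+ m.
Proof.
move=> m0; rewrite mformZ mform_sum normrM ger0_norm ?invr_ge0 ?ler0n // -mulrA mulrC.
rewrite ler_pdivrMr ?ltr0n // mulrAC.
apply: (@le_trans _ _ ((\sum_(j < m) (\sum_v `|g v|) * #|V|%:R ^+ m.-1) * #|V|%:R)).
  apply: ler_wpM2r => //; apply: le_trans (ler_norm_sum _ _ _) _.
  apply: ler_sum => j _; rewrite mform_coord normrM; apply: ler_pM => //.
    apply: le_trans (ler_norm_sum _ _ _) _; rewrite big_mkcond /=.
    by apply: ler_sum => v _; case: ifP.
  rewrite prodr_const normrX normr_nat.
  have -> : #|[pred k : 'I_m | k != j]| = m.-1.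
    by rewrite (eq_card (B := predC1 j)) // cardC1 card_ord.
  by rewrite lerXn2r ?nnegrE // ler_nat max_card.
rewrite sumr_const card_ord -[_ *+ m]mulr_natr -!mulrA [m%:R * _]mulrC [_ ^+ m.-1 * _]mulrA.
by rewrite -exprSr prednK // [_ ^+ m * _]mulrC mulrA.
Qed.

(** Two values [t] apart cannot both be passed, from above and from below, on many vertices. If
    [g >= 2 t] held often, [g <= t] would be rare and the sum of [g] would exceed [t / 2 * n],
    although it is nearly zero; symmetrically for [g <= - 2 t]. Hence [|g| <= 2 t] outside two small
    sets, where [|g| <= m]. *)
Lemma sum_abs_small (R : realType) (m : nat) (L : seq ('I_m * 'I_m)) (p delta : R) :
  uniq L -> all (fun q : 'I_m * 'I_m => q.1 < q.2)%N L -> (1 < size L)%N ->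
  0 < delta ->
  exists2 eps : R, 0 < eps & exists n0 : nat,
  forall (V : finType) (E : rel V) (g : V -> R),
  symmetric E -> (n0 <= #|V|)%N ->
  (forall W : {set V}, `|mform (fun x => hom_dev E L p x - additive_form g x) (fun=> W)|
     <= eps * #|V|%:R ^+ m) ->
  (forall v, `|g v| <= m%:R) -> `|\sum_v g v| <= eps * #|V|%:R ->
  \sum_v `|g v| <= delta * #|V|%:R.
Proof.
move=> uL lL L1 delta0; pose t := delta / 8; have t0 : 0 < t by rewrite divr_gt0.
have m0 : 0 <= m%:R :> R by rewrite ler0n.
have tm0 : 0 < t + m%:R by rewrite ltr_wpDr.
(* An exceptional set of [theta n] vertices changes the sum by at most
   [theta (t + m) n = t / 4 * n]. *)
pose theta := t / (4 * (t + m%:R)).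
have theta0 : 0 < theta by rewrite divr_gt0 // mulr_gt0.
have thetaE : theta * (t + m%:R) = t / 4.
  by rewrite /theta; field; rewrite gt_eqF.
have [eps1 eps10 [n0 H]] := separated_values_impossible p uL lL L1 t0 theta0.
pose eps := Num.min eps1 (t / 2).
have eps0 : 0 < eps by rewrite lt_min eps10 divr_gt0.
exists eps => //; exists n0.+1 => V E g symE len HW gm sg.
have n0' : 0 < #|V|%:R :> R by rewrite ltr0n; apply: leq_trans len.
set n : R := #|V|%:R in sg n0' *.
have HW1 (W : {set V}) : `|mform (fun x => hom_dev E L p x - additive_form g x) (fun=> W)|
     <= eps1 * #|V|%:R ^+ m.
  by apply: le_trans (HW W) _; rewrite ler_wpM2r ?exprn_ge0 // ge_min lexx.
have epst : eps <= t / 2 by rewrite ge_min lexx orbT.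
have sgt : `|\sum_v g v| <= t / 2 * n by apply: le_trans sg _; rewrite ler_wpM2r // ltW.
have cardE (W : {set V}) : #|W|%:R = \sum_v (v \in W)%:R :> R.
  by rewrite -sum1_card natr_sum big_mkcond; apply: eq_bigr => v _; case: (v \in W).
have sum_cst (c : R) : \sum_(v : V) c = c * n.
  by rewrite sumr_const mulr_natr.
move: sgt; rewrite ler_norml => /andP[sg1 sg2].
pose X1 := [set v | t + t <= g v]; pose Y1 := [set v | g v <= t].
pose X2 := [set v | - (t + t) + t <= g v]; pose Y2 := [set v | g v <= - (t + t)].
have gm1 v : - m%:R <= g v <= m%:R by rewrite -ler_norml.
have leX1 : #|X1|%:R <= theta * n.
  rewrite leNgt; apply/negP => big.
  have [lY|lY] := ltP #|Y1|%:R (theta * n); last first.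
    apply: (H V E g X1 Y1 t symE (ltnW len) HW1 _ _ (ltW big) lY) => x; by rewrite inE.
  have : \sum_v (t - (t + m%:R) * (v \in Y1)%:R) <= \sum_v g v.
    apply: ler_sum => v _; rewrite inE; have /andP[? ?] := gm1 v.
    by case: (leP (g v) t) => ?; rewrite ?mulr1 ?mulr0; lra.
  rewrite sumrB sum_cst -mulr_sumr -cardE; nra.
have leY2 : #|Y2|%:R <= theta * n.
  rewrite leNgt; apply/negP => big.
  have [lX|lX] := ltP #|X2|%:R (theta * n); last first.
    apply: (H V E g X2 Y2 (- (t + t)) symE (ltnW len) HW1 _ _ lX (ltW big)) => x; by rewrite inE.
  have : \sum_v g v <= \sum_v (- t + (t + m%:R) * (v \in X2)%:R).
    apply: ler_sum => v _; rewrite inE; have /andP[? ?] := gm1 v.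
    by case: (leP (- (t + t) + t) (g v)) => ?; rewrite ?mulr1 ?mulr0; lra.
  rewrite big_split /= sum_cst -mulr_sumr -cardE; nra.
have : \sum_v `|g v| <= \sum_v (t + t + m%:R * (v \in X1)%:R + m%:R * (v \in Y2)%:R).
  apply: ler_sum => v _; rewrite !inE; have := gm v.
  rewrite !ler_norml => /andP[? ?].
  case: (leP (t + t) (g v)) => ?; case: (leP (g v) (- (t + t))) => ?;
    by rewrite ?mulr1 ?mulr0; apply/andP; split; lra.
rewrite !big_split /= !sum_cst -!mulr_sumr -!cardE => le.
apply: le_trans le _; rewrite (_ : delta = 8 * t); last by rewrite /t; field.
have ? : m%:R * #|X1|%:R <= m%:R * (theta * n) by rewrite ler_wpM2l.
have ? : m%:R * #|Y2|%:R <= m%:R * (theta * n) by rewrite ler_wpM2l.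
have ? : m%:R * (theta * n) <= t / 4 * n.
  rewrite -thetaE mulrA ler_wpM2r ?(ltW n0') // mulrC ler_wpM2l ?(ltW theta0) //; lra.
have ? : 0 < t * n by rewrite mulr_gt0.
by lra.
Qed.

Lemma additive_part_small (R : realType) (m : nat) (L : seq ('I_m * 'I_m)) (p delta : R) :
  uniq L -> all (fun q : 'I_m * 'I_m => q.1 < q.2)%N L -> (1 < size L)%N ->
  0 < delta ->
  exists2 eps : R, 0 < eps & exists n0 : nat,
  forall (V : finType) (E : rel V) (g : V -> R),
  symmetric E -> (n0 <= #|V|)%N ->
  (forall W : {set V}, `|mform (fun x => hom_dev E L p x - additive_form g x) (fun=> W)|
     <= eps * #|V|%:R ^+ m) ->
  (forall v, `|g v| <= m%:R) -> `|\sum_v g v| <= eps * #|V|%:R ->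
  forall W : {set V}, `|mform (hom_dev E L p) (fun=> W)| <= delta * #|V|%:R ^+ m.
Proof.
move=> uL lL L1 delta0; have d20 : 0 < delta / 2 by rewrite divr_gt0.
have m0 : (0 < m)%N by case: L L1 {uL lL} => // -[i j] l _; apply: leq_ltn_trans (ltn_ord i).
have [eps1 eps10 [n0 H]] := sum_abs_small p uL lL L1 d20.
pose eps := Num.min eps1 (delta / 2).
have eps0 : 0 < eps by rewrite lt_min eps10.
exists eps => //; exists n0.+1 => V E g symE len HW gm sg W.
have n0' : 0 < #|V|%:R :> R by rewrite ltr0n; apply: leq_trans len.
have eps_1 : eps <= eps1 by rewrite ge_min lexx.
have eps_2 : eps <= delta / 2 by rewrite ge_min lexx orbT.
have sabs : \sum_v `|g v| <= delta / 2 * #|V|%:R.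
  apply: (H V E g symE (ltnW len)) => //.
    by move=> U; apply: le_trans (HW U) _; rewrite ler_wpM2r ?exprn_ge0.
  by apply: le_trans sg _; rewrite ler_wpM2r.
have le1 : `|mform (additive_form g) (fun _ : 'I_m => W)| <= delta / 2 * #|V|%:R ^+ m.
  rewrite -(ler_pM2r n0') mulrAC; apply: le_trans (mform_additive_bound g W m0) _.
  by rewrite ler_wpM2r ?exprn_ge0.
have le2 : `|mform (fun x => hom_dev E L p x - additive_form g x) (fun=> W)| <=
    delta / 2 * #|V|%:R ^+ m.
  by apply: le_trans (HW W) _; rewrite ler_wpM2r ?exprn_ge0.
rewrite mformB in le2; move: le1 le2; set A := mform (hom_dev E L p) _.
set B := mform (additive_form g) _ => le1 le2; have -> : A = (A - B) + B by ring.
apply: le_trans (ler_normD _ _) _; rewrite [delta in leRHS]splitr mulrDl.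
exact: lerD.
Qed.

(** * The cut condition and graph counts *)

Section EdgePairs.
Variables (m : nat) (F : sgraph 'I_m).

(** Each edge is listed once, with increasing ends, which is the form the counting lemma expects. *)
Definition edge_pairs : seq ('I_m * 'I_m) :=
  enum [pred q : 'I_m * 'I_m | (q.1 < q.2)%N && edge F q.1 q.2].

Lemma edge_pairs_uniq : uniq edge_pairs.
Proof. exact: enum_uniq. Qed.

Lemma edge_pairs_lt : all (fun q : 'I_m * 'I_m => q.1 < q.2)%N edge_pairs.
Proof. by apply/allP => q; rewrite mem_enum => /andP[]. Qed.

Lemma size_edge_pairs : size edge_pairs = num_edges F.
Proof.
rewrite -cardE /num_edges /edge_set.
pose D := [set q : 'I_m * 'I_m | (q.1 < q.2)%N && edge F q.1 q.2].
have -> : #|[pred q : 'I_m * 'I_m | (q.1 < q.2)%N && edge F q.1 q.2]| = #|D|.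
  by rewrite cardsE.
rewrite -(card_in_imset (f := fun q : 'I_m * 'I_m => [set q.1; q.2])); last first.
  move=> [a b] [c d]; rewrite !inE /= => /andP[ab _] /andP[cd _] /finset.setP eqs.
  have := eqs c; have := eqs d; rewrite !inE !eqxx ?orbT /=.
  move=> /orP[]/eqP ed /orP[]/eqP ec; rewrite ?ec ?ed // in cd *.
  - by rewrite ltnn in cd.
  - by rewrite ltnNge (ltnW ab) in cd.
  - by rewrite ltnn in cd.
apply: eq_card => s; apply/imsetP/imsetP => -[[a b]].
  by rewrite !inE /= => /andP[ab Fab] ->; exists (a, b).
rewrite inE /= => Fab ->; case: (ltngtP a b) => [lt|lt|/val_inj eqab].
- by exists (a, b); rewrite // inE /= lt.
- by exists (b, a); rewrite /= 1?finset.setUC // inE /= lt edge_sym.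
- by rewrite eqab edge_irr in Fab.
Qed.

Lemma hom_edge_pairs (V : finType) (G : sgraph V) (phi : {ffun 'I_m -> V}) :
  [forall x, forall y, edge F x y ==> edge G (phi x) (phi y)] =
  hom_along (edge G) edge_pairs phi.
Proof.
apply/forallP/allP => [H [a b]|H a].
  rewrite mem_enum inE /= => /andP[_ ab].
  by have /forallP/(_ b)/implyP := H a; apply.
apply/forallP => b; apply/implyP => ab; case: (ltngtP a b) => [lt|lt|/val_inj eqab].
- by apply: (H (a, b)); rewrite mem_enum inE /= lt.
- by rewrite edge_sym; apply: (H (b, a)); rewrite mem_enum inE /= lt edge_sym.
- by rewrite eqab edge_irr in ab.
Qed.

Lemma N_hom_sum (R : realType) (V : finType) (G : sgraph V) :
  (N_hom F G)%:R = \sum_(x : {ffun 'I_m -> V})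
    (injectiveb x)%:R * (hom_along (edge G) edge_pairs x)%:R :> R.
Proof.
rewrite /N_hom -sum1_card natr_sum big_mkcond; apply: eq_bigr => x _.
by rewrite inE hom_edge_pairs; case: (injectiveb x); case: (hom_along _ _ _);
  rewrite /= ?mulr1 ?mulr0.
Qed.

Lemma N_hom_in_sum (R : realType) (V : finType) (G : sgraph V) (Z : 'I_m -> {set V}) :
  (forall i j, i != j -> [disjoint Z i & Z j]) ->
  (N_hom_in F G Z)%:R = \sum_(x : {ffun 'I_m -> V})
    (hom_along (edge G) edge_pairs x)%:R * \prod_k (x k \in Z k)%:R :> R.
Proof.
move=> dZ; rewrite /N_hom_in -sum1_card natr_sum big_mkcond; apply: eq_bigr => x _.
rewrite !inE hom_edge_pairs.
have [/forallP xZ|] := boolP [forall i, x i \in Z i].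
  have -> : injectiveb x.
    apply/injectiveP => i j eqx; apply/eqP/negP => nij.
    have := disjointFr (dZ i j _) (xZ i); rewrite eqx xZ => /(_ _) h.
    by have := h; rewrite (introN idP nij) => /(_ isT).
  by rewrite big1 => [|k _]; rewrite ?xZ //= andbT mulr1; case: (hom_along _ _ _).
rewrite negb_forall => /existsP[k nk].
by rewrite (bigD1 k) //= (negbTE nk) mul0r mulr0 andbF.
Qed.

End EdgePairs.

Definition cut_close (R : realType) (V : finType) (E : rel V) (p eta : R) :=
  forall X Y : {set V}, `|wsum (erel R E) X Y - p * #|X|%:R * #|Y|%:R| <= eta * #|V|%:R ^+ 2.

Lemma hom_count_of_cut (R : realType) (V : finType) (E : rel V) (p eta : R) (m : nat)
    (L : seq ('I_m * 'I_m)) (Z : 'I_m -> {set V}) :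
  (0 < #|V|)%N -> 0 <= p <= 1 -> cut_close E p eta ->
  uniq L -> all (fun q : 'I_m * 'I_m => q.1 < q.2)%N L ->
  `|\sum_(x : {ffun 'I_m -> V}) (hom_along E L x)%:R * \prod_k (x k \in Z k)%:R
    - p ^+ size L * \prod_k #|Z k|%:R| <= (size L)%:R * (eta * #|V|%:R ^+ m).
Proof.
move=> V0 p01 cut uL lL.
have := @counting_lemma R V E m Z (fun=> #|V|%:R) eta (fun _ _ => p) L V0 uL lL.
have -> : \prod_(q <- L) p = p ^+ size L.
  by elim: (L) => [|q l IHl]; rewrite ?big_nil // big_cons IHl exprS.
rewrite prodr_const card_ord; apply=> //.
  by move=> k; rewrite ler_nat max_card.
by move=> i j S T _ _ _; rewrite -[leRHS]mulrA -expr2; apply: cut.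
Qed.

(** Union bound over the coincidences [x i = x j]: once [x] is fixed outside [i], a single value of
    [x i] produces one. The factor [|V|] on the left avoids the exponent [k - 1]. *)
Lemma noninjective_count (R : realType) (V : finType) (k : nat) :
  (\sum_(x : {ffun 'I_k -> V}) (~~ injectiveb x)%:R) * #|V|%:R <=
  k%:R ^+ 2 * #|V|%:R ^+ k :> R.
Proof.
pose c (i j : 'I_k) (x : {ffun 'I_k -> V}) : R := ((i != j) && (x i == x j))%:R.
apply: (@le_trans _ _ ((\sum_x \sum_i \sum_j c i j x) * #|V|%:R)).
  apply: ler_wpM2r => //; apply: ler_sum => x _.
  case: (boolP (injectiveb x)) => [_|/injectivePn[i [j nij eqx]]] /=.
    by apply: sumr_ge0 => i _; apply: sumr_ge0 => j _.
  rewrite (bigD1 i) //= (bigD1 j) //= /c nij eqx eqxx -addrA lerDl.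
  by rewrite addr_ge0 // sumr_ge0 // => l _; apply: sumr_ge0.
rewrite exchange_big /= mulr_suml.
apply: (@le_trans _ _ (\sum_(i < k) \sum_(j < k) #|V|%:R ^+ k)); last first.
  by rewrite !sumr_const !card_ord -mulrnA -[leLHS]mulr_natl natrM expr2.
apply: ler_sum => i _; rewrite exchange_big /= mulr_suml; apply: ler_sum => j _.
rewrite mulrC -(sum_upd (c i j) i).
apply: (@le_trans _ _ (\sum_(y : {ffun 'I_k -> V}) 1)); last first.
  by rewrite sumr_const card_ffun card_ord natrX.
apply: ler_sum => y _; rewrite (bigD1 (y j)) //= big1 ?addr0.
  by rewrite /c; case: (_ && _).
move=> a nay; rewrite /c; case: (altP (i =P j)) => //= nij.
by rewrite !ffunE eqxx [j == i]eq_sym (negbTE nij) (negbTE nay).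
Qed.

Lemma N_hom_hom_diff (R : realType) (V : finType) (G : sgraph V) (k : nat) (H : sgraph 'I_k) :
  `|\sum_(x : {ffun 'I_k -> V}) (hom_along (edge G) (edge_pairs H) x)%:R - (N_hom H G)%:R|
   * #|V|%:R <= k%:R ^+ 2 * #|V|%:R ^+ k :> R.
Proof.
apply: le_trans (noninjective_count R V k); apply: ler_wpM2r => //.
rewrite N_hom_sum -sumrB; apply: le_trans (ler_norm_sum _ _ _) _.
apply: ler_sum => x _; case: (injectiveb x); case: (hom_along _ _ _);
  by rewrite /= ?mulr1 ?mulr0 ?subrr ?subr0 ?normr0 ?normr1.
Qed.

Lemma sqr_sum_le (R : realType) (I : finType) (c : I -> R) :
  (\sum_i c i) ^+ 2 <= #|I|%:R * \sum_i c i ^+ 2.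
Proof.
have : 0 <= \sum_i \sum_j (c i - c j) ^+ 2.
  by apply: sumr_ge0 => i _; apply: sumr_ge0 => j _; apply: sqr_ge0.
have -> : \sum_i \sum_j (c i - c j) ^+ 2 =
    2 * (#|I|%:R * \sum_i c i ^+ 2) - 2 * (\sum_i c i) ^+ 2.
  pose s1 := \sum_i c i; pose s2 := \sum_i c i ^+ 2.
  have E i : \sum_j (c i - c j) ^+ 2 = #|I|%:R * c i ^+ 2 - 2 * c i * s1 + s2.
    rewrite /s1 /s2 mulr_sumr mulr_natl -sumr_const -sumrB -big_split /=.
    by apply: eq_bigr => j _; ring.
  under eq_bigr do rewrite E.
  rewrite big_split sumrB /= -mulr_sumr sumr_const -mulr_suml -mulr_sumr -/s1 -/s2.
  by rewrite -[s2 *+ _]mulr_natl; ring.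
by lra.
Qed.

Lemma sqr_sum_in_le (R : realType) (I : finType) (P : pred I) (c : I -> R) :
  (\sum_(i | P i) c i) ^+ 2 <= #|I|%:R * \sum_i c i ^+ 2.
Proof.
rewrite big_mkcond; apply: le_trans (sqr_sum_le _) _.
apply: ler_wpM2l => //; apply: ler_sum => i _; case: (P i) => //.
by rewrite expr0n /= sqr_ge0.
Qed.

(** Cauchy-Schwarz twice, over [x] and then over pairs [(y, y')]; each time the squares allow the
    sum to be extended from the given sets to all of [V]. *)
Lemma wsum_C4 (R : realType) (V : finType) (a : V -> V -> R) (S T : {set V}) :
  wsum a S T ^+ 4 <= #|V|%:R ^+ 4 *
    \sum_y \sum_y' \sum_x \sum_x' a x y * a x y' * (a x' y * a x' y').
Proof.
set n : R := #|V|%:R; have n0 : 0 <= n by rewrite ler0n.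
pose Q := \sum_x (\sum_(y in T) a x y) ^+ 2.
have le1 : wsum a S T ^+ 2 <= n * Q by apply: sqr_sum_in_le.
have QE : Q = \sum_(q : V * V | (q.1 \in T) && (q.2 \in T)) \sum_x a x q.1 * a x q.2.
  rewrite -(pair_big (mem T) (mem T) (fun y y' => \sum_x a x y * a x y')) /=.
  rewrite /Q.
  transitivity (\sum_x \sum_(y in T) \sum_(y' in T) a x y * a x y').
    by apply: eq_bigr => x _; rewrite expr2 big_distrlr.
  rewrite exchange_big /=; apply: eq_bigr => y _.
  by rewrite exchange_big.
have le2 : Q ^+ 2 <= n ^+ 2 * \sum_(q : V * V) (\sum_x a x q.1 * a x q.2) ^+ 2.
  rewrite QE; apply: le_trans (sqr_sum_in_le _ _) _.
  by rewrite card_prod natrM expr2.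
have Q0 : 0 <= Q by apply: sumr_ge0 => x _; apply: sqr_ge0.
have -> : wsum a S T ^+ 4 = (wsum a S T ^+ 2) ^+ 2 by rewrite -exprM.
apply: (@le_trans _ _ ((n * Q) ^+ 2)).
  by rewrite lerXn2r ?nnegrE ?sqr_ge0 ?mulr_ge0.
rewrite exprMn (_ : n ^+ 4 = n ^+ 2 * n ^+ 2); last by rewrite -exprD.
rewrite -mulrA ler_wpM2l ?sqr_ge0 //; apply: le_trans le2 _.
rewrite ler_wpM2l ?sqr_ge0 //.
rewrite -(pair_big xpredT xpredT (fun y y' => (\sum_x a x y * a x y') ^+ 2)) /=.
apply: ler_sum => y _; apply: ler_sum => y' _.
by rewrite expr2 big_distrlr.
Qed.

(** * The subgraphs of the 4-cycle and the cut condition *)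

Section FourCycle.
Implicit Type D : {set 'I_4}.

Definition cycle_edge D : rel 'I_4 :=
  fun i j => ((j == ordS i) && (i \in D)) || ((i == ordS j) && (j \in D)).

Lemma cycle_edge_sym D : symmetric (cycle_edge D).
Proof. by move=> i j; rewrite /cycle_edge orbC. Qed.

Lemma ordS4_neq (i : 'I_4) : (i == ordS i) = false.
Proof. by case: i => -[|[|[|[|]]]]. Qed.

Lemma cycle_edge_irr D : irreflexive (cycle_edge D).
Proof. by move=> i; rewrite /cycle_edge ordS4_neq. Qed.

(* The subgraph of the 4-cycle on [0, 1, 2, 3] with the edges [{k, k + 1}], [k \in D]. *)
Definition cycle_graph D := SGraph (cycle_edge_sym D) (cycle_edge_irr D).

Lemma num_edges_cycle D : num_edges (cycle_graph D) = #|D|.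
Proof.
rewrite /num_edges /edge_set.
have -> : [set [set x.1; x.2] | x in [pred x : 'I_4 * 'I_4 | edge (cycle_graph D) x.1 x.2]] =
    [set [set k; ordS k] | k in D].
  apply/finset.setP => s; apply/imsetP/imsetP => [[[i j]]|[k kD ->]].
    rewrite inE /= /cycle_edge => /orP[]/andP[/eqP -> iD] ->; first by exists i.
    by exists j; rewrite 1?finset.setUC.
  by exists (k, ordS k); rewrite // inE /= /cycle_edge eqxx kD.
rewrite card_in_imset // => k l _ _ /finset.setP eqs.
have := eqs (ordS k); have := eqs k; rewrite !inE !eqxx ?orbT /=.
move=> /esym/orP[/eqP //|/eqP ekl]; rewrite ekl => /esym.
by case: l {eqs ekl} => -[|[|[|[|]]]].
Qed.

Variables (R : realType) (V : finType) (G : sgraph V).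

Lemma sum_ffun4 (H : V -> V -> V -> V -> R) :
  \sum_(x : {ffun 'I_4 -> V})
     H (x (inord 0)) (x (inord 1)) (x (inord 2)) (x (inord 3)) =
  \sum_a \sum_b \sum_c \sum_d H a b c d.
Proof.
pose h (q : (V * V) * (V * V)) : {ffun 'I_4 -> V} :=
  [ffun k : 'I_4 => tnth [tuple q.1.1; q.1.2; q.2.1; q.2.2] k].
transitivity (\sum_(q : (V * V) * (V * V)) H q.1.1 q.1.2 q.2.1 q.2.2).
  rewrite (reindex h) /=; last first.
    exists (fun x : {ffun 'I_4 -> V} => ((x (inord 0), x (inord 1)), (x (inord 2), x (inord 3)))).
      by move=> [[a b] [c d]] _; rewrite !ffunE !(tnth_nth a) /= !inordK.
    move=> x _; apply/ffunP => k; rewrite ffunE (tnth_nth (x k)) /=.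
    by case: k => -[|[|[|[|//]]]] lt; rewrite /=; congr (x _); apply: val_inj; rewrite /= inordK.
  apply: eq_bigr => -[[a b] [c d]] _; by rewrite !ffunE !(tnth_nth a) /= !inordK.
rewrite -(pair_big xpredT xpredT (fun q q' : V * V => H q.1 q.2 q'.1 q'.2)) /=.
rewrite -(pair_big xpredT xpredT (fun a b => \sum_(q' : V * V) H a b q'.1 q'.2)) /=.
apply: eq_bigr => a _; apply: eq_bigr => b _.
by rewrite -(pair_big xpredT xpredT (fun c d => H a b c d)).
Qed.

Lemma prod_ord4 (f : 'I_4 -> R) :
  \prod_k f k = f (inord 0) * f (inord 1) * f (inord 2) * f (inord 3).
Proof.
rewrite !big_ord_recl big_ord0 mulr1 !mulrA.
by congr (_ * _ * _ * _); congr (f _); apply: val_inj; rewrite /= inordK.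
Qed.

Lemma hom_cycle D (x : {ffun 'I_4 -> V}) :
  (hom_along (edge G) (edge_pairs (cycle_graph D)) x)%:R =
  \prod_(k in D) (edge G (x k) (x (ordS k)))%:R :> R.
Proof.
rewrite -hom_edge_pairs;
  have [/forallP H|] := boolP [forall i, forall j, edge (cycle_graph D) i j ==> edge G (x i) (x j)].
  rewrite big1 // => k kD; have /forallP/(_ (ordS k))/implyP := H k.
  by rewrite /= /cycle_edge eqxx kD => ->.
rewrite negb_forall => /existsP[i]; rewrite negb_forall => /existsP[j].
rewrite negb_imply /= /cycle_edge => /andP[/orP[]/andP[/eqP -> kD] nG].
  by rewrite (bigD1 i) //= (negbTE nG) mul0r.
by rewrite (bigD1 j) //= edge_sym (negbTE nG) mul0r.
Qed.

(** The product of [[edge] - p] around the 4-cycle expands into the counts of its 16 spanning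
    subgraphs, weighted by powers of [- p]; replaced by their expected values, these cancel because
    [(p - p) ^ 4 = 0]. Each count carries an error [eps] from [HN] and another from noninjective
    maps, whence 32. The lower bound 16 is the [4 ^ 2] of [noninjective_count]. *)
Lemma cut_of_cycle_counts (p eps c : R) : (0 < #|V|)%N -> 0 <= p <= 1 ->
  0 <= c -> 32 * eps <= c ^+ 4 -> 16 <= eps * #|V|%:R ->
  (forall D, `|(N_hom (cycle_graph D) G)%:R - p ^+ #|D| * #|V|%:R ^+ 4| <=
     eps * #|V|%:R ^+ 4) ->
  cut_close (edge G) p c.
Proof.
move=> V0 /andP[p0 p1] c0 epsc Veps HN X Y; set n : R := #|V|%:R in Veps HN *.
have n0 : 0 < n by rewrite ltr0n.
pose a (x y : V) : R := erel R (edge G) x y - p.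
have sa x y : a x y = a y x by rewrite /a /erel edge_sym.
have C4 : \sum_y \sum_y' \sum_x \sum_x' a x y * a x y' * (a x' y * a x' y') =
    \sum_(x : {ffun 'I_4 -> V}) \prod_k a (x k) (x (ordS k)).
  rewrite -(@eq_bigr _ _ _ _ _ _ (fun x : {ffun 'I_4 -> V} => a (x (inord 0)) (x (inord 1)) *
      a (x (inord 1)) (x (inord 2)) * a (x (inord 2)) (x (inord 3)) * a (x (inord 3)) (x (inord 0)))).
    rewrite (sum_ffun4 (fun y x y' x' => a y x * a x y' * a y' x' * a x' y)).
    apply: eq_bigr => y _; rewrite exchange_big /=; apply: eq_bigr => x _.
    apply: eq_bigr => y' _; apply: eq_bigr => x' _.
    by rewrite (sa y x) (sa y' x'); ring.
  move=> x _; rewrite prod_ord4; congr (_ * _ * _ * _); congr (a _ (x _));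
    by apply: val_inj; rewrite /= !inordK.
have C4le : `|\sum_(x : {ffun 'I_4 -> V}) \prod_k a (x k) (x (ordS k))| <= 32 * eps * n ^+ 4.
  pose S D : R := \sum_x (hom_along (edge G) (edge_pairs (cycle_graph D)) x)%:R.
  have SD D : `|S D - p ^+ #|D| * n ^+ 4| <= 2 * eps * n ^+ 4.
    have h1 := N_hom_hom_diff R G (cycle_graph D).
    have {}h1 : `|S D - (N_hom (cycle_graph D) G)%:R| <= eps * n ^+ 4.
      rewrite -(ler_pM2r n0); apply: le_trans h1 _; rewrite [leRHS]mulrAC -/n.
      apply: ler_wpM2r; first by rewrite exprn_ge0 // ltW.
      by apply: le_trans Veps; rewrite -natrX.
    have := ler_normD (S D - (N_hom (cycle_graph D) G)%:R)
      ((N_hom (cycle_graph D) G)%:R - p ^+ #|D| * n ^+ 4).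
    rewrite addrA subrK => /le_trans; apply; have := HN D; lra.
  have -> : \sum_(x : {ffun 'I_4 -> V}) \prod_k a (x k) (x (ordS k)) =
      \sum_D (- p) ^+ #|~: D| * S D.
    under eq_bigr do rewrite /a bigA_distr.
    rewrite exchange_big /=; apply: eq_bigr => D _; rewrite mulr_sumr.
    apply: eq_bigr => x _; rewrite hom_cycle (bigID (mem D)) /= mulrC; congr (_ * _).
      rewrite (eq_bigr (fun=> - p)) => [|k /negbTE -> //]; rewrite prodr_const.
      by congr (_ ^+ _); apply: eq_card => k; rewrite !inE.
    by apply: eq_bigr => k kD; rewrite kD.
  have zero : \sum_(D : {set 'I_4}) (- p) ^+ #|~: D| * (p ^+ #|D| * n ^+ 4) = 0.
    transitivity ((\prod_(k < 4) (p + - p)) * n ^+ 4).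
      have -> : \prod_(k < 4) (p + - p) =
          \sum_(D : {set 'I_4}) \prod_(k < 4) (if k \in D then p else - p).
        exact: bigA_distr.
      rewrite mulr_suml; apply: eq_bigr => D _; rewrite mulrA; congr (_ * _).
      rewrite (bigID (mem D)) /= [LHS]mulrC; congr (_ * _).
        by rewrite (eq_bigr (fun=> p)) ?prodr_const // => k ->.
      rewrite (eq_bigr (fun=> - p)) => [|k /negbTE -> //]; rewrite prodr_const.
      by congr (_ ^+ _); apply: eq_card => k; rewrite !inE.
    by rewrite subrr prodr_const card_ord expr0n mul0r.
  have -> : \sum_D (- p) ^+ #|~: D| * S D =
      \sum_D (- p) ^+ #|~: D| * (S D - p ^+ #|D| * n ^+ 4).
    by under [RHS]eq_bigr do rewrite mulrBr; rewrite sumrB zero subr0.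
  apply: le_trans (ler_norm_sum _ _ _) _.
  apply: (@le_trans _ _ (\sum_(D : {set 'I_4}) 2 * eps * n ^+ 4)); last first.
    rewrite sumr_const -[_ *+ _]mulr_natl -cardsT -powersetT card_powerset cardsT card_ord.
    by rewrite natrX; lra.
  apply: ler_sum => D _; rewrite normrM; apply: le_trans (SD D).
  by rewrite ler_piMl // normrX normrN exprn_ile1 // ger0_norm.
have := wsum_C4 a X Y; rewrite C4 -/n => le4.
rewrite -wsumBr -/a.
have cn0 : 0 <= c * n ^+ 2 by rewrite mulr_ge0 // exprn_ge0 // ltW.
rewrite -(@ler_pXn2r _ 4) ?nnegrE ?normr_ge0 // -normrX ger0_norm ?exprn_even_ge0 //.
apply: le_trans le4 _; apply: (@le_trans _ _ (n ^+ 4 * (32 * eps * n ^+ 4))).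
  rewrite ler_wpM2l ?exprn_ge0 ?(ltW n0) //; apply: le_trans C4le; exact: ler_norm.
rewrite exprMn -exprM mulrCA -exprD ler_wpM2r ?exprn_ge0 ?(ltW n0) //.
Qed.

End FourCycle.

(** * Colourings with prescribed class sizes *)

Section IncreasingInjections.
Variables (m r : nat).

Lemma increasing_lt (i : {ffun 'I_m -> 'I_r}) : increasing i ->
  forall a b : 'I_m, (i a < i b)%N = (a < b)%N.
Proof.
move=> /forallP inc a b; have inc' (c d : 'I_m) : (c < d)%N -> (i c < i d)%N.
  by have /forallP/(_ d)/implyP := inc c.
case: (ltngtP a b) => [/inc' //|/inc' lt|/val_inj ->]; last by rewrite ltnn.
by rewrite ltnNge ltnW.
Qed.

Lemma increasing_inj (i : {ffun 'I_m -> 'I_r}) : increasing i -> injective i.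
Proof.
move=> inc a b eqi; apply/val_inj; case: (ltngtP a b) => //; rewrite -(increasing_lt inc) eqi;
  by rewrite ltnn.
Qed.

Lemma card_perm_lt (s : 'S_m) (j : 'I_m) : #|[set k | (s k < s j)%N]| = s j.
Proof.
rewrite -(card_imset _ (@perm_inj _ s)).
have -> : s @: [set k | (s k < s j)%N] = [set b : 'I_m | (b < s j)%N].
  apply/finset.setP => b; apply/imsetP/idP => [[k]|]; rewrite inE => lt.
    by move=> ->; rewrite inE.
  by exists (s^-1%g b); rewrite ?inE permKV.
rewrite cardsE -sum1_card -(big_ord_widen _ (fun=> 1%N)) ?sum_nat_const ?card_ord ?muln1 //.
exact: ltnW.
Qed.

Lemma injection_sorting (g : {ffun 'I_m -> 'I_r}) : injective g ->
  exists (i : {ffun 'I_m -> 'I_r}) (s : 'S_m),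
    increasing i /\ g = [ffun j => i (s j)].
Proof.
move=> ginj; pose below j := [set k | (g k < g j)%N].
have lt_below j k : (g j < g k)%N -> (#|below j| < #|below k|)%N.
  move=> lt; apply: proper_card; apply/properP; split.
    by apply/fintype.subsetP => l; rewrite !inE => /ltn_trans; apply.
  by exists j; rewrite inE ?ltnn.
have below_lt j : (#|below j| < m)%N.
  rewrite -[X in (_ < X)%N](card_ord m) -cardsT; apply: proper_card.
  apply/properP; split; first exact: finset.subsetT.
  by exists j; rewrite ?inE ?ltnn.
pose rk j := Ordinal (below_lt j).
have rk_inj : injective rk.
  move=> j k /(congr1 val) /= eqc; apply: ginj; apply: val_inj.
  by case: (ltngtP (g j) (g k)) => // /lt_below; rewrite eqc ltnn.
pose s := perm rk_inj; exists [ffun a => g (s^-1%g a)], s; split; last first.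
  by apply/ffunP => j; rewrite !ffunE permK.
apply/forallP => a; apply/forallP => b; apply/implyP => ltab; rewrite !ffunE.
rewrite ltnNge; apply/negP; rewrite leq_eqVlt => /orP[/eqP/val_inj/ginj/perm_inj eqab|].
  by rewrite eqab ltnn in ltab.
move/lt_below; have rkE c : #|below (s^-1%g c)| = c.
  by rewrite -[#|_|]/(val (rk _)) -(permE rk_inj) -/s permKV.
by rewrite !rkE ltnNge ltnW.
Qed.

(** An injection is an increasing map composed with a unique permutation, which ranks its values.
    The averages over permutations in the property thereby become a sum over all injections,
    symmetric in the positions. *)
Lemma sum_injections (R : realType) (A : {ffun 'I_m -> 'I_r} -> R) :
  \sum_(g : {ffun 'I_m -> 'I_r} | injectiveb g) A g =
  \sum_(i : {ffun 'I_m -> 'I_r} | increasing i) \sum_(s : 'S_m) A [ffun j => i (s j)].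
Proof.
pose h (q : {ffun 'I_m -> 'I_r} * 'S_m) : {ffun 'I_m -> 'I_r} := [ffun j => q.1 (q.2 j)].
pose D := [set q : {ffun 'I_m -> 'I_r} * 'S_m | increasing q.1].
rewrite (pair_big_dep _ _ (fun (i : {ffun 'I_m -> 'I_r}) (s : 'S_m) => A [ffun j => i (s j)])) /=.
transitivity (\sum_(g in h @: D) A g).
  apply: eq_bigl => g; apply/injectiveP/imsetP => [/injection_sorting[i [s [inc ->]]]|].
    by exists (i, s); rewrite ?inE.
  case=> -[i s]; rewrite inE /= => /increasing_inj inc -> j k.
  by rewrite !ffunE => /inc/perm_inj.
rewrite big_imset /=; first by apply: eq_bigl => q; rewrite inE andbT.
move=> [i s] [i' s']; rewrite !inE /= => inc inc' /ffunP eqh.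
have eqh' j : i (s j) = i' (s' j) by have := eqh j; rewrite !ffunE.
have eqs : s = s'.
  apply/permP => j; apply: val_inj => /=; rewrite -card_perm_lt -[RHS]card_perm_lt.
  apply: eq_card => k; rewrite !inE.
  by rewrite -(increasing_lt inc) -(increasing_lt inc') !eqh'.
rewrite eqs in eqh' *; congr pair; apply/ffunP => a.
by have := eqh' (s'^-1%g a); rewrite permKV.
Qed.

End IncreasingInjections.

Section Colourings.
Variables (R : realType) (V : finType) (m r : nat).
Implicit Types (phi : {ffun V -> option 'I_r}) (f : {ffun 'I_m -> V} -> R).

(** The colour [None] is for vertices outside all classes, as the prescribed sizes need not exhaust
    [V]. *)
Definition colour_class phi i := [set v | phi v == Some i].

(** At most one [i] contributes, so this is the indicator that [x] receives [m] distinct colours,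
    none of them [None]. *)
Definition rainbow phi (x : {ffun 'I_m -> V}) : R :=
  \sum_(i : {ffun 'I_m -> 'I_r} | injectiveb i) \prod_j (phi (x j) == Some (i j))%:R.

Definition rainbow_sum f phi : R := \sum_x f x * rainbow phi x.

Lemma rainbow_sumE f phi : rainbow_sum f phi =
  \sum_(i : {ffun 'I_m -> 'I_r} | injectiveb i) mform f (fun j => colour_class phi (i j)).
Proof.
rewrite /rainbow_sum /rainbow /mform exchange_big /=; apply: eq_bigr => x _.
rewrite mulr_sumr; apply: eq_bigr => i _; congr (_ * _).
by apply: eq_bigr => j _; rewrite inE.
Qed.

Lemma rainbow_ge0 phi x : 0 <= rainbow phi x.
Proof. by apply: sumr_ge0 => i _; apply: prodr_ge0. Qed.

Lemma rainbow_le1 phi x : rainbow phi x <= 1.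
Proof.
apply: (@le_trans _ _ (\sum_(i : {ffun 'I_m -> 'I_r}) \prod_j (phi (x j) == Some (i j))%:R)).
  rewrite /rainbow big_mkcond; apply: ler_sum => i _; case: ifP => // _.
  exact: prodr_ge0.
rewrite -(bigA_distr_bigA (fun j c => (phi (x j) == Some c)%:R)) /=.
apply: prodr_ile1 => j _; rewrite sumr_ge0 //=.
case: (phi (x j)) => [c|]; last by rewrite big1 ?ler01.
by rewrite (bigD1 c) //= eqxx big1 ?addr0 // => d nd; rewrite (inj_eq Some_inj) eq_sym (negbTE nd).
Qed.

Lemma rainbow_sum_lipschitz f phi phi' : (forall x, `|f x| <= 1) ->
  `|rainbow_sum f phi - rainbow_sum f phi'| * #|V|%:R <=
  m%:R * #|[set v | phi v != phi' v]|%:R * #|V|%:R ^+ m.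
Proof.
move=> f1; set D := [set v | _].
apply: (@le_trans _ _ ((\sum_(x : {ffun 'I_m -> V}) \sum_j (x j \in D)%:R) * #|V|%:R)).
  apply: ler_wpM2r => //; rewrite /rainbow_sum -sumrB.
  apply: le_trans (ler_norm_sum _ _ _) _; apply: ler_sum => x _.
  rewrite -mulrBr normrM.
  apply: (@le_trans _ _ `|rainbow phi x - rainbow phi' x|); first by rewrite ler_piMl.
  have [/existsP[j jD]|] := boolP [exists j, x j \in D].
    apply: (@le_trans _ _ 1).
      have := rainbow_ge0 phi x; have := rainbow_ge0 phi' x.
      have := rainbow_le1 phi x; have := rainbow_le1 phi' x.
      by rewrite ler_norml; lra.
    by rewrite (bigD1 j) //= jD lerDl sumr_ge0.
  rewrite negb_exists => /forallP nD.
  have -> : rainbow phi x = rainbow phi' x.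
    apply: eq_bigr => i _; apply: eq_bigr => j _.
    by have := nD j; rewrite inE negbK => /eqP ->.
  by rewrite subrr normr0 sumr_ge0.
rewrite exchange_big /= mulr_suml.
apply: (@le_trans _ _ (\sum_(j < m) #|D|%:R * #|V|%:R ^+ m)); last first.
  by rewrite sumr_const card_ord -[leLHS]mulr_natl mulrA.
apply: ler_sum => j _; rewrite mulrC -(sum_upd (fun x => (x j \in D)%:R) j).
rewrite (eq_bigr (fun=> #|D|%:R)) => [|y _].
  by rewrite sumr_const card_ffun card_ord -[leLHS]mulr_natr natrX.
rewrite -sum1_card natr_sum [RHS]big_mkcond /=; apply: eq_bigr => a _.
by rewrite ffunE eqxx; case: (a \in D).
Qed.

Definition recolour phi (v : V) (oc : option 'I_r) : {ffun V -> option 'I_r} :=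
  [ffun w => if w == v then oc else phi w].

(** Induction on the total discrepancy, written with truncated subtractions. If a class is too
    large, one of its vertices loses its colour; otherwise some class is too small, and the bound on
    the sum of the [a i] provides an uncoloured vertex for it. Each move lowers the discrepancy by
    one. *)
Lemma fix_colouring (a : 'I_r -> nat) phi : (\sum_i a i <= #|V|)%N ->
  exists phi', (forall i, #|colour_class phi' i| = a i) /\
    (#|[set v | phi v != phi' v]| <=
     \sum_i ((#|colour_class phi i| - a i) + (a i - #|colour_class phi i|)))%N.
Proof.
move=> aV; move: {2}(\sum_i _)%N (erefl (\sum_i ((#|colour_class phi i| - a i) +
  (a i - #|colour_class phi i|)))%N) => k.
elim: k phi => [|k IHk] phi eqk.
  exists phi; split; last by rewrite (_ : [set v | _] = finset.set0) ?cards0 //; apply/finset.setP => v; rewrite !inE eqxx.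
  move=> i; have := eqk => /eqP; rewrite sum_nat_eq0 => /forallP/(_ i)/= .
  by rewrite addn_eq0 !subn_eq0 => le; apply/eqP; rewrite eqn_leq.
suff [v [oc Hk]] : exists v oc, (\sum_i ((#|colour_class (recolour phi v oc) i| - a i) +
    (a i - #|colour_class (recolour phi v oc) i|)) = k)%N.
  have [phi' [H1 H2]] := IHk _ Hk; exists phi'; split=> //; rewrite eqk.
  rewrite Hk in H2; apply: leq_trans (_ : _ <= #|v |: [set w | recolour phi v oc w != phi' w]|)%N _.
    apply: subset_leq_card; apply/fintype.subsetP => w; rewrite !inE ffunE.
    by case: (w == v).
  by rewrite cardsU1 -[k.+1]add1n; apply: leq_add => //; case: (_ \notin _).
have [/existsP[i lti]|] := boolP [exists i, (a i < #|colour_class phi i|)%N].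
  have /card_gt0P[v] : (0 < #|colour_class phi i|)%N by apply: leq_ltn_trans lti.
  rewrite inE => /eqP phiv; exists v, None.
  have ci : #|colour_class phi i| = (#|colour_class (recolour phi v None) i|).+1.
    rewrite (cardsD1 v) inE phiv eqxx add1n; congr _.+1; apply: eq_card => w.
    by rewrite !inE ffunE; case: eqP.
  have cj j : j != i -> #|colour_class phi j| = #|colour_class (recolour phi v None) j|.
    move=> nji; apply: eq_card => w; rewrite !inE ffunE; case: (altP (w =P v)) => [->|//].
    by rewrite phiv (inj_eq Some_inj) eq_sym (negbTE nji).
  move: eqk; rewrite (bigD1 i) //= [in X in _ -> X](bigD1 i) //= ci.
  rewrite ci ltnS in lti.
  rewrite (eq_bigr (fun j => #|colour_class (recolour phi v None) j| - a j +
    (a j - #|colour_class (recolour phi v None) j|))%N); last by move=> j nji; rewrite cj.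
  by move: (\sum_(j | _) _)%N => S; lia.
rewrite negb_exists => /forallP H.
have le i : (#|colour_class phi i| <= a i)%N by rewrite leqNgt.
have [i lti] : exists i, (#|colour_class phi i| < a i)%N.
  apply/existsP; apply: contraPT eqk; rewrite negb_exists => /forallP H'.
  rewrite big1 // => i _; apply/eqP; rewrite addn_eq0 !subn_eq0 le.
  by rewrite leqNgt H'.
have [v phiv] : exists v, phi v = None.
  have : (#|\bigcup_i colour_class phi i| < #|V|)%N.
    apply: leq_trans aV; apply: (@leq_ltn_trans (\sum_i #|colour_class phi i|)%N).
      elim/big_rec2: _ => [|j n A _ leA]; first by rewrite cards0.
      by apply: leq_trans (leq_card_setU _ _) _; rewrite leq_add2l.
    rewrite (bigD1 i) //= [ltnRHS](bigD1 i) //= -addSn; apply: leq_add => //.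
    exact: leq_sum.
  rewrite -cardsT => ltc.
  have /subsetPn[v _ nv] : ~~ ([set: V] \subset \bigcup_i colour_class phi i).
    by apply/negP => /subset_leq_card; rewrite leqNgt ltc.
  exists v; case E : (phi v) => [c|//]; case/negP: nv; apply/finset.bigcupP; exists c => //.
  by rewrite inE E.
exists v, (Some i).
have ci : #|colour_class (recolour phi v (Some i)) i| = (#|colour_class phi i|).+1.
  rewrite (cardsD1 v) inE ffunE eqxx eqxx add1n; congr _.+1; apply: eq_card => w.
  by rewrite !inE ffunE; case: (altP (w =P v)) => //= ->; rewrite phiv.
have cj j : j != i -> #|colour_class phi j| = #|colour_class (recolour phi v (Some i)) j|.
  move=> nji; apply: eq_card => w; rewrite !inE ffunE; case: (altP (w =P v)) => [->|//].
  by rewrite phiv [RHS](inj_eq Some_inj) [i == j]eq_sym (negbTE nji).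
move: eqk; rewrite (bigD1 i) //= [in X in _ -> X](bigD1 i) //= ci.
rewrite (eq_bigr (fun j => #|colour_class (recolour phi v (Some i)) j| - a j +
  (a j - #|colour_class (recolour phi v (Some i)) j|))%N); last by move=> j nji; rewrite cj.
by move: (\sum_(j | _) _)%N => S; lia.
Qed.

End Colourings.

(** * Random colourings with independent vertices *)

Section RandomColouring.
Variables (R : realType) (V : finType) (C : finType) (w : V -> C -> R).
Hypotheses (w_ge0 : forall v c, 0 <= w v c) (w_sum : forall v, \sum_c w v c = 1).
Implicit Type phi : {ffun V -> C}.

Definition colouring_weight phi : R := \prod_v w v (phi v).

Lemma colouring_weight_ge0 phi : 0 <= colouring_weight phi.
Proof. by apply: prodr_ge0 => v _; apply: w_ge0. Qed.

Lemma expect_prod (h : V -> C -> R) :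
  \sum_phi colouring_weight phi * \prod_v h v (phi v) =
  \prod_v \sum_c w v c * h v c.
Proof.
rewrite bigA_distr_bigA; apply: eq_bigr => phi _.
by rewrite big_split.
Qed.

Lemma expect_one : \sum_phi colouring_weight phi = 1.
Proof.
by rewrite /colouring_weight -(bigA_distr_bigA w) /= big1.
Qed.

Lemma expect_tuple (m : nat) (x : {ffun 'I_m -> V}) (c : 'I_m -> C) : injective x ->
  \sum_phi colouring_weight phi * \prod_j (phi (x j) == c j)%:R = \prod_j w (x j) (c j).
Proof.
move=> xinj; pose h v o : R := \prod_(j | x j == v) (o == c j)%:R.
transitivity (\sum_phi colouring_weight phi * \prod_v h v (phi v)).
  apply: eq_bigr => phi _; congr (_ * _); rewrite (partition_big x xpredT) //=.
  by apply: eq_bigr => v _; apply: eq_bigr => j /eqP ->.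
rewrite expect_prod [RHS](partition_big x xpredT) //=; apply: eq_bigr => v _.
have [/existsP[j /eqP xj]|] := boolP [exists j, x j == v].
  have pj : (fun k => x k == v) =1 pred1 j.
    by move=> k /=; rewrite -xj (inj_eq xinj).
  rewrite (big_pred1 _ pj) xj (bigD1 (c j)) //= /h (big_pred1 _ pj) eqxx mulr1.
  by rewrite big1 ?addr0 // => d nd; rewrite (big_pred1 _ pj) (negbTE nd) mulr0.
rewrite negb_exists => /forallP nx.
rewrite [RHS]big_pred0 => [|k]; last exact: negbTE (nx k).
rewrite -(w_sum v); apply: eq_bigr => o' _; rewrite /h big_pred0 ?mulr1 // => k.
exact: negbTE (nx k).
Qed.

(** Independence makes the covariances of distinct vertices vanish, and each variance is at most
    1. *)
Lemma expect_variance (c : C) :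
  \sum_phi colouring_weight phi *
    (\sum_v ((phi v == c)%:R - w v c)) ^+ 2 <= #|V|%:R.
Proof.
pose Y phi v : R := (phi v == c)%:R - w v c.
have w_le1 v d : w v d <= 1.
  by rewrite -(w_sum v) (bigD1 d) //= lerDl sumr_ge0.
have -> : \sum_phi colouring_weight phi * (\sum_v ((phi v == c)%:R - w v c)) ^+ 2 =
    \sum_v \sum_v' \sum_phi colouring_weight phi * (Y phi v * Y phi v').
  under [RHS]eq_bigr do rewrite exchange_big.
  rewrite [RHS]exchange_big /=; apply: eq_bigr => phi _.
  rewrite expr2 big_distrlr mulr_sumr; apply: eq_bigr => v _.
  by rewrite mulr_sumr.
apply: (@le_trans _ _ (\sum_(v : V) 1)); last by rewrite sumr_const.
apply: ler_sum => v _; rewrite (bigD1 v) //= [X in _ + X]big1 ?addr0 => [|v' nvv'].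
  rewrite -expect_one; apply: ler_sum => phi _; rewrite ler_piMr ?colouring_weight_ge0 //.
  have := w_le1 v c; have := w_ge0 v c; rewrite /Y.
  by case: (phi v == c) => /= ? ?; nra.
pose h u d : R := (if u == v then (d == c)%:R - w v c else 1) *
  (if u == v' then (d == c)%:R - w v' c else 1).
transitivity (\sum_phi colouring_weight phi * \prod_u h u (phi u)).
  apply: eq_bigr => phi _; congr (_ * _); rewrite big_split /=; congr (_ * _).
    by rewrite -big_mkcond /= big_pred1_eq.
  by rewrite -big_mkcond /= big_pred1_eq.
rewrite expect_prod (bigD1 v) //= (_ : \sum_d _ = 0) ?mul0r //.
rewrite /h eqxx eq_sym (negbTE nvv'); under eq_bigr do rewrite mulr1 mulrBr.
rewrite sumrB -mulr_suml w_sum mul1r (bigD1 c) //= eqxx mulr1 big1 ?addr0 ?subrr //.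
by move=> d /negbTE ->; rewrite mulr0.
Qed.

End RandomColouring.

(** Colour each vertex [v] independently, with probability [u i v] for [i]. On injective tuples, the
    only ones where [f] may be nonzero, the expected rainbow indicator is the sum of products of the
    [u]. A random colouring has nearly the prescribed class sizes, and [fix_colouring] repairs it at
    a cost bounded by [rainbow_sum_lipschitz]. *)
Lemma fractional_bound (R : realType) (V : finType) (m r : nat)
    (f : {ffun 'I_m -> V} -> R) (eps delta : R) (a : 'I_r -> nat) (u : 'I_r -> V -> R) :
  (0 < #|V|)%N -> (forall x, `|f x| <= 1) -> (forall x : {ffun 'I_m -> V}, ~~ injectiveb x -> f x = 0) ->
  (forall phi : {ffun V -> option 'I_r}, (forall i, #|colour_class phi i| = a i) ->
     `|rainbow_sum f phi| <= eps * #|V|%:R ^+ m) ->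
  (\sum_i a i <= #|V|)%N -> (forall i, `|\sum_v u i v - (a i)%:R| <= 1) ->
  (forall i v, 0 <= u i v) -> (forall v, \sum_i u i v <= 1) ->
  0 < delta -> 1 + delta^-1 <= delta * #|V|%:R ->
  `|\sum_x f x * \sum_(i : {ffun 'I_m -> 'I_r} | injectiveb i) \prod_j u (i j) (x j)|
   <= (eps + 2 * m%:R * r%:R * delta) * #|V|%:R ^+ m.
Proof.
move=> V0 f1 f_inj Hphi aV ua u0 u1 delta0 len; set n : R := #|V|%:R in len Hphi *.
have n0 : 0 < n by rewrite ltr0n.
pose w v (c : option 'I_r) : R := if c is Some i then u i v else 1 - \sum_i u i v.
have w0 v c : 0 <= w v c by case: c => [i|] /=; rewrite ?u0 ?subr_ge0.
have w1 v : \sum_c w v c = 1.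
  rewrite (bigD1 None) //= (reindex_omap Some id) => [|[c|]] //=.
  rewrite [X in _ + X](eq_bigl xpredT) => [|i]; last by rewrite eqxx.
  by rewrite subrK.
pose P := colouring_weight w.
have P0 phi : 0 <= P phi by apply: colouring_weight_ge0.
have P1 : \sum_phi P phi = 1 by apply: expect_one.
have -> : \sum_x f x * \sum_(i : {ffun 'I_m -> 'I_r} | injectiveb i) \prod_j u (i j) (x j) =
    \sum_phi P phi * rainbow_sum f phi.
  rewrite /rainbow_sum; under [RHS]eq_bigr do rewrite mulr_sumr.
  rewrite [RHS]exchange_big /=; apply: eq_bigr => x _.
  have [/injectiveP xinj|nx] := boolP (injectiveb x); last first.
    by rewrite f_inj // mul0r big1 // => phi _; rewrite mul0r mulr0.
  under [RHS]eq_bigr do rewrite mulrCA; rewrite -mulr_sumr; congr (_ * _).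
  rewrite /rainbow; under [RHS]eq_bigr do rewrite mulr_sumr.
  rewrite [RHS]exchange_big /=; apply: eq_bigr => i _.
  by rewrite (expect_tuple w1 (fun j => Some (i j)) xinj).
pose dev (phi : {ffun V -> option 'I_r}) i : R :=
  \sum_v ((phi v == Some i)%:R - w v (Some i)).
have devE phi i : dev phi i = #|colour_class phi i|%:R - \sum_v u i v.
  rewrite /dev sumrB; congr (_ - _); rewrite -sum1_card natr_sum [RHS]big_mkcond /=.
  by apply: eq_bigr => v _; rewrite inE; case: (_ == _).
have dn0 : 0 < delta * n by rewrite mulr_gt0.
(* A bound on the number of recoloured vertices whose mean follows from the variance:
   [|z| <= delta n + z ^ 2 / (delta n)]. The summand 1 accounts for the rounding of the class
   sizes. *)
pose err phi : R := \sum_i (1 + delta * n + dev phi i ^+ 2 / (delta * n)).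
have bound phi : `|rainbow_sum f phi| <= eps * n ^+ m + m%:R * (n ^+ m / n) * err phi.
  have [phi' [H1 H2]] := fix_colouring phi aV.
  have lip := rainbow_sum_lipschitz phi phi' f1; rewrite -/n in lip.
  have derr : #|[set v | phi v != phi' v]|%:R <= err phi.
    apply: (@le_trans _ _ (\sum_i `|#|colour_class phi i|%:R - (a i)%:R|)).
      move: H2; rewrite -(ler_nat R) natr_sum => /le_trans; apply; apply: ler_sum => i _.
      rewrite natrD; case: (leqP #|colour_class phi i| (a i)) => le.
        rewrite (eqP le : (_ - _)%N = 0%N) add0r natrB // distrC ger0_norm ?lexx // subr_ge0 ler_nat //.
      rewrite natrB ?(ltnW le) // (_ : (a i - _)%N = 0%N) ?addr0; last by apply/eqP; rewrite subn_eq0 ltnW.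
      by rewrite ger0_norm // subr_ge0 ler_nat ltnW.
    apply: ler_sum => i _; have := ua i; have := devE phi i.
    set A := _%:R; set B := \sum_v _; set D := (a i)%:R => -> AB.
    have : `|A - D| <= `|A - B| + `|B - D| by rewrite -[A - D](subrKA B) ler_normD.
    have : `|A - B| <= delta * n + (A - B) ^+ 2 / (delta * n).
      rewrite -(real_normK (num_real (A - B))); set z := `|A - B|.
      have z0 : 0 <= z by rewrite /z.
      have [zl|zl] := leP z (delta * n).
        by apply: le_trans zl _; rewrite lerDl divr_ge0 ?exprn_ge0 // ltW.
      apply: (@le_trans _ _ (z ^+ 2 / (delta * n))); last by rewrite lerDr ltW.
      by rewrite ler_pdivlMr // expr2 ler_wpM2l // ltW.
    by lra.
  have h1 : `|rainbow_sum f phi - rainbow_sum f phi'| <= m%:R * (n ^+ m / n) * err phi.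
    rewrite -(ler_pM2r n0); apply: le_trans lip _.
    have -> : m%:R * (n ^+ m / n) * err phi * n = m%:R * err phi * n ^+ m.
      by field; rewrite gt_eqF.
    by rewrite ler_wpM2r ?exprn_ge0 ?(ltW n0) // ler_wpM2l.
  rewrite -(subrK (rainbow_sum f phi') (rainbow_sum f phi)) addrC.
  by apply: le_trans (ler_normD _ _) _; apply: lerD => //; apply: Hphi.
apply: le_trans (ler_norm_sum _ _ _) _.
apply: (@le_trans _ _ (\sum_phi P phi * (eps * n ^+ m + m%:R * (n ^+ m / n) * err phi))).
  by apply: ler_sum => phi _; rewrite normrM ger0_norm // ler_wpM2l.
have errE : \sum_phi P phi * err phi <= r%:R * (2 * delta * n).
  rewrite /err; under eq_bigr do rewrite mulr_sumr.
  rewrite exchange_big /= -[X in X%:R * _]card_ord mulr_natl -sumr_const; apply: ler_sum => i _.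
  under eq_bigr do rewrite mulrDr mulrA.
  rewrite big_split /= -!mulr_suml P1 mul1r.
  have := expect_variance w0 w1 (Some i); rewrite -/P -/n => var.
  have : (\sum_phi P phi * dev phi i ^+ 2) / (delta * n) <= delta^-1.
    by rewrite ler_pdivrMr // mulrA mulVf ?mul1r // gt_eqF.
  by lra.
under eq_bigr do rewrite mulrDr.
rewrite big_split /= -mulr_suml P1 mul1r mulrDl lerD2l.
under eq_bigr do rewrite mulrCA.
rewrite -mulr_sumr.
apply: (@le_trans _ _ (m%:R * (n ^+ m / n) * (r%:R * (2 * delta * n)))).
  by rewrite ler_wpM2l // mulr_ge0 // divr_ge0 ?exprn_ge0 // ltW.
by rewrite le_eqVlt; apply/orP; left; apply/eqP; field; rewrite gt_eqF.
Qed.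

(** * Coefficients of fractional colourings *)

(* [P t - 2 ^+ k.+1 * P (t / 2)] has lower degree than [P]. *)
Lemma coefficient_bound (R : realType) (k : nat) : exists2 C : R, 0 < C &
  forall (c : nat -> R) (B : R),
  (forall t, 0 <= t <= 1 -> `|\sum_(l < k.+1) c l * t ^+ l| <= B) ->
  forall l, (l <= k)%N -> `|c l| <= C * B.
Proof.
elim: k => [|k [C C0 IHk]].
  exists 1 => // c B H l; rewrite leqn0 => /eqP ->; rewrite mul1r.
  by have := H 0; rewrite lexx ler01 big_ord1 expr0 mulr1; apply.
pose D : R := C * (1 + 2 ^+ k.+1).
have D0 : 0 < D by rewrite mulr_gt0 // ltr_wpDr ?exprn_ge0.
exists (1 + k.+2%:R * D); first by rewrite ltr_wpDr // mulr_ge0 // ltW.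
move=> c B H.
have B0 : 0 <= B by apply: le_trans (H 0 _); rewrite ?normr_ge0 // lexx ler01.
pose c' l := c l * (1 - 2 ^+ (k.+1 - l)).
have low l : (l <= k)%N -> `|c l| <= D * B.
  move=> lk; have : `|c' l| <= C * ((1 + 2 ^+ k.+1) * B).
    apply: IHk lk => t /andP[t0 t1].
    have -> : \sum_(i < k.+1) c' i * t ^+ i =
        \sum_(i < k.+2) c i * t ^+ i - 2 ^+ k.+1 * \sum_(i < k.+2) c i * (t / 2) ^+ i.
      rewrite mulr_sumr -sumrB [RHS]big_ord_recr /=.
      have -> : c k.+1 * t ^+ k.+1 - 2 ^+ k.+1 * (c k.+1 * (t / 2) ^+ k.+1) = 0.
        by rewrite expr_div_n mulrCA [2 ^+ _ * _]mulrC divfK ?subrr // expf_neq0.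
      rewrite addr0; apply: eq_bigr => i _.
      have -> : 2 ^+ k.+1 = 2 ^+ (k.+1 - i) * 2 ^+ i :> R by rewrite -exprD subnK // ltnW.
      by rewrite /c' expr_div_n; field; rewrite expf_neq0.
    apply: le_trans (ler_normB _ _) _; rewrite mulrDl mul1r normrM; apply: lerD.
      by apply: H; rewrite t0.
    rewrite ger0_norm ?exprn_ge0 // ler_wpM2l ?exprn_ge0 //; apply: H.
    by rewrite divr_ge0 //= ler_pdivrMr //; lra.
  (* The factor [1 - 2 ^ (k + 1 - l)] between [c l] and [c' l] is at most -1, because [l <= k]. *)
  rewrite mulrA -/D => le; apply: le_trans le; rewrite normrM ler_peMr //.
  have : 2 <= 2 ^+ (k.+1 - l) :> R by rewrite subSn // exprS ler_peMr // exprn_ege1 // ler1n.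
  by move=> ge2; rewrite ler0_norm; lra.
move=> l; rewrite leq_eqVlt => /orP[/eqP ->|]; last first.
  rewrite ltnS => /low /le_trans; apply; rewrite ler_wpM2r //.
  by rewrite -[leLHS]mul1r -[leLHS]add0r lerD // ler_wpM2r ?(ltW D0) // ler1n.
have := H 1; rewrite lexx ler01 => /(_ isT).
under eq_bigr do rewrite expr1n mulr1.
rewrite big_ord_recr /= => le.
have les : `|\sum_(i < k.+1) c i| <= k.+1%:R * (D * B).
  apply: le_trans (ler_norm_sum _ _ _) _.
  rewrite -[X in X%:R * _]card_ord mulr_natl -sumr_const; apply: ler_sum => i _.
  by apply: low; rewrite -ltnS.
set S := \sum_(i < k.+1) _ in le les.
have -> : c k.+1 = (S + c k.+1) - S by ring.
apply: le_trans (ler_normB _ _) _; apply: le_trans (lerD le les) _.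
rewrite [leRHS]mulrDl mul1r lerD2l -mulrA; apply: ler_wpM2r; rewrite ?ler_nat //.
by rewrite mulr_ge0 // ltW.
Qed.

Section MixedCoefficients.
Variables (R : realType) (m r : nat) (alpha : 'I_r -> R).
Implicit Type kappa : 'I_r -> R.

(* The coefficient of [prod_(j in J) x_j], for any [J] of size [k], in the sum
   over injections [i] of [prod_j (alpha (i j) + kappa (i j) * x_j)]. *)
Definition mixed_coef kappa (k : nat) : R :=
  \sum_(i : {ffun 'I_m -> 'I_r} | injectiveb i)
    \prod_(a < m) (if (a < k)%N then kappa (i a) else alpha (i a)).

Lemma perm_to_prefix (J : {set 'I_m}) :
  exists s : 'S_m, forall a : 'I_m, (s a \in J) = (a < #|J|)%N.
Proof.
pose e := enum J ++ enum (~: J).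
have ue : uniq e.
  rewrite cat_uniq !enum_uniq andbT /=; apply/hasPn => x.
  by rewrite !mem_enum inE.
have se : size e = m by rewrite size_cat -!cardE cardsC card_ord.
pose h (a : 'I_m) := nth a e a.
have hE (a b : 'I_m) : h a = nth b e a by apply: set_nth_default; rewrite se.
have hinj : injective h.
  move=> a b; rewrite (hE b a) /h => /eqP.
  by rewrite nth_uniq ?se // => /eqP/val_inj.
exists (perm hinj) => a; rewrite permE /h nth_cat -cardE.
case: ltnP => la.
  by rewrite -mem_enum mem_nth // -cardE.
have : nth a (enum (~: J)) (a - #|J|) \in ~: J.
  rewrite -mem_enum mem_nth // -cardE; have := cardsC J; rewrite card_ord.
  have := ltn_ord a; move: #|J| #|~: J| la => x y; lia.
by rewrite inE => /negbTE.
Qed.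

Lemma mixed_coefE kappa (J : {set 'I_m}) :
  \sum_(i : {ffun 'I_m -> 'I_r} | injectiveb i)
    \prod_j (if j \in J then kappa (i j) else alpha (i j)) = mixed_coef kappa #|J|.
Proof.
have [s sJ] := perm_to_prefix J.
pose h (i : {ffun 'I_m -> 'I_r}) : {ffun 'I_m -> 'I_r} := [ffun a => i (s a)].
have hinj : injective h.
  move=> i i' /ffunP eqi; apply/ffunP => a.
  by have := eqi (s^-1%g a); rewrite !ffunE permKV.
rewrite /mixed_coef [RHS](reindex_inj hinj) /=; apply: eq_big => [i|i _].
  apply/injectiveP/injectiveP => iinj a b.
    by rewrite !ffunE => /iinj/perm_inj.
  have := iinj (s^-1%g a) (s^-1%g b); rewrite !ffunE !permKV => h' /h'.
  by move/perm_inj.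
rewrite (reindex_inj (@perm_inj _ s)); apply: eq_bigr => a _.
by rewrite sJ ffunE.
Qed.

Section Values.
Hypotheses (alpha_gt0 : forall i, 0 < alpha i) (le_mr : (m <= r)%N).

Definition prefix_injection : {ffun 'I_m -> 'I_r} := [ffun a => widen_ord le_mr a].

Lemma prefix_injection_inj : injective prefix_injection.
Proof. by move=> a b; rewrite !ffunE => /(congr1 val) /= h; apply: val_inj. Qed.

Lemma mixed_coef0 kappa : 0 < mixed_coef kappa 0.
Proof.
rewrite /mixed_coef (bigD1 prefix_injection) /=; last by apply/injectiveP/prefix_injection_inj.
by rewrite ltr_wpDr ?prodr_gt0 // sumr_ge0 // => i _; apply: prodr_ge0 => a _; apply: ltW.
Qed.

(* Moves mass from the first colour to the next [k - 1] ones. *)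
Definition spread (k : nat) (c : 'I_r) : R :=
  if val c == 0%N then - (k%:R - 1) else if (c < k)%N then 1 else 0.

Lemma card_ord_lt (n k : nat) : (k <= n)%N -> #|[set b : 'I_n | (b < k)%N]| = k.
Proof.
move=> kn; rewrite cardsE -sum1_card -(big_ord_widen _ (fun=> 1%N)) //.
by rewrite sum_nat_const card_ord muln1.
Qed.

(** A term is nonzero only if [i] maps the first [k] positions onto the first [k] colours. It then
    contains the negative factor [- (k - 1)] exactly once, the other factors being positive, so
    nothing cancels. *)
Lemma mixed_coef_spread (k : nat) : (1 < k)%N -> (k <= m)%N -> mixed_coef (spread k) k < 0.
Proof.
move=> k1 km; have kr := leq_trans km le_mr.
have k1R : 1 < k%:R :> R by rewrite ltr1n.
have term (i : {ffun 'I_m -> 'I_r}) : injective i -> (forall a : 'I_m, (a < k)%N -> (i a < k)%N) ->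
    \prod_(a < m) (if (a < k)%N then spread k (i a) else alpha (i a)) < 0.
  move=> iinj ik.
  have [a0 a0k ia0] : exists2 a : 'I_m, (a < k)%N & val (i a) = 0%N.
    pose A := [set a : 'I_m | (a < k)%N]; pose B := [set c : 'I_r | (c < k)%N].
    have /eqP eqAB : i @: A == B.
      rewrite eqEcard card_imset // !card_ord_lt // leqnn andbT.
      by apply/fintype.subsetP => c /imsetP[a]; rewrite !inE => /ik h ->.
    have r0 : (0 < r)%N by apply: leq_trans kr; apply: ltnW.
    have : Ordinal r0 \in B by rewrite inE /= ltnW.
    by rewrite -eqAB => /imsetP[a]; rewrite inE => ak /(congr1 val) /= ->; exists a.
  rewrite (bigD1 a0) //= a0k /spread ia0 eqxx nmulr_rlt0; last by lra.
  apply: prodr_gt0 => a na; case: ifP => // ak; rewrite ifF ?ik ?ltr01 //.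
  apply/negP => /eqP ia; case/eqP: na; apply: iinj; apply: val_inj; rewrite ia ia0 //.
rewrite /mixed_coef (bigD1 prefix_injection) /=; last by apply/injectiveP/prefix_injection_inj.
rewrite -[ltRHS]addr0; apply: ltr_leD.
  by apply: term => [|a ak]; [apply: prefix_injection_inj|rewrite ffunE].
apply: sumr_le0 => i /andP[/injectiveP iinj _].
have [/forallP ik|] := boolP [forall a : 'I_m, (a < k)%N ==> (i a < k)%N].
  by apply/ltW/term => // a ak; have /implyP := ik a; apply.
rewrite negb_forall => /existsP[a]; rewrite negb_imply -leqNgt => /andP[ak ka].
rewrite (bigD1 a) //= ak /spread ifF ?ifF ?mul0r //; first by rewrite ltnNge ka.
by apply/negP => /eqP h; rewrite h leqNgt ltnW in ka.
Qed.

Definition transfer (c c' : 'I_r) (i : 'I_r) : R := (i == c)%:R - (i == c')%:R.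

Lemma prod_first (F G : 'I_m -> R) (a0 : 'I_m) : val a0 = 0%N ->
  \prod_(a < m) (if (a < 1)%N then F a else G a) = F a0 * \prod_(a | a != a0) G a.
Proof.
move=> a00; rewrite (bigD1 a0) //= a00; congr (_ * _); apply: eq_bigr => a na.
case: ifP => //; rewrite ltnS leqn0 => /eqP a0'; case/eqP: na.
by apply: val_inj => /=; rewrite a0' -a00.
Qed.

Lemma injection_through (c : 'I_r) (a0 : 'I_m) :
  exists2 i : {ffun 'I_m -> 'I_r}, injective i & i a0 = c.
Proof.
pose i0 := prefix_injection.
exists [ffun a => tperm (i0 a0) c (i0 a)]; last by rewrite ffunE tpermL.
move=> a b; have := @prefix_injection_inj a b.
by rewrite !ffunE => h /perm_inj /h.
Qed.

Lemma injection_through2 (c c' : 'I_r) (a0 a1 : 'I_m) : c != c' -> a0 != a1 ->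
  exists i : {ffun 'I_m -> 'I_r}, [/\ injective i, i a0 = c & i a1 = c'].
Proof.
move=> ncc naa; have [i iinj i0] := injection_through c a0.
exists [ffun a => tperm (i a1) c' (i a)]; split.
- by move=> a b; rewrite !ffunE => /perm_inj; apply: iinj.
- rewrite ffunE i0 tpermD // 1?eq_sym //; apply: contra naa => /eqP h.
  by apply/eqP/iinj; rewrite i0 h.
- by rewrite ffunE tpermL.
Qed.

Lemma mixed_coef_point (c : 'I_r) : (0 < m)%N ->
  0 < mixed_coef (fun i => (i == c)%:R) 1.
Proof.
move=> m0; pose a0 := Ordinal m0; have [i iinj i0] := injection_through c a0.
rewrite /mixed_coef; under eq_bigr do rewrite (@prod_first _ _ a0) //.
rewrite (bigD1 i) /=; last exact/injectiveP.
rewrite i0 eqxx mul1r ltr_wpDr ?prodr_gt0 // sumr_ge0 // => j _.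
by rewrite mulr_ge0 // prodr_ge0 // => a _; apply: ltW.
Qed.

(** Exchanging the colours [c] and [c'] pairs the terms with [i a0 = c] and those with [i a0 = c'].
    What remains is a sum of differences in which an [alpha c'] at another position is replaced by
    the smaller [alpha c]; one is strict, since with [1 < m] some injection takes both colours. *)
Lemma mixed_coef_transfer (c c' : 'I_r) : (1 < m)%N -> alpha c < alpha c' ->
  0 < mixed_coef (transfer c c') 1.
Proof.
move=> m1 ltcc; have m0 := ltnW m1; pose a0 := Ordinal m0; pose a1 := Ordinal m1.
have ncc : c != c' by apply: contraTneq ltcc => ->; rewrite ltxx.
pose rest (i : {ffun 'I_m -> 'I_r}) := \prod_(a | a != a0) alpha (i a).
pose swap (i : {ffun 'I_m -> 'I_r}) : {ffun 'I_m -> 'I_r} := [ffun a => tperm c c' (i a)].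
have swap_inj : injective swap.
  move=> i i' /ffunP eqi; apply/ffunP => a.
  by have := eqi a; rewrite !ffunE => /perm_inj.
have inj_swap i : injectiveb (swap i) = injectiveb i.
  apply/injectiveP/injectiveP => iinj a b h.
    by apply: iinj; rewrite !ffunE h.
  by move: h; rewrite !ffunE => /perm_inj/iinj.
rewrite /mixed_coef; under eq_bigr do rewrite (@prod_first _ _ a0) // /transfer mulrBl.
rewrite sumrB [X in _ - X](reindex_inj swap_inj) /= (eq_bigl _ _ inj_swap) -sumrB.
have term (i : {ffun 'I_m -> 'I_r}) : injective i -> i a0 = c -> rest (swap i) <= rest i.
  move=> iinj ia0; apply: ler_prod => a na; rewrite ffunE (ltW (alpha_gt0 _)) /=.
  have nic : i a != c by rewrite -ia0 (inj_eq iinj).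
  by case: tpermP => [h|->|//]; [rewrite h eqxx in nic|apply: ltW].
have eqt (i : {ffun 'I_m -> 'I_r}) : (i a0 == c)%:R * \prod_(a | a != a0) alpha (i a) -
    (swap i a0 == c')%:R * \prod_(a | a != a0) alpha (swap i a) =
    (i a0 == c)%:R * (rest i - rest (swap i)).
  by rewrite ffunE -{2}(tpermL c c') (inj_eq perm_inj) mulrBr.
under eq_bigr do rewrite eqt.
have [i [iinj i0 i1]] := injection_through2 ncc (isT : a0 != a1).
rewrite (bigD1 i) /=; last exact/injectiveP.
rewrite ltr_wpDr //.
  apply: sumr_ge0 => j /andP[/injectiveP jinj _].
  case: (altP (j a0 =P c)) => [j0|_]; last by rewrite mul0r.
  by rewrite mul1r subr_ge0 term.
rewrite i0 eqxx mul1r subr_gt0 /rest (bigD1 a1) //= [ltRHS](bigD1 a1) //=.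
rewrite ffunE i1 tpermR; apply: (@lt_le_trans _ _ (alpha c' * \prod_(a < m | (a != a0) && (a != a1)) alpha (swap i a))).
  by rewrite ltr_pM2r // prodr_gt0.
rewrite ler_wpM2l ?(ltW (alpha_gt0 _)) //; apply: ler_prod => a /andP[na _].
rewrite ffunE (ltW (alpha_gt0 _)) /=.
have nic : i a != c by rewrite -i0 (inj_eq iinj).
by case: tpermP => [h|->|//]; [rewrite h eqxx in nic|apply: ltW].
Qed.

End Values.
End MixedCoefficients.

Section Levels.
Variables (R : realType) (V : finType) (m : nat).
Implicit Types (f : {ffun 'I_m -> V} -> R) (h : V -> R).

Definition level_sum f h (k : nat) : R :=
  \sum_(J : {set 'I_m} | #|J| == k) \sum_x f x * \prod_(j in J) h (x j).

Lemma sum_by_card (T : nat -> R) (A : {set 'I_m} -> R) :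
  \sum_(J : {set 'I_m}) T #|J| * A J =
  \sum_(k < m.+1) T k * \sum_(J : {set 'I_m} | #|J| == k) A J.
Proof.
have cJ (J : {set 'I_m}) : (#|J| < m.+1)%N by rewrite ltnS -[X in (_ <= X)%N](card_ord m) max_card.
rewrite (partition_big (fun J : {set 'I_m} => Ordinal (cJ J)) xpredT) //=.
apply: eq_bigr => k _; rewrite mulr_sumr; apply: eq_big => [J|J /eqP <- //].
by rewrite -val_eqE.
Qed.

Lemma mixed_expansion (r : nat) (alpha kappa : 'I_r -> R) f h (t : R) :
  \sum_x f x * (\sum_(i : {ffun 'I_m -> 'I_r} | injectiveb i)
    \prod_j (alpha (i j) + t * kappa (i j) * h (x j))) =
  \sum_(k < m.+1) mixed_coef m alpha kappa k * level_sum f h k * t ^+ k.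
Proof.
have inner (x : {ffun 'I_m -> V}) : \sum_(i : {ffun 'I_m -> 'I_r} | injectiveb i)
    \prod_j (alpha (i j) + t * kappa (i j) * h (x j)) =
    \sum_(J : {set 'I_m}) mixed_coef m alpha kappa #|J| * t ^+ #|J| * \prod_(j in J) h (x j).
  under eq_bigr => i _ do (under eq_bigr do rewrite addrC; rewrite bigA_distr).
  rewrite exchange_big /=; apply: eq_bigr => J _.
  rewrite -mixed_coefE !mulr_suml; apply: eq_bigr => i _.
  rewrite -prodr_const [\prod_(j in J) t]big_mkcond [\prod_(j in J) h _]big_mkcond -!big_split /=.
  by apply: eq_bigr => j _; case: ifP => _; [ring|rewrite !mulr1].
under eq_bigr do rewrite inner mulr_sumr.
rewrite exchange_big /=.
transitivity (\sum_(J : {set 'I_m}) mixed_coef m alpha kappa #|J| * t ^+ #|J| *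
    \sum_x f x * \prod_(j in J) h (x j)).
  by apply: eq_bigr => J _; rewrite mulr_sumr; apply: eq_bigr => x _; rewrite mulrCA.
rewrite (sum_by_card (fun k => mixed_coef m alpha kappa k * t ^+ k)).
by apply: eq_bigr => k _; rewrite -/(level_sum f h k); ring.
Qed.

(** The indicator of [W] is split as [a] plus a remainder. It will be used with [a] the density of
    [W], so that the remainder has sum zero. *)
Lemma mform_levels f (W : {set V}) (a : R) :
  mform f (fun=> W) =
  \sum_(k < m.+1) a ^+ (m - k) * level_sum f (fun v => (v \in W)%:R - a) k.
Proof.
rewrite -(sum_by_card (fun k => a ^+ (m - k))
  (fun J => \sum_x f x * \prod_(j in J) ((x j \in W)%:R - a))).
under [RHS]eq_bigr do rewrite mulr_sumr.
rewrite [RHS]exchange_big /=; apply: eq_bigr => x _.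
under [RHS]eq_bigr do rewrite mulrCA; rewrite -mulr_sumr; congr (_ * _).
transitivity (\prod_j (((x j \in W)%:R - a) + a)).
  by apply: eq_bigr => j _; rewrite subrK.
rewrite bigA_distr; apply: eq_bigr => J _.
rewrite (bigID (mem J)) /= mulrC; congr (_ * _).
  rewrite (eq_bigr (fun=> a)) => [|j /negbTE -> //]; rewrite prodr_const.
  congr (_ ^+ _); rewrite (eq_card (B := ~: J)) => [|j]; last by rewrite !inE.
  by rewrite cardsCs finset.setCK card_ord.
by apply: eq_bigr => j ->.
Qed.

Lemma level_sum0 f h : level_sum f h 0 = \sum_x f x.
Proof.
rewrite /level_sum (big_pred1 finset.set0) => [|J]; last by rewrite cards_eq0.
by apply: eq_bigr => x _; rewrite big1 ?mulr1 // => j; rewrite inE.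
Qed.

Definition marginal f (v : V) : R := \sum_(j < m) \sum_x f x * (x j == v)%:R.

Lemma level_sum1 f h : level_sum f h 1 = \sum_v marginal f v * h v.
Proof.
transitivity (\sum_(j < m) \sum_x f x * h (x j)).
  rewrite /level_sum (eq_bigl (mem ((fun j : 'I_m => [set j]%SET) @: [set: 'I_m]%SET))).
    rewrite big_imset /= => [|j k _ _ /finset.set1_inj //].
    apply: eq_big => [j|j _]; first by rewrite inE.
    by apply: eq_bigr => x _; rewrite big_set1.
  move=> J; apply/cards1P/imsetP => [[j ->]|[j _ ->]]; last by exists j.
  by exists j; rewrite ?inE.
rewrite /marginal; under [RHS]eq_bigr do rewrite mulr_suml.
rewrite [RHS]exchange_big /=; apply: eq_bigr => j _.
under [RHS]eq_bigr do rewrite mulr_suml.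
rewrite [RHS]exchange_big /=; apply: eq_bigr => x _.
rewrite (bigD1 (x j)) //= eqxx mulr1 big1 ?addr0 // => v nv.
by rewrite eq_sym (negbTE nv) mulr0 mul0r.
Qed.

Lemma sum_marginal f : \sum_v marginal f v = m%:R * \sum_x f x.
Proof.
rewrite /marginal exchange_big /= -[X in X%:R * _]card_ord mulr_natl -sumr_const.
apply: eq_bigr => j _; rewrite exchange_big /=; apply: eq_bigr => x _.
by rewrite -mulr_sumr (bigD1 (x j)) //= eqxx big1 ?addr0 ?mulr1 // => v nv; rewrite eq_sym (negbTE nv).
Qed.

Lemma marginal_bound f v : (forall x, `|f x| <= 1) ->
  `|marginal f v| <= m%:R * #|V|%:R ^+ m.-1.
Proof.
move=> f1; apply: le_trans (ler_norm_sum _ _ _) _.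
rewrite -[X in X%:R * _]card_ord mulr_natl -sumr_const; apply: ler_sum => j _.
apply: le_trans (ler_norm_sum _ _ _) _.
have := mform_coord (fun w => (w == v)%:R : R) j (fun=> [set: V]%SET).
rewrite prodr_const cardsT (eq_card (B := predC1 j)) // cardC1 card_ord.
rewrite (bigD1 v) ?inE //= eqxx big1 ?addr0 ?mul1r => [<-|w /andP[_ /negbTE -> //]].
apply: ler_sum => x _; rewrite normrM normr_nat big1 ?mulr1 => [|k _]; last by rewrite inE.
by rewrite ler_piMl.
Qed.

End Levels.

Lemma mform_additive_const (R : realType) (V : finType) (m : nat) (g : V -> R) (W : {set V}) :
  (0 < m)%N ->
  mform (@additive_form R V m g) (fun=> W) = (\sum_(v in W) g v) * #|W|%:R ^+ m.-1.
Proof.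
move=> m0; rewrite mformZ mform_sum.
rewrite (eq_bigr (fun=> (\sum_(v in W) g v) * #|W|%:R ^+ m.-1)) => [|j _]; last first.
  by rewrite mform_coord prodr_const (eq_card (B := predC1 j)) // cardC1 card_ord.
by rewrite sumr_const card_ord -[X in _ * X]mulr_natl mulKf ?pnatr_eq0 -?lt0n.
Qed.

Lemma exists_common_lower_bound (R : realType) (I : finType) (F : I -> R) :
  (forall i, 0 < F i) -> exists2 t : R, 0 < t & forall i, t <= F i.
Proof.
move=> F0; have S0 : 0 <= \sum_i (F i)^-1 by apply: sumr_ge0 => i _; rewrite invr_ge0 ltW.
exists (1 + \sum_i (F i)^-1)^-1 => [|i]; first by rewrite invr_gt0 ltr_wpDr.
rewrite -[leRHS]invrK lef_pV2 ?posrE ?invr_gt0 ?ltr_wpDr //.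
apply: ler_wpDl => //; rewrite (bigD1 i) //= lerDl.
by apply: sumr_ge0 => j _; rewrite invr_ge0 ltW.
Qed.

(** * Bounds on the components from fractional colourings *)

Section CoefficientControl.
Variables (R : realType) (m r : nat) (alpha : 'I_r -> R).
Hypotheses (alpha_gt0 : forall i, 0 < alpha i) (le_mr : (m <= r)%N)
  (alpha_sum : \sum_i alpha i <= 1).

Definition fractional_uniform (V : finType) (f : {ffun 'I_m -> V} -> R) (B : R) :=
  forall u : 'I_r -> V -> R, (forall i, \sum_v u i v = alpha i * #|V|%:R) ->
  (forall i v, 0 <= u i v) -> (forall v, \sum_i u i v <= 1) ->
  `|\sum_x f x * \sum_(i : {ffun 'I_m -> 'I_r} | injectiveb i) \prod_j u (i j) (x j)| <= B.

(** The condition that [h] has sum zero keeps the class sizes [alpha i * |V|] when a multiple of [h]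
    is added to each colour. [C] is chosen before [V], [f] and [B]. *)
Definition level_controlled (k : nat) := exists2 C : R, 0 < C &
  forall (V : finType) (f : {ffun 'I_m -> V} -> R) (B : R) (h : V -> R),
  fractional_uniform f B -> (forall v, `|h v| <= 1) -> \sum_v h v = 0 ->
  `|level_sum f h k| <= C * B.

(** The colourings [alpha i + t0 * t * kappa i * h] are admissible for [t] in [[0, 1]] if [t0] is
    small. Their total weight at a vertex stays at most 1 either because the [kappa i] cancel or
    because [alpha] leaves room. The coefficient of [t ^ k] is the component wanted, up to the
    nonzero factor. *)
Lemma mixed_coef_control (kappa : 'I_r -> R) (k : nat) : (k <= m)%N ->
  mixed_coef m alpha kappa k != 0 -> \sum_i kappa i = 0 \/ \sum_i alpha i < 1 ->
  level_controlled k.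
Proof.
move=> km kne slack.
have [t0 t0_gt0 [t0k t0s]] : exists2 t0 : R, 0 < t0 &
    (forall i, t0 * `|kappa i| <= alpha i) /\ \sum_i alpha i + t0 * `|\sum_i kappa i| <= 1.
  have [t1 t1_gt0 t1k] := exists_common_lower_bound
    (fun i => divr_gt0 (alpha_gt0 i) (ltr_wpDr (normr_ge0 (kappa i)) ltr01)).
  have ok t : 0 < t -> t <= t1 -> forall i, t * `|kappa i| <= alpha i.
    move=> tp le i; have := le_trans le (t1k i).
    rewrite ler_pdivlMr ?ltr_wpDr // => h; apply: le_trans h.
    by rewrite ler_wpM2l ?(ltW tp) // lerDr.
  case: slack => [->|lt1].
    by exists t1 => //; split; [apply: ok|rewrite normr0 mulr0 addr0].
  set s := \sum_i kappa i; set A := \sum_i alpha i in lt1 *.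
  have s1 : 0 < 1 + `|s| by rewrite ltr_wpDr.
  pose t2 := (1 - A) / (1 + `|s|).
  have t20 : 0 < t2 by rewrite divr_gt0 // subr_gt0.
  exists (Num.min t1 t2); first by rewrite lt_min t1_gt0.
  split; first by apply: ok; rewrite ?lt_min ?t1_gt0 // ge_min lexx.
  have h : Num.min t1 t2 <= t2 by rewrite ge_min lexx orbT.
  have : t2 * (1 + `|s|) = 1 - A by rewrite /t2 divfK // gt_eqF.
  have := normr_ge0 s; have : 0 <= Num.min t1 t2 by rewrite ltW // lt_min t1_gt0.
  by nra.
have [C C0 HC] := coefficient_bound R m.
pose D := `|mixed_coef m alpha kappa k| * t0 ^+ k.
have D0 : 0 < D by rewrite mulr_gt0 ?normr_gt0 ?exprn_gt0.
exists (C / D); first by rewrite divr_gt0.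
move=> V f B h Hf h1 hs.
have := HC (fun l => mixed_coef m alpha kappa l * level_sum f h l * t0 ^+ l) B.
move=> /(_ _ k km) H; rewrite mulrAC ler_pdivlMr // mulrC /D mulrAC.
rewrite -(ger0_norm (ltW (exprn_gt0 k t0_gt0))) -!normrM; apply: H.
move=> t /andP[tge0 tle1]; have tt0 : 0 <= t0 * t by rewrite mulr_ge0 // ltW.
have := mixed_expansion alpha kappa f h (t0 * t).
under [X in _ = X -> _]eq_bigr do rewrite exprMn mulrA.
move=> <-; have small i v : `|t0 * t * kappa i * h v| <= alpha i.
  apply: le_trans (t0k i); rewrite !normrM (ger0_norm (ltW t0_gt0)) (ger0_norm tge0).
  apply: (@le_trans _ _ (t0 * t * `|kappa i|)).
    by rewrite ler_piMr // mulr_ge0.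
  by rewrite ler_wpM2r // ler_piMr // ltW.
apply: (Hf (fun i v => alpha i + t0 * t * kappa i * h v)).
- move=> i; rewrite big_split /= -mulr_sumr hs mulr0 addr0 sumr_const.
  by rewrite mulr_natr.
- by move=> i v; have := small i v; rewrite ler_norml; lra.
- move=> v; rewrite big_split /=; apply: le_trans t0s; rewrite lerD2l.
  rewrite -mulr_suml -mulr_sumr; apply: le_trans (ler_norm _) _.
  rewrite !normrM (ger0_norm (ltW t0_gt0)) (ger0_norm tge0).
  apply: (@le_trans _ _ (t0 * t * `|\sum_i kappa i|)).
    by rewrite ler_piMr // mulr_ge0.
  by rewrite ler_wpM2r // ler_piMr // ltW.
Qed.

Lemma level_controlled_ne1 (k : nat) : (k <= m)%N -> k != 1%N -> level_controlled k.
Proof.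
case: k => [|[|k]] // km _.
  apply: (mixed_coef_control (kappa := fun=> 0)) => //; last by left; rewrite big1.
  by rewrite gt_eqF // mixed_coef0.
apply: (mixed_coef_control (kappa := spread R k.+2)) => //.
  by rewrite lt_eqF // mixed_coef_spread.
left; have r0 : (0 < r)%N by apply: leq_trans le_mr; apply: leq_trans km.
rewrite (bigD1 (Ordinal r0)) //= /spread eqxx.
rewrite (eq_bigr (fun c : 'I_r => (c < k.+2)%:R : R)) => [|c nc]; last first.
  by rewrite ifF; [case: ifP|apply: contraNF nc].
have <- : \sum_(c < r) (c < k.+2)%:R = k.+2%:R :> R.
  rewrite -natr_sum -[in RHS](card_ord_lt (leq_trans km le_mr)); congr _%:R.
  by rewrite cardsE -sum1_card [RHS]big_mkcond.
by rewrite [in X in - (X - 1)](bigD1 (Ordinal r0)) //=; ring.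
Qed.

(** If the [alpha i] add up to less than 1, the weight of a single colour may be perturbed. If they
    add up to 1, two of them differ, and mass is moved between these two. *)
Lemma level_controlled_1 : (1 < m)%N -> (exists i, alpha i != r%:R^-1) -> level_controlled 1.
Proof.
move=> m1 [i0 ni0]; have m0 := ltnW m1.
have r0 : 0 < r%:R :> R by rewrite ltr0n (leq_trans m0).
have [lt1|ge1] := ltP (\sum_i alpha i) 1.
  apply: (mixed_coef_control (kappa := fun i => (i == i0)%:R)) => //; last by right.
  by rewrite gt_eqF // mixed_coef_point.
have [c [c' ltc]] : exists c c', alpha c < alpha c'.
  apply: contrapT => H; have ge a b : alpha a <= alpha b.
    by rewrite leNgt; apply/negP => lt; apply: H; exists b, a.
  case/eqP: ni0; have eqa a : alpha a = alpha i0 by apply/le_anti; rewrite !ge.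
  have : \sum_i alpha i = 1 by apply/le_anti; rewrite alpha_sum.
  rewrite (eq_bigr (fun=> alpha i0)) // sumr_const card_ord => h.
  by apply: (mulIf (lt0r_neq0 r0)); rewrite mulr_natr h mulVf // gt_eqF.
apply: (mixed_coef_control (kappa := transfer R c c')) => //; last left.
  by rewrite gt_eqF // mixed_coef_transfer.
rewrite /transfer sumrB (bigD1 c) //= eqxx big1 ?addr0 => [|i /negbTE -> //].
by rewrite (bigD1 c') //= eqxx big1 ?addr0 ?subrr // => i /negbTE ->.
Qed.

Lemma all_controlled (P : pred nat) : (forall k, (k <= m)%N -> P k -> level_controlled k) ->
  exists2 C : R, 0 < C & forall k, (k <= m)%N -> P k ->
  forall (V : finType) (f : {ffun 'I_m -> V} -> R) (B : R) (h : V -> R),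
  fractional_uniform f B -> (forall v, `|h v| <= 1) -> \sum_v h v = 0 ->
  `|level_sum f h k| <= C * B.
Proof.
move=> H; have /choice[C HC] : forall k, exists c : R, 0 < c /\
    ((k <= m)%N -> P k -> forall (V : finType) (f : {ffun 'I_m -> V} -> R) (B : R) (h : V -> R),
    fractional_uniform f B -> (forall v, `|h v| <= 1) -> \sum_v h v = 0 ->
    `|level_sum f h k| <= c * B).
  move=> k.
  have [/andP[km Pk]|nk] := boolP ((k <= m)%N && P k).
    by have [c c0 Hc] := H k km Pk; exists c; split => // _ _; apply: Hc.
  by exists 1; split => // km Pk; rewrite km Pk in nk.
exists (\sum_(k < m.+1) C k).
  rewrite (bigD1 ord0) //= ltr_wpDr ?(HC _).1 //.
  by apply: sumr_ge0 => k _; apply/ltW/(HC _).1.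
move=> k km Pk V f B h Hf h1 hs; have le := (HC k).2 km Pk V f B h Hf h1 hs.
have B0 : 0 <= B by move: (le_trans (normr_ge0 _) le); rewrite pmulr_rge0 // (HC k).1.
apply: le_trans le _; rewrite ler_wpM2r // (bigD1 (Ordinal (km : (k < m.+1)%N))) //= lerDl.
by apply: sumr_ge0 => j _; apply/ltW/(HC _).1.
Qed.

Lemma mform_control : (forall k, (k <= m)%N -> level_controlled k) ->
  exists2 C : R, 0 < C & forall (V : finType) (f : {ffun 'I_m -> V} -> R) (B : R),
  (0 < #|V|)%N -> fractional_uniform f B -> forall W, `|mform f (fun=> W)| <= C * B.
Proof.
move=> H; have [C C0 HC] := all_controlled (P := xpredT) (fun k km _ => H k km).
exists (m.+1%:R * C); first by rewrite mulr_gt0.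
move=> V f B V0 Hf W; have n0 : 0 < #|V|%:R :> R by rewrite ltr0n.
pose a : R := #|W|%:R / #|V|%:R.
have a0 : 0 <= a by rewrite divr_ge0.
have a1 : a <= 1 by rewrite ler_pdivrMr // mul1r ler_nat max_card.
rewrite (mform_levels f W a); apply: le_trans (ler_norm_sum _ _ _) _.
rewrite -mulrA -[X in X%:R * _]card_ord mulr_natl -sumr_const; apply: ler_sum => k _.
rewrite normrM normrX (ger0_norm a0); apply: le_trans (ler_piMl (normr_ge0 _) (exprn_ile1 _ a0 a1)) _.
apply: HC => //; first by rewrite -ltnS.
  by move=> v; rewrite ler_norml; case: (v \in W) => /=; lra.
rewrite sumrB sumr_const -[X in _ - X]mulr_natr divfK ?gt_eqF //.
rewrite -[X in X - _]natr_sum -big_mkcond sum1_card subrr //.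
Qed.

Lemma mform_additive_control : (0 < m)%N ->
  exists2 C : R, 0 < C & forall (V : finType) (f : {ffun 'I_m -> V} -> R) (B : R),
  (0 < #|V|)%N -> (forall x, `|f x| <= 1) -> fractional_uniform f B ->
  exists g : V -> R, [/\ forall v, `|g v| <= m%:R, `|\sum_v g v| * #|V|%:R ^+ m.-1 <= C * B &
    forall W, `|mform (fun x => f x - additive_form g x) (fun=> W)| <= C * B].
Proof.
move=> m0; have [C C0 HC] := all_controlled (P := fun k => k != 1%N) level_controlled_ne1.
exists (2 * m.+1%:R * C); first by rewrite !mulr_gt0.
move=> V f B V0 f1 Hf; have n0 : 0 < #|V|%:R :> R by rewrite ltr0n.
set n : R := #|V|%:R in n0 *.
have nm0 : 0 < n ^+ m.-1 by rewrite exprn_gt0.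
have s0 : `|\sum_x f x| <= C * B.
  rewrite -(level_sum0 f (fun=> 0)); apply: HC => //; last by rewrite big1.
  by move=> v; rewrite normr0.
have CB0 : 0 <= C * B := le_trans (normr_ge0 _) s0.
have mS : m%:R <= m.+1%:R :> R by rewrite ler_nat.
have m1 : 1 <= m.+1%:R :> R by rewrite ler1n.
(* With this normalisation the additive form reproduces the degree one component of [f] exactly;
   what it adds is a multiple of the total sum of [f], which is the component of degree 0 and
   already bounded. *)
exists (fun v => marginal f v / n ^+ m.-1); split=> [v||W].
- rewrite normrM normfV (ger0_norm (ltW nm0)) ler_pdivrMr //; exact: marginal_bound.
- rewrite -mulr_suml sum_marginal normrM normfV (ger0_norm (ltW nm0)) divfK ?gt_eqF //.
  rewrite normrM normr_nat -mulrA -mulrA; apply: le_trans (_ : m.+1%:R * (C * B) <= _).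
    by apply: ler_pM.
  by have := mulr_ge0 (ler0n R m.+1) CB0; lra.
pose a : R := #|W|%:R / n; pose h v : R := (v \in W)%:R - a.
have a0 : 0 <= a by rewrite divr_ge0 // ltW.
have a1 : a <= 1 by rewrite ler_pdivrMr // mul1r ler_nat max_card.
have h1 v : `|h v| <= 1 by rewrite ler_norml /h; case: (v \in W) => /=; lra.
have hs : \sum_v h v = 0.
  rewrite sumrB sumr_const -[X in _ - X]mulr_natr divfK ?gt_eqF //.
  by rewrite -[X in X - _]natr_sum -big_mkcond sum1_card subrr.
have addE : mform (@additive_form R V m (fun v => marginal f v / n ^+ m.-1)) (fun=> W) =
    a ^+ m.-1 * level_sum f h 1 + a ^+ m * (m%:R * \sum_x f x).
  rewrite mform_additive_const //.
  rewrite level_sum1 /h; under [X in _ = _ * X + _]eq_bigr do rewrite mulrBr.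
  have -> : a ^+ m = a * a ^+ m.-1 by rewrite -exprS prednK.
  rewrite sumrB -!mulr_suml sum_marginal.
  rewrite (_ : \sum_v marginal f v * (v \in W)%:R = \sum_(v in W) marginal f v); last first.
    by rewrite [RHS]big_mkcond; apply: eq_bigr => v _; case: (v \in W); rewrite ?mulr1 ?mulr0.
  by rewrite /a expr_div_n; field; rewrite !gt_eqF.
rewrite mformB addE (mform_levels f W a) -/h.
have m1' : (1 < m.+1)%N by [].
rewrite (bigD1 (Ordinal m1')) //= subn1 opprD addrACA subrr add0r.
set S := \sum_(i < m.+1 | _) _.
have le1 : `|S| <= m.+1%:R * (C * B).
  apply: le_trans (ler_norm_sum _ _ _) _.
  apply: (@le_trans _ _ (\sum_(i < m.+1) C * B)); last by rewrite sumr_const card_ord mulr_natl.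
  rewrite [leLHS]big_mkcond; apply: ler_sum => k _; case: ifP => // nk.
  rewrite normrM normrX (ger0_norm a0); apply: le_trans (ler_piMl (normr_ge0 _) (exprn_ile1 _ a0 a1)) _.
  by apply: HC => //; rewrite -ltnS.
have le2 : `|a ^+ m * (m%:R * \sum_x f x)| <= m.+1%:R * (C * B).
  rewrite !normrM normrX (ger0_norm a0) normr_nat; apply: le_trans (ler_piMl _ (exprn_ile1 _ a0 a1)) _; first by rewrite mulr_ge0.
  by apply: ler_pM.
by apply: le_trans (ler_normB _ _) _; apply: le_trans (lerD le1 le2) _; rewrite le_eqVlt; apply/orP; left; apply/eqP; ring.
Qed.

End CoefficientControl.

(** * The property and the cut condition *)

Lemma exists_nat_ge (R : realType) (x : R) : exists n0 : nat, forall n : nat,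
  (n0 <= n)%N -> x <= n%:R.
Proof.
exists (Num.truncn x).+1 => n le; apply/ltW/(lt_le_trans (truncnS_gt x)).
by rewrite ler_nat.
Qed.

Section PropertyBridge.
Variables (R : realType) (m r : nat) (F : sgraph 'I_m) (p : R).

(** On disjoint sets injectivity is automatic, so the counts and their expected values combine into
    forms of [hom_dev], one for each injection of the positions into the colours. *)
Lemma property_deviation (V : finType) (G : sgraph V) (U : 'I_r -> {set V}) :
  pairwise_disjoint U ->
  \sum_(i : {ffun 'I_m -> 'I_r} | increasing i) N_hom_avg R F G (fun j => U (i j))
    - p ^+ num_edges F *
      \sum_(i : {ffun 'I_m -> 'I_r} | increasing i) \prod_(j < m) #|U (i j)|%:R =
  (m`!)%:R^-1 * \sum_(i : {ffun 'I_m -> 'I_r} | injectiveb i)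
    mform (hom_dev (edge G) (edge_pairs F) p) (fun j => U (i j)).
Proof.
move=> dU; have f0 : (m`!)%:R != 0 :> R by rewrite pnatr_eq0 -lt0n fact_gt0.
rewrite sum_injections !mulr_sumr -sumrB; apply: eq_bigr => i /increasing_inj iinj.
have dis (s : 'S_m) (j k : 'I_m) : j != k ->
    [disjoint U ([ffun l => i (s l)] j) & U ([ffun l => i (s l)] k)].
  by move=> njk; rewrite !ffunE; apply: dU; rewrite (inj_eq iinj) (inj_eq perm_inj).
have term (s : 'S_m) : mform (hom_dev (edge G) (edge_pairs F) p)
      (fun j => U ([ffun l => i (s l)] j)) =
    (N_hom_in F G (fun j => U (i (s j))))%:R - p ^+ num_edges F * \prod_j #|U (i j)|%:R.
  rewrite mform_hom_dev; last exact: dis.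
  rewrite -N_hom_in_sum; last exact: dis.
  rewrite size_edge_pairs; congr (_%:R - _ * _).
    by congr N_hom_in; apply/funext => j; rewrite ffunE.
  rewrite [RHS](reindex_inj (@perm_inj _ s)); apply: eq_bigr => j _.
  by rewrite ffunE.
rewrite [in RHS](eq_bigr _ (fun s _ => term s)).
rewrite sumrB sumr_const card_Sn -[X in _ * (_ - X)]mulr_natl /N_hom_avg.
by rewrite mulrBr mulKf // mulrC.
Qed.

Lemma property_of_cut (V : finType) (G : sgraph V) (U : 'I_r -> {set V}) (eta : R) :
  (0 < #|V|)%N -> 0 <= p <= 1 -> cut_close (edge G) p eta -> pairwise_disjoint U ->
  `|\sum_(i : {ffun 'I_m -> 'I_r} | increasing i) N_hom_avg R F G (fun j => U (i j))
    - p ^+ num_edges F *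
      \sum_(i : {ffun 'I_m -> 'I_r} | increasing i) \prod_(j < m) #|U (i j)|%:R|
  <= (r ^ m * num_edges F)%:R * (eta * #|V|%:R ^+ m).
Proof.
move=> V0 p01 cut dU; rewrite property_deviation // normrM ger0_norm ?invr_ge0 //.
have le1 (i : {ffun 'I_m -> 'I_r}) : injectiveb i ->
    `|mform (hom_dev (edge G) (edge_pairs F) p) (fun j => U (i j))| <=
    (num_edges F)%:R * (eta * #|V|%:R ^+ m).
  move=> /injectiveP iinj; rewrite mform_hom_dev => [|j k njk]; last first.
    by apply: dU; rewrite (inj_eq iinj).
  rewrite -size_edge_pairs; apply: hom_count_of_cut => //; first exact: edge_pairs_uniq.
  exact: edge_pairs_lt.
have eta0 : 0 <= (num_edges F)%:R * (eta * #|V|%:R ^+ m).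
  rewrite mulr_ge0 // mulr_ge0 ?exprn_ge0 //.
  have := cut finset.set0 finset.set0; rewrite cards0 mulr0 subr0 => h.
  have := le_trans (normr_ge0 _) h.
  by rewrite pmulr_lge0 // exprn_gt0 // ltr0n.
apply: (@le_trans _ _ (1 * \sum_(i : {ffun 'I_m -> 'I_r}) (num_edges F)%:R * (eta * #|V|%:R ^+ m))).
  apply: ler_pM => //.
    by rewrite invf_le1 ?ltr0n ?fact_gt0 // ler1n fact_gt0.
  apply: le_trans (ler_norm_sum _ _ _) _; rewrite big_mkcond; apply: ler_sum => i _.
  by case: ifP => // /le1.
by rewrite mul1r sumr_const card_ffun !card_ord -[leLHS]mulr_natl natrM mulrA.
Qed.

Hypothesis eF_gt0 : (0 < num_edges F)%N.

Lemma order_gt1 : (1 < m)%N.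
Proof.
move: eF_gt0 (edge_pairs_lt F); rewrite -size_edge_pairs.
case: (edge_pairs F) => // -[i j] l _ /= /andP[ij _].
by apply: leq_ltn_trans (ltn_ord j); apply: leq_ltn_trans ij.
Qed.

Variable alpha : 'rV[R]_r.
Hypotheses (p_gt0 : 0 < p) (p_le1 : p <= 1) (alpha_gt0 : forall i, 0 < alpha 0 i)
  (le_mr : (m <= r)%N) (alpha_sum : \sum_(i < r) alpha 0 i <= 1)
  (Halt : alpha <> const_mx (r%:R^-1) \/ (1 < num_edges F)%N).

Lemma hom_dev_le1 (V : finType) (G : sgraph V) (x : {ffun 'I_m -> V}) :
  `|hom_dev (edge G) (edge_pairs F) p x| <= 1.
Proof.
rewrite /hom_dev normrM normr_nat; case: (injectiveb x); rewrite ?mul0r ?mul1r //.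
have q0 : 0 <= p ^+ size (edge_pairs F) by rewrite exprn_ge0 // ltW.
have q1 : p ^+ size (edge_pairs F) <= 1 by rewrite exprn_ile1 // ltW.
by rewrite ler_norml; case: (hom_along _ _ _) => /=; lra.
Qed.

Lemma hereditary_of_fractional (delta : R) : 0 < delta ->
  exists2 eps : R, 0 < eps & exists n0 : nat, forall (V : finType) (G : sgraph V),
  (n0 <= #|V|)%N ->
  fractional_uniform (fun i => alpha 0 i) (hom_dev (edge G) (edge_pairs F) p)
    (eps * #|V|%:R ^+ m) ->
  forall W : {set V}, `|mform (hom_dev (edge G) (edge_pairs F) p) (fun=> W)| <=
    delta * #|V|%:R ^+ m.
Proof.
move=> delta0; have m1 := order_gt1; have m0 := ltnW m1.
case: Halt => [ne|e1].
  have ctl1 : level_controlled m (fun i => alpha 0 i) 1.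
    apply: level_controlled_1 => //; apply: contrapT => H; apply: ne.
    apply/rowP => i; rewrite mxE; apply/eqP; apply: contrapT => /negP ni.
    by apply: H; exists i.
  have [|C C0 HC] := mform_control (m := m) (alpha := fun i => alpha 0 i).
    move=> k km; case: (altP (k =P 1%N)) => [-> //|].
    exact: level_controlled_ne1.
  exists (delta / C); first by rewrite divr_gt0.
  exists 1%N => V G V0 /(HC _ _ _ V0) H W; have := H W.
  by rewrite mulrA mulrCA divff ?mulr1 // gt_eqF.
rewrite -size_edge_pairs in e1.
have [eps eps0 [n0 H]] := additive_part_small p (edge_pairs_uniq F) (edge_pairs_lt F) e1 delta0.
have [C C0 HC] := mform_additive_control alpha_gt0 le_mr alpha_sum m0.
exists (eps / C); first by rewrite divr_gt0.
exists (maxn 1 n0) => V G; rewrite geq_max => /andP[V0 nV] Hf.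
have [g []] := HC V _ _ V0 (hom_dev_le1 G) Hf.
rewrite mulrA mulrCA divff ?mulr1 ?gt_eqF // => g1 gs HW.
apply: (H V (edge G) g) => //; first exact: edge_sym.
have n0' : 0 < #|V|%:R :> R by rewrite ltr0n.
by move: gs; rewrite -{2}(prednK m0) exprS mulrA ler_pM2r // exprn_gt0.
Qed.

Lemma cut_of_property (c : R) : 0 < c ->
  exists2 eps : R, 0 < eps & exists n0 : nat, forall (V : finType) (G : sgraph V),
  (n0 <= #|V|)%N ->
  (forall U : 'I_r -> {set V}, pairwise_disjoint U ->
    (forall i, #|U i|%:Z = Num.floor (alpha 0 i * #|V|%:R)) ->
    `|\sum_(i : {ffun 'I_m -> 'I_r} | increasing i) N_hom_avg R F G (fun j => U (i j))
      - p ^+ num_edges F *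
        \sum_(i : {ffun 'I_m -> 'I_r} | increasing i) \prod_(j < m) #|U (i j)|%:R|
    <= eps * #|V|%:R ^+ m) ->
  cut_close (edge G) p c.
Proof.
move=> c0; have m0 := ltnW order_gt1; have r0 := leq_trans m0 le_mr.
have e0 : (0 < size (edge_pairs F))%N by rewrite size_edge_pairs.
have [eps1 eps10 [n1 H1]] := hereditary_count_cut (edge_pairs_uniq F) (edge_pairs_lt F) e0
  p_gt0 p_le1 c0.
have [eps2 eps20 [n2 H2]] := hereditary_of_fractional eps10.
have f0 : 0 < (m`!)%:R :> R by rewrite ltr0n fact_gt0.
have mr0 : 0 < m%:R * r%:R :> R by rewrite mulr_gt0 // ltr0n.
exists (eps2 / 2 / (m`!)%:R); first by rewrite !divr_gt0.
(* The error [2 m r delta] of the random colouring is [eps2 / 2]; the property supplies the other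
   half, after removal of its normalisation [m!]. *)
pose delta := eps2 / 4 / (m%:R * r%:R).
have delta0 : 0 < delta by rewrite !divr_gt0.
have [n3 H3] := exists_nat_ge ((1 + delta^-1) / delta).
exists (maxn 1 (maxn n1 (maxn n2 n3))) => V G; rewrite !geq_max => /and4P[V0 V1 V2 V3] HU.
have n0 : 0 < #|V|%:R :> R by rewrite ltr0n.
apply: H1 => //; first exact: edge_sym.
apply: H2 => // u us u0 u1.
pose a i := absz (Num.floor (alpha 0 i * #|V|%:R)).
have aE i : (a i)%:Z = Num.floor (alpha 0 i * #|V|%:R).
  by rewrite gez0_abs // floor_ge0 mulr_ge0 // ltW.
have aR i : (a i)%:R = (Num.floor (alpha 0 i * #|V|%:R))%:~R :> R by rewrite -aE.
have -> : eps2 * #|V|%:R ^+ m = (eps2 / 2 + 2 * m%:R * r%:R * delta) * #|V|%:R ^+ m.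
  by rewrite /delta; congr (_ * _); field; rewrite !pnatr_eq0 -!lt0n m0 r0.
apply: (@fractional_bound R V m r _ _ delta a u) => //.
- exact: hom_dev_le1.
- by move=> x /negbTE nx; rewrite /hom_dev nx mul0r.
- move=> phi phia; rewrite rainbow_sumE.
  have dphi : pairwise_disjoint (colour_class phi).
    move=> i j nij; rewrite -setI_eq0; apply/eqP/finset.setP => v; rewrite !inE.
    by apply/negP => /andP[/eqP -> /eqP[eqij]]; rewrite eqij eqxx in nij.
  have := HU (colour_class phi) dphi; rewrite property_deviation // => /(_ _) H.
  have {H} := H (fun i => etrans (congr1 Posz (phia i)) (aE i)).
  rewrite normrM ger0_norm ?invr_ge0 // ler_pdivrMl // => /le_trans; apply.
  by rewrite mulrA mulrCA divff ?mulr1 ?gt_eqF.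
- rewrite -(ler_nat R) natr_sum; apply: (@le_trans _ _ (\sum_i alpha 0 i * #|V|%:R)).
    by apply: ler_sum => i _; rewrite aR floor_le.
  by rewrite -mulr_suml ler_piMl // ltW.
- move=> i; rewrite us aR; have := floor_le (alpha 0 i * #|V|%:R).
  have := lt_succ_floor (alpha 0 i * #|V|%:R); rewrite intrD ler_norml; lra.
- by have := H3 _ V3; rewrite ler_pdivrMr // mulrC.
Qed.

End PropertyBridge.

(** * Quasi-randomness as the cut condition, and the conclusion *)

Lemma quasi_random_cut (R : realType) (p : R) (G : graph_seq) : 0 <= p <= 1 ->
  quasi_random p G <->
  (forall c : R, 0 < c -> \forall n \near \oo%classic, cut_close (edge (G n)) p c).
Proof.
move=> p01; split=> [qr c c0|cut k H].
  pose eps := c ^+ 4 / 32; have eps0 : 0 < eps by rewrite divr_gt0 ?exprn_gt0.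
  have [N0 HN0] := exists_nat_ge (16 / eps).
  have big : \forall n \near \oo%classic, (maxn 1 N0 <= #|gvert G n|)%N.
    exact: (gvert_cvg G (nbhs_infty_ge _)).
  have cyc : \forall n \near \oo%classic, forall D : {set 'I_4},
      `|(N_hom (cycle_graph D) (G n))%:R - p ^+ #|D| * #|gvert G n|%:R ^+ 4| <=
      eps * #|gvert G n|%:R ^+ 4.
    (* The rate of convergence depends on the graph counted; as only sixteen graphs occur here, one
       threshold serves them all. *)
    apply: filter_forall => D; have [u u0 Hu] := qr 4 (cycle_graph D).
    move/cvgrPdist_le: u0 => /(_ eps eps0) u0.
    near=> n; have -> : (N_hom (cycle_graph D) (G n))%:R =
      (p ^+ num_edges (cycle_graph D) + u n) * #|gvert G n|%:R ^+ 4 by near: n.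
    rewrite num_edges_cycle mulrDl addrAC subrr add0r normrM (ger0_norm (exprn_ge0 _ _)) //.
    by rewrite ler_wpM2r ?exprn_ge0 // -normrN -[- u n]add0r; near: n.
  near=> n; have /andP[V0 VN] : (0 < #|gvert G n|)%N && (N0 <= #|gvert G n|)%N.
    by rewrite -geq_max; near: n.
  apply: (@cut_of_cycle_counts _ _ _ p eps) => //; first exact: ltW.
  - by rewrite /eps mulrC divfK.
  - by have := HN0 _ VN; rewrite ler_pdivrMr // mulrC.
  - by near: n.
pose N n : R := (N_hom H (G n))%:R.
exists (fun n => N n / #|gvert G n|%:R ^+ k - p ^+ num_edges H); last first.
  near=> n; have V0 : (0 < #|gvert G n|)%N.
    by near: n; exact: (gvert_cvg G (nbhs_infty_ge 1)).
  by rewrite addrC subrK divfK // expf_neq0 // pnatr_eq0 -lt0n.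
apply/cvgrPdist_le => eps eps0.
pose e : R := (num_edges H)%:R; have e0 : 0 <= e by rewrite /e.
pose eta := eps / 2 / (1 + e).
have eta0 : 0 < eta by rewrite !divr_gt0 // ltr_wpDr.
have [N0 HN0] := exists_nat_ge (k%:R ^+ 2 / (eps / 2)).
have big : \forall n \near \oo%classic, (maxn 1 N0 <= #|gvert G n|)%N.
  exact: (gvert_cvg G (nbhs_infty_ge _)).
near=> n; have /andP[V0 VN] : (0 < #|gvert G n|)%N && (N0 <= #|gvert G n|)%N.
  by rewrite -geq_max; near: n.
have cutn : cut_close (edge (G n)) p eta by near: n; apply: cut.
have := hom_count_of_cut (fun=> [set: gvert G n]%SET) V0 p01 cutn (edge_pairs_uniq H) (edge_pairs_lt H).
rewrite prodr_const card_ord cardsT size_edge_pairs.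
under eq_bigr => x _ do (rewrite big1 ?mulr1 => [|j _]; last by rewrite inE).
have := N_hom_hom_diff R (G n) H.
set S := \sum_x _; set v : R := #|gvert G n|%:R; rewrite -/(N n) -/e => le1 le2.
have v0 : 0 < v by rewrite ltr0n.
have vk0 : 0 < v ^+ k by rewrite exprn_gt0.
have kv : k%:R ^+ 2 <= eps / 2 * v.
  by have := HN0 _ VN; rewrite ler_pdivrMr ?divr_gt0 // mulrC.
have {}le1 : `|S - N n| <= eps / 2 * v ^+ k.
  rewrite -(ler_pM2r v0); apply: le_trans le1 _.
  by rewrite [leRHS]mulrAC ler_wpM2r // ltW.
have {}le2 : `|S - p ^+ num_edges H * v ^+ k| <= eps / 2 * v ^+ k.
  apply: le_trans le2 _; rewrite mulrA ler_wpM2r ?(ltW vk0) //.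
  rewrite /eta mulrA ler_pdivrMr ?ltr_wpDr // mulrC ler_wpM2l ?divr_ge0 ?(ltW eps0) //.
  by rewrite lerDr.
have -> : N n / v ^+ k - p ^+ num_edges H = (N n - p ^+ num_edges H * v ^+ k) / v ^+ k.
  by rewrite mulrBl mulfK // gt_eqF.
rewrite sub0r normrN normrM normfV (ger0_norm (ltW vk0)) ler_pdivrMr //.
rewrite -(subrKA S); apply: le_trans (ler_normD _ _) _; rewrite [`|N n - S|]distrC.
by apply: le_trans (lerD le1 le2) _; rewrite -mulrDl -splitr.
Unshelve. all: by end_near.
Qed.

Theorem theorem8p1 (R : realType) (m : nat) (F : sgraph 'I_m) (p : R)
    (r : nat) (alpha : 'rV[R]_r)
    (eF_gt0 : (0 < num_edges F)%N)
    (p_gt0 : 0 < p) (p_le1 : p <= 1)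
    (alpha_gt0 : forall i, 0 < alpha 0 i)
    (le_mr : (m <= r)%N)
    (alpha_sum : \sum_(i < r) alpha 0 i <= 1)
    (Halt : alpha <> const_mx (r%:R^-1) \/
            (1 < num_edges F)%N /\
            (regular_graph F \/ star_graph F \/ disconnected F)) :
  quasi_random_property p (P_tilde p F alpha).
Proof.
move=> G; have p01 : 0 <= p <= 1 by rewrite ltW.
rewrite (quasi_random_cut G p01); split=> [PG c c0|cut eps eps0].
  have Halt' : alpha <> const_mx (r%:R^-1) \/ (1 < num_edges F)%N.
    by case: Halt => [|[]]; [left|right].
  have [eps eps0 [n0 H]] :=
    cut_of_property eF_gt0 p_gt0 p_le1 alpha_gt0 le_mr alpha_sum Halt' c0.
  have big : \forall n \near \oo%classic, (n0 <= #|gvert G n|)%N.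
    exact: (gvert_cvg G (nbhs_infty_ge _)).
  by near=> n; apply: H; near: n => //; apply: PG.
have r0 : (0 < r)%N by apply: leq_trans le_mr; apply: ltnW; apply: order_gt1 eF_gt0.
have re0 : 0 < (r ^ m * num_edges F)%:R :> R by rewrite ltr0n muln_gt0 expn_gt0 r0.
have eta0 : 0 < eps / (r ^ m * num_edges F)%:R by rewrite divr_gt0.
near=> n => U dU _.
have V0 : (0 < #|gvert G n|)%N by near: n; exact: (gvert_cvg G (nbhs_infty_ge 1)).
have cutn : cut_close (edge (G n)) p (eps / (r ^ m * num_edges F)%:R).
  by near: n; apply: cut.
apply: le_trans (property_of_cut F V0 p01 cutn dU) _.
by rewrite mulrA mulrCA divff ?mulr1 // gt_eqF.
Unshelve. all: by end_near.
Qed.
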